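(* Let $\alpha>0$ and let $(Z_i)_{i\in\mathbb{Z}}$ be an i.i.d. sequence of real random variables such that $\Pr(|Z_1|>x)=x^{-\alpha}L(x)$ for $x>0$, where $L$ is slowly varying at infinity, and $$\lim_{x\to\infty}\frac{\Pr(Z_1>x)}{\Pr(|Z_1|>x)}=p,\qquad \lim_{x\to\infty}\frac{\Pr(Z_1<-x)}{\Pr(|Z_1|>x)}=r,$$ with $p\in[0,1]$ and $p+r=1$. Let $(a_n)$ be a sequence of positive real numbers with $n\Pr(|Z_1|>a_n)\to1$ as $n\to\infty$. Let $(C_i)_{i\ge0}$ be a sequence of random variables, independent of $(Z_i)_{i\in\mathbb{Z}}$, such that the series $$X_i=\sum_{j=0}^{\infty}C_jZ_{i-j},\qquad i\in\mathbb{Z},$$ is a.s. convergent. Suppose that: - if $\alpha\in(0,1)$, then $\sum_{j=0}^\infty\mathrm{E}|C_j|^{\delta}<\infty$ for some $\delta\in(0,\alpha)$ and $\sum_{j=0}^\infty\mathrm{E}|C_j|^{\gamma}<\infty$ for some $\gamma\in(\alpha,1)$; - if $\alpha=1$, then $\sum_{j=0}^\infty\mathrm{E}|C_j|^{\delta}<\infty$ for some $\delta\in(0,\alpha)$; - if $\alpha>1$, then $\sum_{j=0}^\infty\mathrm{E}|C_j|<\infty$. For $t\in[0,1]$ let $$M_n(t)=\frac{1}{a_n}\bigvee_{i=1}^{\lfloor nt\rfloor}X_i\ \text{ if } t\ge \tfrac1n,\qquad M_n(t)=\frac{X_1}{a_n}\ \text{ if } t<\tfrac1n .$$ Let $C_+=\max\{C_j\vee0: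 j\ge0\}$ and $C_-=\max\{-C_j\vee0: j\ge0\}$. Let $$M(t)=C^{(1)}W^{(1)}(t)\vee C^{(2)}W^{(2)}(t),\qquad t\in[0,1],$$ where $W^{(1)}$ and $W^{(2)}$ are independent extremal processes with exponent measures $p\alpha x^{-\alpha-1}1_{(0,\infty)}(x)\,dx$ and $r\alpha x^{-\alpha-1}1_{(0,\infty)}(x)\,dx$ respectively, and $(C^{(1)},C^{(2)})$ is a random vector independent of $(W^{(1)},W^{(2)})$ with the same distribution as $(C_+,C_-)$. Then, as $n\to\infty$, $$M_n(\cdot)\xrightarrow{d}M(\cdot)$$ in $D_\uparrow[0,1]$ with the Skorohod $M_1$ topology.
   Context: $a\vee b=\max\{a,b\}$; $-C_j\vee 0$ means $(-C_j)\vee 0$; $\xrightarrow{d}$ denotes convergence in distribution. $D_\uparrow[0,1]=D_\uparrow([0,1],\mathbb{R})$ is the set of non-decreasing right-continuous functions $x:[0,1]\to\mathbb{R}$ with left limits. The $M_1$ topology: for a càdlàg $x:[0,1]\to\mathbb{R}$ (with $x(0-)=x(0)$) let $\Gamma_x=\{(t,z)\in[0,1]\times\mathbb{R}: z=\lambda x(t-)+(1-\lambda)x(t)\text{ for some }\lambda\in[0,1]\}$, ordered by $(t_1,z_1)\le(t_2,z_2)$ if either $t_1<t_2$, or $t_1=t_2$ and $|x(t_1-)-z_1|\le|x(t_2-)-z_2|$. A parametric representation of $\Gamma_x$ is a continuous nondecreasing function $(\rho,u)$ mapping $[0,1]$ onto $\Gamma_x$ ($\rho$ is the time component, $u$ the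 spatial component); let $\Pi_s(x)$ be the set of these. The $M_1$ topology is induced by the metric $d_{M_1}(x_1,x_2)=\inf\{\sup_{s\in[0,1]}|\rho_1(s)-\rho_2(s)|\vee\sup_{s\in[0,1]}|u_1(s)-u_2(s)|:(\rho_i,u_i)\in\Pi_s(x_i),\,i=1,2\}$. An extremal process with exponent measure $\nu$ on $(0,\infty)$ is a process with the law of $t\mapsto\bigvee_{t_i\le t}j_i$, $t\in[0,1]$ (with $\bigvee\emptyset=0$), where $\sum_i\delta_{(t_i,j_i)}$ is a Poisson point process on $[0,1]\times(0,\infty)$ with intensity measure $\mathrm{Leb}\times\nu$. Convention: if $p=0$ then $W^{(1)}$ is the zero process, and if $r=0$ then $W^{(2)}$ is the zero process. *)

(* Defs.v *)
From HB Require Import structures.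
From mathcomp Require Import all_boot all_order all_algebra.
From mathcomp Require Import all_classical all_reals all_analysis.
From mathcomp Require Import measurable_realfun.

Set Implicit Arguments.
Unset Strict Implicit.
Unset Printing Implicit Defensive.

Import Order.TTheory GRing.Theory Num.Theory.
Import numFieldNormedType.Exports.

Local Open Scope classical_set_scope.
Local Open Scope ring_scope.

(* A path on [0, 1] is represented by a function on R of which only the
   restriction to [0, 1] matters: the conditions below, the distance [dM1],
   and hence the open sets of [D_up R], do not see the values outside. *)
Record D_up (R : realType) := MkD_up {
  D_up_fun :> R -> R;
  D_up_nondecreasing : forall s t, 0 <= s -> s <= t -> t <= 1 ->
    D_up_fun s <= D_up_fun t;
  D_up_right_continuous : forall t, 0 <= t < 1 ->
    D_up_fun s @[s --> t^'+] --> D_up_fun t;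
  D_up_left_limit : forall t, 0 < t <= 1 -> cvg (D_up_fun s @[s --> t^'-]) }.

HB.instance Definition _ (R : realType) := gen_eqMixin (D_up R).
HB.instance Definition _ (R : realType) := gen_choiceMixin (D_up R).

Section M1_topology.
Context {R : realType}.
Implicit Types x : D_up R.

(* x(t-), with x(0-) = x(0) *)
Definition left_lim (x : R -> R) (t : R) : R :=
  if t == 0 then x 0 else lim (x s @[s --> t^'-]).

Definition completed_graph (x : R -> R) : set (R * R) :=
  [set tz | 0 <= tz.1 <= 1 /\ exists2 l : R, 0 <= l <= 1 &
    tz.2 = l * left_lim x tz.1 + (1 - l) * x tz.1].

Definition graph_le (x : R -> R) (tz1 tz2 : R * R) : Prop :=
  tz1.1 < tz2.1 \/
  tz1.1 = tz2.1 /\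
    `|left_lim x tz1.1 - tz1.2| <= `|left_lim x tz2.1 - tz2.2|.

Definition parametric_representation (x : R -> R) (rho u : R -> R) : Prop :=
  [/\ {within `[0, 1], continuous rho}, {within `[0, 1], continuous u},
      forall s1 s2, 0 <= s1 -> s1 <= s2 -> s2 <= 1 ->
        graph_le x (rho s1, u s1) (rho s2, u s2) &
      [set (rho s, u s) | s in `[0, 1]] = completed_graph x].

Definition sup_dist (f g : R -> R) : \bar R :=
  ereal_sup [set `|f s - g s|%:E | s in `[0, 1]].

Definition dM1 (x1 x2 : R -> R) : \bar R :=
  ereal_inf [set e | exists rho1 u1 rho2 u2,
    [/\ parametric_representation x1 rho1 u1,
        parametric_representation x2 rho2 u2 &
        e = maxe (sup_dist rho1 rho2) (sup_dist u1 u2)]].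

(* [U] contains a dM1-ball around each of its points. *)
Definition M1_open (U : set (D_up R)) : Prop :=
  forall x, U x -> exists2 e : R, 0 < e &
    forall y : D_up R, (dM1 x y < e%:E)%E -> U y.

Lemma M1_openT : M1_open setT.
Proof. by move=> x _; exists 1. Qed.

Lemma M1_openI : setI_closed M1_open.
Proof.
move=> A B oA oB x [/oA[e e0 eA] /oB[f f0 fB]].
exists (Num.min e f); first by rewrite lt_min e0 f0.
move=> y; rewrite EFin_min lt_min => /andP[xe xf].
by split; [exact: eA|exact: fB].
Qed.

Lemma M1_open_bigU (I : Type) (f : I -> set (D_up R)) :
  (forall i, M1_open (f i)) -> M1_open (\bigcup_i f i).
Proof.
move=> of_ x [i _ /of_[e e0 ef]]; exists e => // y /ef fy; by exists i.
Qed.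

HB.instance Definition _ := isOpenTopological.Build (D_up R)
  M1_openT M1_openI M1_open_bigU.

End M1_topology.

Section probability_notions.
Context {R : realType} {d : measure_display} {Omega : measurableType d}.
Variable P : probability Omega R.

Definition random_element (X : Omega -> D_up R) : Prop :=
  forall U : set (D_up R), open U -> measurable (X @^-1` U).

(* The sigma-algebra generated by the X i, i in D. *)
Definition sigma_gen {I : Type} (D : set I) (X : I -> Omega -> R) :
    set (set Omega) :=
  <<s \bigcup_(i in D) preimage_set_system setT (X i) measurable >>.

Definition independent_sigma (F G : set (set Omega)) : Prop :=
  forall A B, F A -> G B -> P (A `&` B) = (P A * P B)%E.

Definition mutually_independent {d' : measure_display}
    {T : measurableType d'} {I : eqType} (X : I -> Omega -> T) : Prop :=
  forall (s : seq I) (B : I -> set T), uniq s ->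
    (forall i, measurable (B i)) ->
    P (\bigcap_(i in [set` s]) (X i @^-1` B i)) =
    (\prod_(i <- s) P (X i @^-1` B i))%E.

Definition identically_distributed {I : Type} (X : I -> Omega -> R) : Prop :=
  forall i j (B : set R), measurable B -> P (X i @^-1` B) = P (X j @^-1` B).

(* pts enumerates the (possibly finitely many) points of the process;
   [None] stands for no point. *)
Definition point_count {T : Type} (pts : nat -> Omega -> option T)
    (B : set T) (w : Omega) : \bar R :=
  (\sum_(0 <= i <oo) (if pts i w is Some z then (\1_B z)%:E else 0))%E.

(* The Poisson weights are written out because [poisson_pmf] is not the
   Poisson mass function at rate 0. *)
Definition poisson_point_process {d' : measure_display}
    {T : measurableType d'} (E : set T) (mu : set T -> \bar R)
    (pts : nat -> Omega -> option T) : Prop :=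
  [/\ forall i w z, pts i w = Some z -> E z,
      forall B, measurable B -> B `<=` E ->
        measurable_fun [set: Omega] (point_count pts B),
      forall B, measurable B -> B `<=` E -> (mu B < +oo)%E -> forall k : nat,
        P [set w | point_count pts B w = k%:R%:E] =
        (fine (mu B) ^+ k / k`!%:R * expR (- fine (mu B)))%:E,
      forall B, measurable B -> B `<=` E -> mu B = +oo%E ->
        P [set w | point_count pts B w = +oo%E] = 1%E &
      forall (n : nat) (B : 'I_n -> set T),
        (forall i, measurable (B i) /\ B i `<=` E) -> trivIset setT B ->
        mutually_independent (fun i => point_count pts (B i))].

Definition running_sup (pts : nat -> Omega -> option (R * R)) (w : Omega)
    (t : R) : \bar R :=
  maxe 0%E (ereal_sup
    [set e | exists i s j, [/\ pts i w = Some (s, j), s <= t & e = j%:E]]).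

End probability_notions.

Section extremal_process.
Context {R : realType}.

(* c alpha x^{-alpha-1} 1_{(0,oo)}(x) dx *)
Definition exponent_measure (c alpha : R) : set R -> \bar R := fun A =>
  (\int[lebesgue_measure]_(x in A)
    (c * alpha * x `^ (- alpha - 1) * \1_`]0, +oo[%classic x)%:E)%E.

(* Equality in law with the running supremum of a Poisson point process,
   possibly living on another probability space, is equality of
   finite-dimensional distributions. *)
Definition extremal_process {d : measure_display} {Omega : measurableType d}
    (P : probability Omega R) (nu : set R -> \bar R)
    (W : Omega -> D_up R) : Prop :=
  (forall t, 0 <= t <= 1 -> measurable_fun [set: Omega] (fun w => W w t)) /\
  exists (d' : measure_display) (T : measurableType d') (Q : probability T R)
      (pts : nat -> T -> option (R * R)),
    poisson_point_process Q [set tj : R * R | 0 <= tj.1 <= 1 /\ 0 < tj.2]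
      (lebesgue_measure \x nu)%E pts /\
    forall (s : seq R) (B : R -> set R),
      (forall t, t \in s -> 0 <= t <= 1) -> (forall t, measurable (B t)) ->
      P [set w | forall t, t \in s -> B t (W w t)] =
      Q [set w | forall t, t \in s -> (EFin @` B t) (running_sup pts w t)].

(* The extremal process with exponent measure
   c alpha x^{-alpha-1} 1_{(0,oo)}(x) dx, the zero process if c = 0. *)
Definition stable_extremal_process {d : measure_display}
    {Omega : measurableType d} (P : probability Omega R) (c alpha : R)
    (W : Omega -> D_up R) : Prop :=
  if c == 0 then forall w t, 0 <= t <= 1 -> W w t = 0
  else extremal_process P (exponent_measure c alpha) W.

End extremal_process.

Section convergence_in_distribution.
Context {R : realType}.
Context {d : measure_display} {Omega : measurableType d}.
Context {d' : measure_display} {Omega' : measurableType d'}.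

Definition cvg_in_distribution (P : probability Omega R)
    (P' : probability Omega' R) (X : nat -> Omega -> D_up R)
    (Y : Omega' -> D_up R) : Prop :=
  [/\ forall n, random_element (X n), random_element Y &
      forall f : D_up R -> R, continuous f ->
        [bounded f x | x in [set: D_up R]] ->
        ('E_P[f \o X n] @[n --> \oo] --> 'E_P'[f \o Y])%E].

End convergence_in_distribution.

Definition slowly_varying {R : realType} (L : R -> R) : Prop :=
  (\forall x \near +oo, 0 < L x) /\
  forall c : R, 0 < c -> L (c * x) / L x @[x --> +oo] --> (1 : R).

Section linear_process.
Context {R : realType} {Omega : Type}.
Variables (C : nat -> Omega -> R) (Z : int -> Omega -> R).

Definition linear_terms (i : int) (w : Omega) : nat -> R :=
  fun j => C j w * Z (i - j%:Z) w.

Definition linear_process (i : int) (w : Omega) : R :=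
  limn (series (linear_terms i w)).

Definition C_plus (w : Omega) : R :=
  sup [set Num.max (C j w) 0 | j in [set: nat]].

Definition C_minus (w : Omega) : R :=
  sup [set Num.max (- C j w) 0 | j in [set: nat]].

End linear_process.

Section partial_maxima.
Context {R : realType}.
Variables (a : R) (n : nat) (X : int -> R).

(* The default value X 1 of the iterated maximum is one of its terms as soon
   as 1/n <= t. *)
Definition maxima_fun (t : R) : R :=
  if n%:R^-1 <= t
  then a^-1 * \big[Num.max/X 1]_(1 <= i < (Num.truncn (n%:R * t)).+1) X i%:Z
  else X 1 / a.

Definition scaled_max (k : nat) : R :=
  a^-1 * \big[Num.max/X 1]_(1 <= i < k.+1) X i%:Z.

Lemma maxima_funE t : maxima_fun t = scaled_max (Num.truncn (n%:R * t)).
Proof.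
rewrite /maxima_fun /scaled_max; case: ifPn => //; rewrite -ltNge => tn.
have [n0|n0] := posnP n.
  by rewrite n0 mul0r truncn0 big_nil mulrC.
suff -> : Num.truncn (n%:R * t) = 0%N by rewrite big_nil mulrC.
apply/eqP; rewrite -leqn0 truncn_le_nat.
by rewrite mulrC -ltr_pdivlMr ?ltr0n// mul1r.
Qed.

Hypothesis a_gt0 : 0 < a.

Lemma scaled_max_homo k l : (k <= l)%N -> scaled_max k <= scaled_max l.
Proof. by move=> kl; rewrite ler_pM2l ?invr_gt0//; exact: le_bigmax_nat. Qed.

Lemma maxima_fun_homo s t : s <= t -> maxima_fun s <= maxima_fun t.
Proof.
move=> st; rewrite !maxima_funE; apply: scaled_max_homo.
by apply: le_truncn; rewrite ler_wpM2l.
Qed.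

Lemma maxima_fun_right_continuous t : 0 <= t < 1 ->
  maxima_fun s @[s --> t^'+] --> maxima_fun t.
Proof.
move=> /andP[t0 _]; apply: cvg_near_cst; have [n0|n0] := posnP n.
  by apply: nearW => s; rewrite !maxima_funE n0 !mul0r.
have /andP[lo hi] : (Num.truncn (n%:R * t))%:R <= n%:R * t <
    (Num.truncn (n%:R * t)).+1%:R by rewrite truncn_itv// mulr_ge0.
near=> s; rewrite !maxima_funE; congr (scaled_max _); apply: truncn_def.
rewrite (le_trans lo)/=; last by rewrite ler_wpM2l// ltW.
rewrite mulrC -ltr_pdivlMr ?ltr0n//; near: s; apply: nbhs_right_lt.
by rewrite ltr_pdivlMr ?ltr0n// mulrC.
Unshelve. all: by end_near. Qed.

Lemma maxima_fun_left_limit t : 0 < t <= 1 -> cvg (maxima_fun s @[s --> t^'-]).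
Proof.
move=> _; apply: nondecreasing_at_left_is_cvgr.
  by apply: nearW => x y z _ _; exact: maxima_fun_homo.
apply: nearW => x; exists (maxima_fun t) => _ [y /= yx <-].
by apply: maxima_fun_homo; move: yx; rewrite in_itv/= => /andP[_ /ltW].
Qed.

Definition maxima_path : D_up R :=
  MkD_up (fun s t _ st _ => maxima_fun_homo st)
    maxima_fun_right_continuous maxima_fun_left_limit.

End partial_maxima.

(* Main.v *)
Require Import Defs.
From HB Require Import structures.
From mathcomp Require Import all_boot all_order all_algebra.
From mathcomp Require Import all_classical all_reals all_analysis.
From mathcomp Require Import measurable_realfun.
From mathcomp Require Import ring lra zify.

Set Implicit Arguments.
Unset Strict Implicit.
Unset Printing Implicit Defensive.

Import Order.TTheory GRing.Theory Num.Theory.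
Import numFieldNormedType.Exports.

Local Open Scope classical_set_scope.
Local Open Scope ring_scope.

(** The partial maxima of the linear process inherit their limit from the
    principle of one large innovation. At the scale [a n] only finitely many of
    the innovations up to time [n] are visible, and they are far apart, so that
    a large innovation [z] at time [k] enters the process with the successive
    weights [C 0, C 1, C 2, ...] and raises the running maximum by the largest
    of the products [C j * z]. This is [C_plus * z] when [z] is positive and
    [C_minus * - z] when it is negative; both cases are recorded by [jump].
    Hence the running maximum differs little from the running maximum of the
    jumps ([single_jump] path by path, [jump_approximation] in probability).
    The innovations that meet the coefficients beyond a large index [m] are
    dismissed by [far_event_negligible], which uses the one summable moment of
    order [delta < alpha], [delta <= 1], of the coefficients.

    Given the coefficients, the jumps are independent and identically
    distributed with a regularly varying tail, so that the classical Poisson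
    limit for maxima over the blocks of a grid applies
    ([block_probability_cvg]); averaging over the coefficients gives
    [jump_maximum_cdf_cvg]. On the side of the limit, the event that an extremal
    process stays below a nondecreasing step function is the event that a
    Poisson process has no point above the steps, and its probability is
    [extremal_cdf]. Averaging over [C1] and [C2] gives the same mixture of
    Frechet probabilities ([positive_max_cdf_law]). So the finite-dimensional
    distribution functions at grid points converge.

    This is enough because the paths are nondecreasing. Two monotone paths that
    are close at the points [l / K] are close in the M1 distance ([dM1_le]):
    between grid points they can only differ by a delay [1 / K] in time, which
    M1 forgives, whatever their jumps. Therefore the space is covered, up to a
    small M1 distance, by cells that prescribe the values at grid points up to
    [1 / K], and the convergence of the probabilities of the cells controls the
    expectations of continuous functions ([cvg_in_distribution_fidi]). *)

(** * The M1 distance between nondecreasing paths *)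
Section m1_geometry.
Context {R : realType}.
Implicit Types (x y : D_up R) (s t v w a b c e h : R).

Lemma lipschitz_continuous (k : R) (f : R -> R) : 0 < k ->
  (forall s t, `|f s - f t| <= k * `|s - t|) -> continuous f.
Proof.
move=> k0 fk s; apply/cvgrPdist_lt => e e0; near=> t.
rewrite (le_lt_trans (fk _ _))// -ltr_pdivlMl//.
near: t; apply: (@nbhsx_ballx _ R s (k^-1 * e)).
by rewrite mulr_gt0 ?invr_gt0.
Unshelve. all: by end_near. Qed.

Lemma left_lim_ge x s t : 0 <= s -> s < t -> t <= 1 -> x s <= left_lim x t.
Proof.
move=> s0 st t1; have t0 : 0 < t by exact: le_lt_trans st.
rewrite /left_lim gt_eqF//; apply: limr_ge.
  by apply: D_up_left_limit; rewrite t0.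
near=> r; apply: D_up_nondecreasing => //.
- by near: r; apply: nbhs_left_ge.
- by rewrite (le_trans _ t1)// ltW//; near: r; exact: nbhs_left_lt.
Unshelve. all: by end_near. Qed.

Lemma left_lim_le x t c : 0 < t <= 1 ->
  (forall s, 0 <= s -> s < t -> x s <= c) -> left_lim x t <= c.
Proof.
move=> /andP[t0 t1] xc; rewrite /left_lim gt_eqF//; apply: limr_le.
  by apply: D_up_left_limit; rewrite t0.
near=> r; apply: xc.
  by near: r; apply: nbhs_left_ge.
by near: r; exact: nbhs_left_lt.
Unshelve. all: by end_near. Qed.

Lemma left_lim_le_self x t : 0 <= t <= 1 -> left_lim x t <= x t.
Proof.
move=> /andP[]; rewrite le_eqVlt => /predU1P[<- _|t0 t1].
  by rewrite /left_lim eqxx.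
apply: left_lim_le; first by rewrite t0.
by move=> s s0 st; apply: D_up_nondecreasing => //; exact: ltW.
Qed.

(** The generalised inverse of [t + x t]. The point [0] is put in the set so
    that the supremum is taken over a nonempty set for every [v]. *)
Definition m1_time x v : R :=
  sup [set t | t = 0 \/ 0 <= t <= 1 /\ t + x t <= v].

Lemma m1_time_le x v c : 0 <= c ->
  (forall t, 0 <= t <= 1 -> t + x t <= v -> t <= c) -> m1_time x v <= c.
Proof.
move=> c0 tc; apply: ge_sup; first by exists 0; left.
by move=> t [->//|[t01 tv]]; exact: tc.
Qed.

Let m1_ubound x v :
  has_ubound [set t | t = 0 \/ 0 <= t <= 1 /\ t + x t <= v].
Proof. by exists 1 => t [->//|[/andP[]]]. Qed.

Lemma m1_time_ge x v t : 0 <= t <= 1 -> t + x t <= v -> t <= m1_time x v.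
Proof. by move=> t01 tv; apply: ub_le_sup => //; right. Qed.

Lemma m1_time_itv x v : 0 <= m1_time x v <= 1.
Proof.
rewrite m1_time_le ?andbT//; first by apply: ub_le_sup => //; left.
by move=> t /andP[].
Qed.

Lemma m1_time_homo x : {homo m1_time x : v w / v <= w}.
Proof.
move=> v w vw; apply: m1_time_le.
  by have /andP[] := m1_time_itv x w.
by move=> t t01 tv; apply: m1_time_ge => //; exact: le_trans vw.
Qed.

(** Together with [m1_time_right]: the level [v] is passed by [t + x t] at the
    time [q := m1_time x v], possibly by a jump, so [v - q] lies between the left
    limit and the value of [x] at [q], that is, on the completed graph. *)
Lemma m1_time_left x v : x 0 <= v ->
  m1_time x v + left_lim x (m1_time x v) <= v.
Proof.
move=> x0v; have /andP[] := m1_time_itv x v.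
set q := m1_time x v; rewrite le_eqVlt => /predU1P[<- _|q0 q1].
  by rewrite add0r /left_lim eqxx.
rewrite -lerBrDl; apply: left_lim_le; first by rewrite q0.
move=> s s0 sq; apply/ler_addgt0Pr => e e0.
have [||t [->|[/andP[t0 t1] tv]]] :=
    @sup_adherent _ [set t | t = 0 \/ 0 <= t <= 1 /\ t + x t <= v]
      (Num.min e (q - s)).
- by rewrite lt_min e0 subr_gt0.
- by split; [exists 0; left|exact: m1_ubound].
- rewrite -/(m1_time x v) -/q ltrBlDr add0r lt_min => /andP[_].
  by rewrite ltrBrDl -ltrBrDr subrr ltNge s0.
rewrite -/(m1_time x v) -/q ltrBlDr -ltrBlDl lt_min => /andP[qe].
rewrite ltrD2l ltrN2 => st.
have xst : x s <= x t by exact: D_up_nondecreasing (ltW st) t1.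
lra.
Qed.

Lemma m1_time_right x v : v <= 1 + x 1 -> v <= m1_time x v + x (m1_time x v).
Proof.
move=> v1; have /andP[] := m1_time_itv x v.
set q := m1_time x v => q0; rewrite le_eqVlt => /predU1P[->//|q1].
have qx : (s + x s) @[s --> q^'+] --> q + x q.
  apply: cvgD; last by apply: D_up_right_continuous; rewrite q0.
  exact: cvg_at_right_filter.
apply: (cvgr_to_ge qx).
near=> s; rewrite leNgt; apply/negP => /ltW /m1_time_ge sq.
have : s <= q.
  apply: sq; apply/andP; split.
    by rewrite (le_trans q0)// ltW//; near: s; exact: nbhs_right_gt.
  by near: s; exact: nbhs_right_le.
by rewrite leNgt => /negP; apply; near: s; exact: nbhs_right_gt.
Unshelve. all: by end_near. Qed.

Lemma m1_time_graph x t z : 0 <= t <= 1 -> left_lim x t <= z <= x t ->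
  m1_time x (t + z) = t.
Proof.
move=> /andP[t0 t1] /andP[lz zx]; apply/eqP; rewrite eq_le; apply/andP; split.
  apply: m1_time_le => // s /andP[s0 s1]; rewrite leNgt => sxs.
  rewrite leNgt; apply/negP => ts.
  have xts : x t <= x s by exact: D_up_nondecreasing (ltW ts) s1.
  lra.
rewrite leNgt; apply/negP.
set q := m1_time _ _ => qt; have /andP[q0 q1] := m1_time_itv x (t + z).
rewrite -/q in q0 q1.
have st : q < (q + t) / 2 < t by apply/andP; split; lra.
have s0 : 0 <= (q + t) / 2 by lra.
move: st; set s := (q + t) / 2 in s0 * => /andP[qs st].
have := left_lim_ge x s0 st t1 => xs.
have : s <= q; last by rewrite leNgt qs.
apply: m1_time_ge; first by rewrite s0 (le_trans (ltW st)).
lra.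
Qed.

(** The path does not decrease between the two times, so the time component
    takes at most the increment of the sum [v]; this makes the spatial component
    [v - m1_time x v] nondecreasing. *)
Lemma m1_time_le_diff x v w : x 0 <= v -> v <= w -> w <= 1 + x 1 ->
  m1_time x w - m1_time x v <= w - v.
Proof.
move=> xv vw w1; have := m1_time_homo x vw.
rewrite le_eqVlt => /predU1P[->|qq]; first by rewrite subrr subr_ge0.
have /andP[q0 _] := m1_time_itv x v.
have /andP[_ q1] := m1_time_itv x w.
have := left_lim_ge x q0 qq q1.
have := m1_time_left (le_trans xv vw).
have := m1_time_right (le_trans vw w1).
lra.
Qed.

(** The sum of the coordinates along the completed graph of [x] ranges over
    [x 0, 1 + x 1]. Clamping to this interval lets two paths share a parameter. *)
Definition m1_clamp x v : R := Num.max (x 0) (Num.min v (1 + x 1)).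

Lemma m1_clampP x v : [\/ v <= x 0 /\ m1_clamp x v = x 0,
  x 0 <= v <= 1 + x 1 /\ m1_clamp x v = v |
  1 + x 1 <= v /\ m1_clamp x v = 1 + x 1].
Proof.
have x01 : x 0 <= x 1 by apply: D_up_nondecreasing.
rewrite /m1_clamp; have [v1|/ltW v1] := leP v (1 + x 1); last first.
  by apply: Or33; split => //; apply/max_idPr; lra.
have [v0|/ltW v0] := leP (x 0) v; last by apply: Or31.
by apply: Or32; split => //; rewrite v0.
Qed.

Lemma m1_clamp_itv x v : x 0 <= m1_clamp x v <= 1 + x 1.
Proof.
have x01 : x 0 <= x 1 by apply: D_up_nondecreasing.
by case: (m1_clampP x v) => -[? ->]; lra.
Qed.

Lemma m1_clamp_homo x : {homo m1_clamp x : v w / v <= w}.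
Proof.
have x01 : x 0 <= x 1 by apply: D_up_nondecreasing.
move=> v w vw; case: (m1_clampP x v) => -[? ->];
  case: (m1_clampP x w) => -[? ->]; lra.
Qed.

Lemma m1_clamp_dist x v w : `|m1_clamp x v - m1_clamp x w| <= `|v - w|.
Proof.
have x01 : x 0 <= x 1 by apply: D_up_nondecreasing.
wlog vw : v w / v <= w => [h|].
  by have [/h//|/ltW/h] := leP v w; rewrite distrC [leRHS]distrC.
rewrite distrC [leRHS]distrC !ger0_norm ?subr_ge0//; last exact: m1_clamp_homo.
by case: (m1_clampP x v) => -[? ->]; case: (m1_clampP x w) => -[? ->]; lra.
Qed.

Lemma m1_clamp_id x v : x 0 <= v <= 1 + x 1 -> m1_clamp x v = v.
Proof. by move=> ?; case: (m1_clampP x v) => -[? ->]; lra. Qed.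

Definition m1_rho x v : R := m1_time x (m1_clamp x v).
Definition m1_u x v : R := m1_clamp x v - m1_rho x v.

Lemma m1_rho_homo x : {homo m1_rho x : v w / v <= w}.
Proof. by move=> v w vw; apply: m1_time_homo; exact: m1_clamp_homo. Qed.

Lemma m1_u_homo x : {homo m1_u x : v w / v <= w}.
Proof.
move=> v w vw; rewrite /m1_u /m1_rho.
have /andP[v0 v1] := m1_clamp_itv x v; have /andP[w0 w1] := m1_clamp_itv x w.
have := m1_time_le_diff v0 (m1_clamp_homo x vw) w1; lra.
Qed.

Lemma m1_rho_dist x v w : `|m1_rho x v - m1_rho x w| <= `|v - w|.
Proof.
apply: le_trans (m1_clamp_dist x v w).
wlog vw : v w / v <= w => [h|].
  by have [/h//|/ltW/h] := leP v w; rewrite distrC [leRHS]distrC.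
have := m1_u_homo x vw; have := m1_rho_homo x vw; rewrite /m1_u => ? ?.
by rewrite distrC [leRHS]distrC !ger0_norm ?subr_ge0; lra.
Qed.

Lemma m1_u_dist x v w : `|m1_u x v - m1_u x w| <= `|v - w|.
Proof.
apply: le_trans (m1_clamp_dist x v w).
wlog vw : v w / v <= w => [h|].
  by have [/h//|/ltW/h] := leP v w; rewrite distrC [leRHS]distrC.
have := m1_u_homo x vw; have := m1_rho_homo x vw; rewrite /m1_u => ? ?.
by rewrite distrC [leRHS]distrC !ger0_norm ?subr_ge0; lra.
Qed.

Lemma m1_u_itv x v :
  left_lim x (m1_rho x v) <= m1_u x v <= x (m1_rho x v).
Proof.
have /andP[v0 v1] := m1_clamp_itv x v; rewrite /m1_u.
have := m1_time_left v0; have := m1_time_right v1; rewrite -/(m1_rho x v); lra.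
Qed.

Lemma completed_graph_itv x t z : 0 <= t <= 1 ->
  completed_graph x (t, z) <-> left_lim x t <= z <= x t.
Proof.
move=> t01; have lx := left_lim_le_self x t01; split=> [[_ /= [l l01 ->]]|].
  by apply/andP; split; nra.
move=> /andP[lz zx]; split => //=.
move: lx; rewrite le_eqVlt => /predU1P[lx|lx].
  by exists 0; [rewrite lexx ler01|lra].
have d0 : 0 < x t - left_lim x t by rewrite subr_gt0.
exists ((x t - z) / (x t - left_lim x t)).
  by rewrite divr_ge0 ?subr_ge0//= ?ler_pdivrMr ?mul1r ?lerD2l ?lerN2// ltW.
by field; rewrite gt_eqF.
Qed.

(** A nondecreasing path is parametrised by the sum of the two coordinates on
    its completed graph, along which both are nondecreasing and 1-Lipschitz.
    Any interval containing [x 0, 1 + x 1] can serve as the common domain of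
    two such parametrisations. *)
Lemma m1_parametric x a b : 0 < b -> a <= x 0 -> 1 + x 1 <= a + b ->
  parametric_representation x (fun s => m1_rho x (a + s * b))
    (fun s => m1_u x (a + s * b)).
Proof.
move=> b0 ax xb.
have cont (f : R -> R) : (forall v w, `|f v - f w| <= `|v - w|) ->
    {within `[0, 1]%classic, continuous (fun s => f (a + s * b))}.
  move=> f1; apply: continuous_subspaceT; apply: (lipschitz_continuous b0).
  move=> s t; rewrite (le_trans (f1 _ _))//.
  have -> : a + s * b - (a + t * b) = b * (s - t) by ring.
  by rewrite normrM gtr0_norm.
split.
- exact/cont/m1_rho_dist.
- exact/cont/m1_u_dist.
- move=> s1 s2 _ s12 _.
  have v12 : a + s1 * b <= a + s2 * b by rewrite lerD2l ler_pM2r.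
  have := m1_rho_homo x v12; rewrite le_eqVlt => /predU1P[rr|]; last by left.
  right => /=; split => //.
  have /andP[l1 _] := m1_u_itv x (a + s1 * b).
  have /andP[l2 _] := m1_u_itv x (a + s2 * b).
  have u12 := m1_u_homo x v12.
  rewrite distrC [leRHS]distrC !ger0_norm ?subr_ge0 -?rr//; last first.
    by rewrite rr.
  by rewrite lerB.
- apply/seteqP; split=> [_ [s _ <-]|[t z] tz].
    apply/completed_graph_itv; first exact: m1_time_itv.
    exact: m1_u_itv.
  have /= t01 := tz.1; move: tz => /(completed_graph_itv _ _ t01) lzx.
  have zt : x 0 <= t + z <= 1 + x 1.
    move: lzx t01 => /andP[lz zx] /andP[t0 t1].
    have xt1 : x t <= x 1 by apply: D_up_nondecreasing.
    rewrite (lerD t1 (le_trans zx xt1)) andbT.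
    rewrite -(add0r (x 0)) lerD// (le_trans _ lz)//.
    move: t0; rewrite le_eqVlt => /predU1P[<-|t0].
      by rewrite /left_lim eqxx.
    exact: left_lim_ge.
  exists ((t + z - a) / b).
    rewrite /= in_itv/= ler_pdivlMr// ler_pdivrMr// mul0r mul1r.
    by apply/andP; split; lra.
  rewrite divfK ?gt_eqF// addrC subrK /m1_u /m1_rho m1_clamp_id//.
  by rewrite m1_time_graph// [t + z]addrC addrK.
Qed.

Lemma m1_clamp_close x y e v : `|x 0 - y 0| <= e -> `|x 1 - y 1| <= e ->
  `|m1_clamp x v - m1_clamp y v| <= e.
Proof.
have x01 : x 0 <= x 1 by apply: D_up_nondecreasing.
have y01 : y 0 <= y 1 by apply: D_up_nondecreasing.
rewrite !ler_norml => ? ?.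
by case: (m1_clampP x v) => -[? ->]; case: (m1_clampP y v) => -[? ->]; lra.
Qed.

(** If [x] dominates [y] up to [e] after a delay [h], then [t + x t] passes the
    level [v + e] at most [h + 2 * e] later than [t + y t] passes [v]. *)
Lemma m1_rho_close x y h e v : 0 <= h -> 0 <= e ->
  (forall s t, 0 <= s -> s + h <= t -> t <= 1 -> y s <= x t + e) ->
  m1_clamp x v <= m1_clamp y v + e ->
  m1_rho x v <= m1_rho y v + (h + 2 * e).
Proof.
move=> h0 e0 yx xyv; have /andP[q0 _] := m1_time_itv y (m1_clamp y v).
apply: m1_time_le => [|t /andP[t0 t1] tx]; first by rewrite /m1_rho; lra.
have [s0|s0] := leP 0 (t - (h + 2 * e)); last by rewrite /m1_rho; lra.
rewrite -lerBlDr; apply: m1_time_ge; first by apply/andP; split; lra.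
have : y (t - (h + 2 * e)) <= x t + e by apply: yx => //; lra.
lra.
Qed.

(** Both completed graphs are parametrised by the sum of the coordinates over a
    common interval. The time components then differ by [h + 2 * e], and the
    clamped sums by [e], which leaves [h + 3 * e] for the spatial components. *)
Lemma dM1_le x y h e : 0 <= h -> 0 <= e ->
  `|x 0 - y 0| <= e -> `|x 1 - y 1| <= e ->
  (forall s t, 0 <= s -> s + h <= t -> t <= 1 ->
    x s <= y t + e /\ y s <= x t + e) ->
  (dM1 x y <= (h + 3 * e)%:E)%E.
Proof.
move=> h0 e0 xy0 xy1 xy.
have x01 : x 0 <= x 1 by apply: D_up_nondecreasing.
have y01 : y 0 <= y 1 by apply: D_up_nondecreasing.
pose a := Num.min (x 0) (y 0); pose b : R := 1 + Num.max (x 1) (y 1) - a.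
have [ax ay] : a <= x 0 /\ a <= y 0 by rewrite /a !ge_min !lexx orbT.
have [xb yb] : 1 + x 1 <= a + b /\ 1 + y 1 <= a + b.
  by rewrite /b [a + _]addrC subrK !lerD2l !le_max !lexx orbT.
have b0 : 0 < b by lra.
have cl v := m1_clamp_close v xy0 xy1.
have rho v : `|m1_rho x v - m1_rho y v| <= h + 2 * e.
  have := cl v; rewrite !ler_norml => clv.
  have : m1_rho x v <= m1_rho y v + (h + 2 * e).
    apply: m1_rho_close => //; last by lra.
    by move=> s t s0 st t1; have [] := xy _ _ s0 st t1.
  have : m1_rho y v <= m1_rho x v + (h + 2 * e).
    apply: m1_rho_close => //; last by lra.
    by move=> s t s0 st t1; have [] := xy _ _ s0 st t1.
  lra.
apply: le_trans (_ : (maxe (sup_dist (fun s => m1_rho x (a + s * b))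
    (fun s => m1_rho y (a + s * b))) (sup_dist (fun s => m1_u x (a + s * b))
    (fun s => m1_u y (a + s * b))) <= _)%E).
  apply: ereal_inf_lbound.
  exists (fun s => m1_rho x (a + s * b)), (fun s => m1_u x (a + s * b)),
    (fun s => m1_rho y (a + s * b)), (fun s => m1_u y (a + s * b)).
  by split => //; exact: m1_parametric.
rewrite ge_max; apply/andP; split; apply: ge_ereal_sup => _ [s _ <-];
    rewrite lee_fin.
  by rewrite (le_trans (rho _))//; lra.
have := cl (a + s * b); have := rho (a + s * b).
rewrite /m1_u !ler_norml; lra.
Qed.

End m1_geometry.

(** * Events, probabilities and bounded convergence *)
Lemma cvgn_sum {R : realType} (I : Type) (r : seq I) (f : I -> nat -> R)
    (a : I -> R) : (forall i, f i n @[n --> \oo] --> a i) ->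
  (\sum_(i <- r) f i n) @[n --> \oo] --> \sum_(i <- r) a i.
Proof.
move=> fa; elim: r => [|i r IH].
  by rewrite big_nil; under eq_fun do rewrite big_nil; exact: cvg_cst.
by rewrite big_cons; under eq_fun do rewrite big_cons; exact: cvgD.
Qed.

Lemma cvgn_prod {R : realType} (I : Type) (r : seq I) (f : I -> nat -> R)
    (a : I -> R) : (forall i, f i n @[n --> \oo] --> a i) ->
  (\prod_(i <- r) f i n) @[n --> \oo] --> \prod_(i <- r) a i.
Proof.
move=> fa; elim: r => [|i r IH].
  by rewrite big_nil; under eq_fun do rewrite big_nil; exact: cvg_cst.
by rewrite big_cons; under eq_fun do rewrite big_cons; exact: cvgM.
Qed.

Section measurability_of_sets.
Context {d : measure_display} {T : measurableType d} {R : realType}.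
Implicit Types f g : T -> R.

Lemma measurable_set_le f g : measurable_fun [set: T] f ->
  measurable_fun [set: T] g -> measurable [set w | f w <= g w].
Proof.
by move=> mf mg; rewrite -[X in measurable X]setTI; exact: measurable_fun_le.
Qed.

Lemma measurable_set_lt f g : measurable_fun [set: T] f ->
  measurable_fun [set: T] g -> measurable [set w | f w < g w].
Proof.
move=> mf mg; rewrite (_ : mkset _ = ~` [set w | g w <= f w]).
  by apply: measurableC; exact: measurable_set_le.
by apply/seteqP; split=> w /=; rewrite leNgt; [move=> ->|move/negP/negPn].
Qed.

Lemma measurable_forall (I : countType) (D : set I) (A : I -> set T) :
  (forall i, D i -> measurable (A i)) ->
  measurable [set w | forall i, D i -> A i w].
Proof.
move=> mA; rewrite (_ : mkset _ = ~` \bigcup_i [set w | D i /\ ~ A i w]).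
  apply: measurableC; apply: countable_bigcupT_measurable => // i.
  have [Di|Di] := pselect (D i).
    rewrite (_ : mkset _ = ~` A i); first exact/measurableC/mA.
    by apply/seteqP; split=> w /=; [case|].
  rewrite (_ : mkset _ = set0)//.
  by apply/seteqP; split=> w // -[].
apply/seteqP; split=> w /=.
  by move=> Aw [i _ [/Aw]].
by move=> nA i Di; apply: contrapT => Aiw; apply: nA; exists i.
Qed.

Lemma measurable_forallT (I : countType) (A : I -> set T) :
  (forall i, measurable (A i)) -> measurable [set w | forall i, A i w].
Proof.
move=> mA; rewrite (_ : mkset _ = [set w | forall i, [set: I] i -> A i w]).
  by apply: measurable_forall.
by apply/seteqP; split=> w Aw i //; exact: Aw.
Qed.

Lemma measurable_set_andb (a b : pred T) : measurable [set w | a w] ->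
  measurable [set w | b w] -> measurable [set w | a w && b w].
Proof.
move=> ma mb; rewrite (_ : mkset _ = [set w | a w] `&` [set w | b w]).
  exact: measurableI.
by apply/seteqP; split=> w /=; [move/andP|move=> [-> ->]].
Qed.

End measurability_of_sets.

Section probability_in_R.
Context {d : measure_display} {T : measurableType d} {R : realType}.
Variable P : probability T R.

Lemma probabilityE (A : set T) : measurable A -> P A = (fine (P A))%:E.
Proof. by move=> mA; rewrite fineK// fin_num_measure. Qed.

Lemma le_fine_probability (A B : set T) : measurable A -> measurable B ->
  A `<=` B -> fine (P A) <= fine (P B).
Proof.
move=> mA mB AB; rewrite fine_le ?fin_num_measure//.
by apply: le_measure; rewrite ?inE.
Qed.

Lemma fine_probabilityU (A B : set T) : measurable A -> measurable B ->
  fine (P (A `|` B)) <= fine (P A) + fine (P B).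
Proof.
move=> mA mB; rewrite -fineD ?fin_num_measure// fine_le//.
- by rewrite fin_num_measure//; exact: measurableU.
- by rewrite fin_numD !fin_num_measure.
- exact: measureU2.
Qed.

Lemma fine_probability_ge0 (A : set T) : 0 <= fine (P A).
Proof. by rewrite fine_ge0. Qed.

Lemma fine_probability_le1 (A : set T) : measurable A -> fine (P A) <= 1.
Proof.
by move=> mA; rewrite -lee_fin -probabilityE//; exact: probability_le1.
Qed.

Lemma bounded_measurable_integrable (f : T -> R) (B : R) :
  measurable_fun [set: T] f -> (forall w, `|f w| <= B) ->
  P.-integrable [set: T] (EFin \o f).
Proof.
move=> mf fB; apply: measurable_bounded_integrable => //.
  by rewrite -ge0_fin_numE// fin_num_measure.
exists B; split; first exact: num_real.
by move=> M BM w _ /=; rewrite (le_trans (fB w))// ltW.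
Qed.

Lemma bounded_convergence (f_ : nat -> T -> R) (f : T -> R) (B : R) :
  (forall n, measurable_fun [set: T] (f_ n)) -> measurable_fun [set: T] f ->
  (forall n w, `|f_ n w| <= B) ->
  {ae P, forall w, f_ n w @[n --> \oo] --> f w} ->
  (\int[P]_w f_ n w)%R @[n --> \oo] --> (\int[P]_w f w)%R.
Proof.
move=> mf_ mf fB ff.
have [|||||intf _] := @dominated_convergence _ _ _ P setT measurableT
  (fun n w => (f_ n w)%:E) (EFin \o f) (cst B%:E).
- by move=> n; exact/measurable_EFinP.
- exact/measurable_EFinP.
- by apply: filterS ff => w fw _; apply: cvg_EFin => //; exact: nearW.
- by apply: (@bounded_measurable_integrable (cst B) `|B|).
- by apply: aeW => w n _ /=; rewrite lee_fin.
rewrite -[X in _ --> X -> _]fineK; last exact: integrable_fin_num.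
exact: fine_cvg.
Qed.

Lemma Rintegral_weighted_indic (I : finType) (c : I -> R) (A : I -> set T) :
  (forall i, measurable (A i)) ->
  (\int[P]_w (\sum_i c i * \1_(A i) w))%R = \sum_i c i * fine (P (A i)).
Proof.
move=> mA; rewrite /Rintegral.
have int1 i : P.-integrable [set: T] (fun w => (\1_(A i) w : R)%:E).
  exact: integrable_indic.
under eq_integral do rewrite -sumEFin.
rewrite integral_sum//; last first.
  by move=> i; under eq_fun do rewrite EFinM; exact: integrableZl.
rewrite (eq_bigr (fun i => (c i * fine (P (A i)))%:E)) ?sumEFin// => i _.
under eq_integral do rewrite EFinM.
by rewrite integralZl// integral_indic// setIT EFinM -probabilityE.
Qed.

End probability_in_R.

(** * Cells of paths *)
Section cells.
Context {R : realType}.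
Implicit Types (x y : D_up R) (K : nat).

Definition grid K l : R := l%:R / K%:R.

Lemma grid_itv K l : (l <= K)%N -> 0 <= grid K l <= 1.
Proof.
move=> lK; rewrite /grid divr_ge0//=; have [->|K0] := posnP K.
  by rewrite invr0 mulr0.
by rewrite ler_pdivrMr ?ltr0n// mul1r ler_nat.
Qed.

Lemma grid0 K : grid K 0 = 0.
Proof. by rewrite /grid mul0r. Qed.

Lemma gridK K : (0 < K)%N -> grid K K = 1.
Proof. by move=> K0; rewrite /grid divff// pnatr_eq0 -lt0n. Qed.

(** The shift by one half keeps [0], where the limit law may have an atom,
    away from the boundaries of the cells. *)
Definition level K c : R := (c%:R - (K ^ 2)%:R - 2^-1) / K%:R.

Lemma level_neq0 K c : (0 < K)%N -> level K c != 0.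
Proof.
move=> K0; rewrite /level mulf_neq0 ?invr_eq0 ?pnatr_eq0 -?lt0n//.
apply/eqP => h.
have : (2 * c)%:R = (2 * K ^ 2 + 1)%:R :> R by rewrite natrD !natrM; lra.
move/eqP; rewrite eqr_nat => /eqP/(congr1 odd).
by rewrite oddD !oddM.
Qed.

Lemma level_le K c c' : (c <= c')%N -> level K c <= level K c'.
Proof.
by move=> cc; rewrite /level ler_wpM2r// !lerD2r ler_nat.
Qed.

Lemma level_S K c : level K c.+1 = level K c + K%:R^-1.
Proof. by rewrite /level -natr1; ring. Qed.

Definition cell_index K := {ffun 'I_K.+1 -> 'I_(2 * K ^ 2)}.

Definition in_cell K (v : cell_index K) (x : R -> R) :=
  forall l, level K (v l) < x (grid K l) <= level K (v l).+1.

Lemma in_cell_inj K (v v' : cell_index K) (x : R -> R) :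
  in_cell v x -> in_cell v' x -> v = v'.
Proof.
have lt_false (u u' : cell_index K) l : in_cell u x -> in_cell u' x ->
    ~ (u l < u' l)%N.
  move=> ux ux' uu'; have /andP[_] := ux l; have /andP[+ _] := ux' l.
  by move=> /lt_le_trans/[apply]; rewrite ltNge level_le.
move=> vx vx'; apply/ffunP => l; apply/val_inj => /=.
by case: (ltngtP (v l) (v' l)) => // [/(lt_false _ _ _ vx vx')|
  /(lt_false _ _ _ vx' vx)].
Qed.

(** Between grid points monotonicity compares the two paths through the next
    grid point, at the price of a delay [1 / K]. *)
Lemma in_cell_dM1 K (v : cell_index K) x y : (0 < K)%N ->
  in_cell v x -> in_cell v y -> (dM1 x y <= (4 / K%:R)%:E)%E.
Proof.
move=> K0 vx vy; have K0' : 0 < K%:R :> R by rewrite ltr0n.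
have Kge0 : 0 <= K%:R^-1 :> R by rewrite invr_ge0.
have close l : (l <= K)%N -> `|x (grid K l) - y (grid K l)| <= K%:R^-1.
  rewrite -ltnS => lK; have := vx (Ordinal lK); have := vy (Ordinal lK).
  rewrite !level_S /= ler_norml; lra.
rewrite (_ : 4 / K%:R = K%:R^-1 + 3 * K%:R^-1); last by field; rewrite gt_eqF.
apply: dM1_le => //.
- by have := close 0 (leq0n _); rewrite grid0.
- by have := close K (leqnn _); rewrite gridK.
move=> s t s0 st t1; pose l := (Num.truncn (s * K%:R)).+1.
have /andP[ls sl] : (Num.truncn (s * K%:R))%:R <= s * K%:R < l%:R.
  by rewrite truncn_itv// mulr_ge0// ltW.
have sg : s <= grid K l by rewrite /grid ler_pdivlMr// ltW.
have gt : grid K l <= t.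
  by rewrite (le_trans _ st)// /grid ler_pdivrMr// mulrDl mulVf ?gt_eqF// -natr1 lerD2r.
have lK : (l <= K)%N.
  by rewrite -(ler_nat R) -[leRHS]mul1r -ler_pdivrMr// (le_trans gt).
have g0 : 0 <= grid K l by rewrite (le_trans s0).
have g1 : grid K l <= 1 by rewrite (le_trans gt).
have xs z := D_up_nondecreasing z s0 sg g1.
have xt z := D_up_nondecreasing z g0 gt t1.
have := close _ lK; rewrite ler_norml => /andP[c1 c2].
by split; [have := xs x; have := xt y|have := xs y; have := xt x]; lra.
Qed.

(** A nondecreasing path is bounded by its end values, hence stays in the range
    covered by the finitely many cells as soon as [K] exceeds them. *)
Lemma in_cell_ex (x : D_up R) : \forall K \near \oo,
  exists v : cell_index K, in_cell v x.
Proof.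
pose b := `|x 0| + `|x 1| + 1.
exists (Num.truncn b).+1 => // K /= bK.
have {bK} bK : b < K%:R.
  have /andP[_ h] : (Num.truncn b)%:R <= b < (Num.truncn b).+1%:R.
    by rewrite truncn_itv// /b !addr_ge0.
  by rewrite (lt_le_trans h)// ler_nat.
have K0 : 0 < K%:R :> R by rewrite (le_lt_trans _ bK)// /b !addr_ge0.
have main (l : 'I_K.+1) : exists c : 'I_(2 * K ^ 2),
    level K c < x (grid K l) <= level K c.+1.
  have /andP[g0 g1] : 0 <= grid K l <= 1.
    by apply: grid_itv; rewrite -ltnS.
  have x0 := D_up_nondecreasing x (lexx 0) g0 g1.
  have x1 := D_up_nondecreasing x g0 g1 (lexx 1).
  have [xl xu] : 1 - K%:R <= x (grid K l) /\ x (grid K l) <= K%:R - 1.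
    have := ler_norm (x 1); have := ler_norm (- x 0); rewrite normrN.
    have := normr_ge0 (x 0); have := normr_ge0 (x 1).
    by rewrite /b in bK; split; lra.
  set z := x (grid K l) in xl xu *.
  pose q := z * K%:R + (K ^ 2)%:R + 2^-1.
  have K1 : 1 <= K%:R :> R by rewrite ler1n -(ltr0n R).
  have q0 : 0 < q by rewrite /q natrX; nra.
  have q2 : q <= (2 * K ^ 2)%:R by rewrite /q natrM natrX; nra.
  have [c /andP[cq qc]] : exists c : nat, c%:R < q <= c.+1%:R.
    have /andP[] := truncn_itv (ltW q0).
    rewrite le_eqVlt => /predU1P[qE _|qt /ltW tq]; last first.
      by exists (Num.truncn q); rewrite qt.
    exists (Num.truncn q).-1.
    have t0 : (0 < Num.truncn q)%N by rewrite -(ltr0n R) qE.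
    have pq : (Num.truncn q).-1%:R < (Num.truncn q)%:R :> R.
      by rewrite ltr_nat prednK.
    by rewrite prednK// qE lexx andbT (lt_le_trans pq)// qE.
  have cK : (c < 2 * K ^ 2)%N by rewrite -(ltr_nat R) (lt_le_trans cq).
  exists (Ordinal cK) => /=.
  rewrite /level ltr_pdivrMr// ler_pdivlMr//.
  by apply/andP; split; rewrite /q in cq qc; lra.
have [v hv] := choice main.
by exists (finfun v) => l; rewrite ffunE.
Qed.

End cells.

(** * Random elements and convergence in distribution *)
Section weak_convergence.
Context {R : realType}.

Lemma measurable_in_cell {d} {T : measurableType d} (Y : T -> R -> R) K
    (v : cell_index K) :
  (forall t : R, 0 <= t <= 1 -> measurable_fun [set: T] (Y ^~ t)) ->
  measurable [set w | in_cell v (Y w)].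
Proof.
move=> mY; apply: measurable_forallT => l.
have mYl : measurable_fun [set: T] (Y ^~ (grid K l)).
  by apply: mY; apply: grid_itv; rewrite -ltnS.
apply: measurable_set_andb; first exact: measurable_set_lt.
exact: measurable_set_le.
Qed.

(** An open set is the union of the cells that it contains, because the cells
    around a given path shrink to it; and there are countably many cells. *)
Lemma random_element_coordinates {d} {T : measurableType d}
    (Y : T -> D_up R) :
  (forall t : R, 0 <= t <= 1 -> measurable_fun [set: T] (fun w => Y w t)) ->
  random_element Y.
Proof.
move=> mY U oU; have {}oU : M1_open U by exact: oU.
rewrite (_ : _ @^-1` _ = \bigcup_(K : nat) \bigcup_(v in
    [set v : cell_index K | forall y : D_up R, in_cell v y -> U y])
  [set w | in_cell v (Y w)]).
  apply: bigcup_measurable => K _; apply: fin_bigcup_measurable; first exact: finite_finset.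
  by move=> v _; exact: measurable_in_cell.
apply/seteqP; split=> [w /= UYw|w [K _ [v /= vU /vU]]//].
have [e e0 eU] := oU _ UYw.
near \oo => K; have [v vY] : exists v : cell_index K, in_cell v (Y w).
  by near: K; exact: in_cell_ex.
exists K => //; exists v => //= y vy; apply: eU.
have K0 : (0 < K)%N by near: K; exact: nbhs_infty_gt.
apply: le_lt_trans (in_cell_dM1 K0 vY vy) _.
rewrite lte_fin ltr_pdivrMr ?ltr0n// mulrC -ltr_pdivrMr//.
by near: K; exact: nbhs_infty_gtr.
Unshelve. all: by end_near. Qed.

Section fidi.
Context {d : measure_display} {T : measurableType d}.
Context {d' : measure_display} {T' : measurableType d'}.
Variables (P : probability T R) (P' : probability T' R).
Variables (X : nat -> T -> D_up R) (Y : T' -> D_up R) (Y' : T' -> R -> R).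
Hypothesis mX : forall n (t : R), 0 <= t <= 1 ->
  measurable_fun [set: T] (fun w => X n w t).
Hypothesis rY : random_element Y.
Hypothesis mY' : forall t : R, 0 <= t <= 1 -> measurable_fun [set: T'] (Y' ^~ t).
Hypothesis YY' : {ae P', forall w (t : R), 0 <= t <= 1 -> Y w t = Y' w t}.
Hypothesis cdfXY : forall K (x : 'I_K.+1 -> R), (0 < K)%N ->
  (forall l, x l != 0) ->
  fine (P [set w | forall l : 'I_K.+1, X n w (grid K l) <= x l]) @[n --> \oo] -->
  fine (P' [set w | forall l : 'I_K.+1, Y' w (grid K l) <= x l]).

Let mXg n K (l : 'I_K.+1) : measurable_fun [set: T] (fun w => X n w (grid K l)).
Proof. by apply: mX; apply: grid_itv; rewrite -ltnS. Qed.

Let mYg K (l : 'I_K.+1) : measurable_fun [set: T'] (fun w => Y' w (grid K l)).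
Proof. by apply: mY'; apply: grid_itv; rewrite -ltnS. Qed.

(** Half-open boxes are obtained from lower orthants by successive
    differences, one coordinate at a time. *)
Let cvg_box K (lo hi : 'I_K.+1 -> R) j : (0 < K)%N ->
  (forall l, lo l != 0) -> (forall l, hi l != 0) ->
  (forall l, lo l <= hi l) ->
  fine (P [set w | forall l : 'I_K.+1, ((l < j)%N ==> (lo l < X n w (grid K l)))
     && (X n w (grid K l) <= hi l)]) @[n --> \oo] -->
  fine (P' [set w | forall l : 'I_K.+1, ((l < j)%N ==> (lo l < Y' w (grid K l)))
     && (Y' w (grid K l) <= hi l)]).
Proof.
move=> K0 lo0; elim: j hi => [|j IH] hi hi0 lohi; first exact: cdfXY.
have [jK|Kj] := ltnP j K.+1; last first.
  rewrite (_ : (fun n => _) = (fun n => fine (P [set w | forall l : 'I_K.+1,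
    ((l < j)%N ==> (lo l < X n w (grid K l))) && (X n w (grid K l) <= hi l)]))).
    rewrite (_ : [set w | _] = [set w | forall l : 'I_K.+1,
      ((l < j)%N ==> (lo l < Y' w (grid K l))) && (Y' w (grid K l) <= hi l)]).
      exact: IH.
    apply/seteqP; split=> w /= h l; have := h l;
      by rewrite !(leq_trans (ltn_ord l))// ltnW.
  apply/funext => n; congr (fine (P _)).
  apply/seteqP; split=> w /= h l; have := h l;
    by rewrite !(leq_trans (ltn_ord l))// ltnW.
pose hj l := if l == Ordinal jK then lo l else hi l.
pose A hi (x : R -> R) := forall l : 'I_K.+1,
  ((l < j)%N ==> (lo l < x (grid K l))) && (x (grid K l) <= hi l).
have diff (x : R -> R) :
    (forall l : 'I_K.+1, ((l < j.+1)%N ==> (lo l < x (grid K l))) &&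
      (x (grid K l) <= hi l)) <-> A hi x /\ ~ A hj x.
  split=> [h|[h1 h2] l].
    split=> [l|/(_ (Ordinal jK))].
      have /andP[h1 ->] := h l; rewrite andbT; apply/implyP => lj.
      by move/implyP: h1; apply; rewrite ltnS ltnW.
    rewrite /hj eqxx => /andP[_]; have /andP[+ _] := h (Ordinal jK).
    by rewrite /= ltnSn/= ltNge => /negP.
  have /andP[h3 h4] := h1 l; rewrite h4 andbT; apply/implyP.
  rewrite ltnS leq_eqVlt => /predU1P[lj|lj]; last by move/implyP : h3; exact.
  rewrite ltNge; apply/negP => xlo; apply: h2 => l'; have /andP[-> hl'] := h1 l'.
  rewrite /hj; case: eqP => [l'j|//]; suff -> : l' = l by [].
  by rewrite l'j; apply/val_inj; rewrite /= lj.
have AA (x : R -> R) : A hj x -> A hi x.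
  move=> h l; have /andP[-> h'] := h l; rewrite (le_trans h')// /hj.
  by case: ifP.
have mA d0 (T0 : measurableType d0) (Z : T0 -> R -> R) h :
    (forall l : 'I_K.+1, measurable_fun [set: T0] (fun w => Z w (grid K l))) ->
    measurable [set w | A h (Z w)].
  move=> mZ; apply: measurable_forallT => l.
  have [lj|lj] := boolP (l < j)%N => /=; last exact: measurable_set_le.
  by apply: measurable_set_andb; [exact: measurable_set_lt|
                                  exact: measurable_set_le].
have PA d0 (T0 : measurableType d0) (Q : probability T0 R) (Z : T0 -> R -> R) :
    (forall l : 'I_K.+1, measurable_fun [set: T0] (fun w => Z w (grid K l))) ->
    fine (Q [set w | forall l : 'I_K.+1,
      ((l < j.+1)%N ==> (lo l < Z w (grid K l))) && (Z w (grid K l) <= hi l)]) =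
    fine (Q [set w | A hi (Z w)]) - fine (Q [set w | A hj (Z w)]).
  move=> mZ; rewrite (_ : mkset _ = [set w | A hi (Z w)] `\` [set w | A hj (Z w)]).
    rewrite measureD; [|exact: mA|exact: mA|].
      rewrite setIidr; last by move=> w; exact: AA.
      by rewrite fineB// fin_num_measure//; exact: mA.
    by rewrite -ge0_fin_numE// fin_num_measure//; exact: mA.
  by apply/seteqP; split=> w /diff.
rewrite PA//; under eq_fun => n do rewrite (PA _ _ P (fun w => X n w))//.
apply: cvgB; first exact: IH.
apply: IH => l; rewrite /hj; case: ifP => // _; exact: lohi.
Qed.

Lemma cvg_cell K (v : cell_index K) : (0 < K)%N ->
  fine (P [set w | in_cell v (X n w)]) @[n --> \oo] -->
  fine (P' [set w | in_cell v (Y' w)]).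
Proof.
move=> K0; have := @cvg_box K (fun l => level K (v l))
  (fun l => level K (v l).+1) K.+1 K0 (fun l => level_neq0 _ K0)
  (fun l => level_neq0 _ K0) (fun l => level_le _ (leqnSn _)).
set f := (X in X @ _ --> _ -> _); set b := (X in _ --> X -> _).
rewrite (_ : f = fun n => fine (P [set w | in_cell v (X n w)])).
  rewrite (_ : b = fine (P' [set w | in_cell v (Y' w)]))//.
  congr (fine (P' _)); apply/seteqP; split=> w /= h l; have := h l;
    by rewrite ltn_ord.
apply/funext => n; congr (fine (P _)); apply/seteqP; split=> w /= h l;
  by have := h l; rewrite ltn_ord.
Qed.

Lemma measurable_continuous_comp {d0} {T0 : measurableType d0}
    (V : T0 -> D_up R) (f : D_up R -> R) :
  random_element V -> continuous f -> measurable_fun [set: T0] (f \o V).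
Proof.
move=> rV /continuousP cf _; apply: (measurability _ (RGenOpens.measurableE R)) => //.
move=> _ [_ [a [b ->] <-]]; rewrite setTI comp_preimage.
exact/rV/cf/interval_open.
Qed.

Definition cell_inf (f : D_up R -> R) K (v : cell_index K) : R :=
  inf [set f x | x in [set x : D_up R | in_cell v x]].

Definition cell_minorant (f : D_up R -> R) K (x : R -> R) : R :=
  \sum_(v : cell_index K) cell_inf f v * \1_[set x | in_cell v x] x.

Lemma cell_minorantE (f : D_up R -> R) K (v : cell_index K) (x : R -> R) :
  in_cell v x -> cell_minorant f K x = cell_inf f v.
Proof.
move=> vx; rewrite /cell_minorant (bigD1 v)//= big1 ?addr0.
  by rewrite indicE mem_set// mulr1.
move=> v' v'v; rewrite indicE memNset ?mulr0//= => v'x.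
by move/eqP : v'v; apply; exact: in_cell_inj v'x vx.
Qed.

Section minorant.
Variables (f : D_up R -> R) (B : R).
Hypothesis B0 : 0 <= B.
Hypothesis f0B : forall x, 0 <= f x <= B.

Let f_lb (A : set (D_up R)) : has_lbound [set f x | x in A].
Proof. by exists 0 => _ [x _ <-]; have /andP[] := f0B x. Qed.

Lemma cell_inf_le K (v : cell_index K) (x : D_up R) : in_cell v x ->
  cell_inf f v <= f x.
Proof. by move=> vx; apply: ge_inf => //; exists x. Qed.

Lemma cell_minorant_le K (x : D_up R) : cell_minorant f K x <= f x.
Proof.
have [[v vx]|nv] := pselect (exists v : cell_index K, in_cell v x).
  by rewrite (cell_minorantE f vx); exact: cell_inf_le.
rewrite /cell_minorant big1; first by have /andP[] := f0B x.
by move=> v _; rewrite indicE memNset ?mulr0//= => vx; apply: nv; exists v.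
Qed.

(** Over an empty cell the infimum is the default value 0. *)
Lemma cell_inf_itv K (v : cell_index K) : 0 <= cell_inf f v <= B.
Proof.
have [[x vx]|nv] := pselect (exists x : D_up R, in_cell v x); last first.
  rewrite /cell_inf (_ : mkset _ = set0) ?image_set0 ?inf0 ?lexx//.
  by apply/seteqP; split=> // x vx; apply: nv; exists x.
apply/andP; split; last first.
  by rewrite (le_trans (cell_inf_le vx))//; have /andP[] := f0B x.
apply: lb_le_inf; first by exists (f x), x.
by move=> _ [y _ <-]; have /andP[] := f0B y.
Qed.

Lemma cell_minorant_itv K (x : R -> R) : 0 <= cell_minorant f K x <= B.
Proof.
have [[v vx]|nv] := pselect (exists v : cell_index K, in_cell v x).
  by rewrite (cell_minorantE f vx); exact: cell_inf_itv.
rewrite /cell_minorant big1 ?lexx//.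
by move=> v _; rewrite indicE memNset ?mulr0//= => vx; apply: nv; exists v.
Qed.

(** The oscillation of a continuous function over the cell of [x] vanishes as
    the cell shrinks to [x]. *)
Lemma cvg_cell_minorant (x : D_up R) : continuous f ->
  cell_minorant f K x @[K --> \oo] --> f x.
Proof.
move=> cf; apply/cvgrPdist_le => e e0.
have [r r0 rf] : exists2 r : R, 0 < r & forall y : D_up R,
    (dM1 x y < r%:E)%E -> `|f x - f y| < e.
  have : open (f @^-1` ball (f x) e).
    by move/continuousP : cf; apply; exact: ball_open.
  move=> oU; have {}oU : M1_open (f @^-1` ball (f x) e) by exact: oU.
  exact: (oU x (ballxx _ e0)).
near=> K; have [v vx] : exists v : cell_index K, in_cell v x.
  by near: K; exact: in_cell_ex.
have K0 : (0 < K)%N by near: K; exact: nbhs_infty_gt.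
rewrite (cell_minorantE f vx) ger0_norm ?subr_ge0 ?cell_inf_le//.
rewrite lerBlDr -lerBlDl; apply: lb_le_inf; first by exists (f x), x.
move=> _ [y vy <-]; rewrite lerBlDl -lerBlDr.
rewrite (le_trans (ler_norm _))// ltW// rf//.
apply: le_lt_trans (in_cell_dM1 K0 vx vy) _.
rewrite lte_fin ltr_pdivrMr ?ltr0n// mulrC -ltr_pdivrMr//.
by near: K; exact: nbhs_infty_gtr.
Unshelve. all: by end_near. Qed.

(** The expectation of the cell-wise infimum of [f] is a finite combination of
    probabilities of cells, so it converges as [n] grows; it lies below the
    expectation of [f (X n)], and approaches that of [f Y] as [K] grows. *)
Lemma liminf_integral_ge (e : R) : continuous f -> 0 < e ->
  \forall n \near \oo,
    (\int[P']_w f (Y w))%R - e <= (\int[P]_w f (X n w))%R.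
Proof.
move=> cf e0.
have mcY K (v : cell_index K) := measurable_in_cell v mY'.
have mcX n K (v : cell_index K) : measurable [set w | in_cell v (X n w)].
  by apply: measurable_in_cell => t t01; exact: mX.
have rX n : random_element (X n).
  by apply: random_element_coordinates => t t01; exact: mX.
have fB x : `|f x| <= B by have /andP[f0 fB] := f0B x; rewrite ger0_norm.
have mB K x : `|cell_minorant f K x| <= B.
  by have /andP[g0 gB] := cell_minorant_itv K x; rewrite ger0_norm.
have mm d0 (T0 : measurableType d0) (V : T0 -> R -> R) K :
    (forall v : cell_index K, measurable [set w | in_cell v (V w)]) ->
    measurable_fun [set: T0] (fun w => cell_minorant f K (V w)).
  move=> mV; apply: measurable_sum => v; apply: measurable_funM => //.
  exact: (measurable_indic (U := [set w | in_cell v (V w)])).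
have mfY := measurable_continuous_comp rY cf.
have cvgK : (\int[P']_w cell_minorant f K (Y' w))%R @[K --> \oo] -->
    (\int[P']_w f (Y w))%R.
  apply: (bounded_convergence (B := B)) => //.
  - by move=> K; apply: mm.
  - apply: filterS YY' => w Yw; have := @cvg_cell_minorant (Y w) cf.
    suff E K : cell_minorant f K (Y w) = cell_minorant f K (Y' w).
      by under eq_fun do rewrite E.
    apply: eq_bigr => v _; congr (_ * (_ %:R)); congr (nat_of_bool _).
    suff EE : in_cell v (Y w) = in_cell v (Y' w).
      by apply/idP/idP; rewrite !inE /= EE.
    apply/propext; split=> h l; have := h l; rewrite Yw//;
      by apply: grid_itv; rewrite -ltnS.
have e20 : 0 < e / 2 by rewrite divr_gt0.
have [K [K0 hK]] : exists K, (0 < K)%N /\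
    (\int[P']_w f (Y w))%R - e / 2 <= (\int[P']_w cell_minorant f K (Y' w))%R.
  near \oo => K; exists K; split; first by near: K; exact: nbhs_infty_gt.
  have : `|(\int[P']_w f (Y w))%R - (\int[P']_w cell_minorant f K (Y' w))%R|
      <= e / 2 by near: K; move/cvgrPdist_le : cvgK; exact.
  by rewrite ler_norml => /andP[_]; rewrite lerBlDr -lerBlDl.
have cvgn : (\sum_(v : cell_index K) cell_inf f v *
      fine (P [set w | in_cell v (X n w)])) @[n --> \oo] -->
    (\int[P']_w cell_minorant f K (Y' w))%R.
  have -> : (\int[P']_w cell_minorant f K (Y' w))%R =
      \sum_(v : cell_index K) cell_inf f v *
      fine (P' [set w | in_cell v (Y' w)]).
    by rewrite -Rintegral_weighted_indic.
  by apply: cvgn_sum => v; apply: cvgM; [exact: cvg_cst|exact: cvg_cell].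
near=> n.
apply: le_trans (_ : \int[P]_w cell_minorant f K (X n w) <= _)%R; last first.
  apply: le_Rintegral => //.
  - apply: (bounded_measurable_integrable P (B := B)) => //.
    by apply: mm => v; exact: mcX.
  - apply: (bounded_measurable_integrable P (B := B)) => //.
    exact: (measurable_continuous_comp (rX n) cf).
  - by move=> w _; exact: cell_minorant_le.
have -> : (\int[P]_w cell_minorant f K (X n w))%R =
    \sum_(v : cell_index K) cell_inf f v * fine (P [set w | in_cell v (X n w)]).
  by rewrite -Rintegral_weighted_indic//.
have : `|(\int[P']_w cell_minorant f K (Y' w))%R -
    \sum_(v : cell_index K) cell_inf f v *
      fine (P [set w | in_cell v (X n w)])| <= e / 2.
  by near: n; move/cvgrPdist_le : cvgn; exact.
rewrite ler_norml => /andP[_]; lra.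
Unshelve. all: by end_near. Qed.

End minorant.

(** The lower bound [liminf_integral_ge], applied to the nonnegative functions
    [f + B] and [B - f], bounds the expectations of [f] on both sides. *)
Lemma cvg_in_distribution_fidi : cvg_in_distribution P P' X Y.
Proof.
have rX n : random_element (X n).
  by apply: random_element_coordinates => t t01; exact: mX.
split => // f cf [b [_ fb]].
pose B := `|b| + 1; have fB x : `|f x| <= B.
  by apply: fb => //; rewrite /B ltr_pwDr// ler_norm.
have int d0 (T0 : measurableType d0) (Q : probability T0 R) (V : T0 -> D_up R) :
    random_element V -> Q.-integrable [set: T0] (EFin \o (f \o V)).
  move=> rV; apply: (bounded_measurable_integrable Q (B := B)) => [|w].
    exact: measurable_continuous_comp.
  exact: fB.
have intB d0 (T0 : measurableType d0) (Q : probability T0 R) :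
    Q.-integrable [set: T0] (EFin \o cst B).
  by apply: (bounded_measurable_integrable Q (B := `|B|)).
have EB d0 (T0 : measurableType d0) (Q : probability T0 R) :
    (\int[Q]_w cst B w)%R = B.
  have h : Q [set: T0] = 1%E by exact: probability_setT.
  by rewrite Rintegral_cst//= h mulr1.
have Ef d0 (T0 : measurableType d0) (Q : probability T0 R) (V : T0 -> D_up R) :
    random_element V -> ('E_Q[f \o V] = (\int[Q]_w f (V w))%:E)%E.
  move=> rV; rewrite unlock /Rintegral fineK//.
  exact: integrable_fin_num (int _ _ Q V rV).
rewrite Ef//; under eq_fun do rewrite Ef//.
apply: cvg_EFin; first exact: nearW.
apply/cvgrPdist_le => e e0.
have BB : 0 <= B + B by rewrite /B; have := normr_ge0 b; lra.
have up := @liminf_integral_ge (fun x => f x + B) (B + B) BB _ e _ e0.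
have dn := @liminf_integral_ge (fun x => B - f x) (B + B) BB _ e _ e0.
near=> n.
have : (\int[P']_w (f (Y w) + B))%R - e <= (\int[P]_w (f (X n w) + B))%R.
  near: n; apply: up.
    by move=> x; have := fB x; rewrite ler_norml; lra.
  by move=> x; exact: (cvgD (cf x) (cvg_cst B)).
have : (\int[P']_w (B - f (Y w)))%R - e <= (\int[P]_w (B - f (X n w)))%R.
  near: n; apply: dn.
    by move=> x; have := fB x; rewrite ler_norml; lra.
  by move=> x; exact: (cvgB (cvg_cst B) (cf x)).
have addB d0 (T0 : measurableType d0) (Q : probability T0 R) (V : T0 -> D_up R) :
    random_element V ->
    (\int[Q]_w (f (V w) + B))%R = (\int[Q]_w f (V w))%R + B.
  move=> rV; rewrite (RintegralD measurableT (int _ _ Q V rV) (intB _ _ Q)).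
  by rewrite EB.
have subB d0 (T0 : measurableType d0) (Q : probability T0 R) (V : T0 -> D_up R) :
    random_element V ->
    (\int[Q]_w (B - f (V w)))%R = B - (\int[Q]_w f (V w))%R.
  move=> rV; rewrite (RintegralB measurableT (intB _ _ Q) (int _ _ Q V rV)).
  by rewrite EB.
rewrite !addB// !subB//= ler_norml; lra.
Unshelve. all: by end_near. Qed.

End fidi.
End weak_convergence.

(** * Independence and freezing of a variable *)
Section independence.
Local Open Scope ereal_scope.
Context {R : realType} {d d1 d2 : measure_display}.
Context {T : measurableType d} {T1 : measurableType d1} {T2 : measurableType d2}.
Variable P : probability T R.

Definition independent_functions (U : T -> T1) (V : T -> T2) :=
  forall A B, measurable A -> measurable B ->
    P ((U @^-1` A) `&` (V @^-1` B)) = P (U @^-1` A) * P (V @^-1` B).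

Variables (U : T -> T1) (V : T -> T2).
Hypothesis mU : measurable_fun [set: T] U.
Hypothesis mV : measurable_fun [set: T] V.
Lemma measurable_integral_snd (h : T1 * T2 -> \bar R) :
  measurable_fun [set: T1 * T2] h -> (forall x, 0 <= h x) ->
  measurable_fun [set: T1] (fun x => \int[P]_w h (x, V w)).
Proof.
move=> mh h0.
pose V' : {mfun T >-> T2} := HB.pack V (isMeasurableFun.Build _ _ _ _ V mV).
rewrite (_ : (fun _ => _) = fubini_F (distribution P V') h).
  exact: measurable_fun_fubini_tonelli_F.
apply/funext => x; rewrite /fubini_F ge0_integral_pushforward//.
exact: measurableT_comp.
Qed.

Lemma measurable_probability_snd (E : set (T1 * T2)) : measurable E ->
  measurable_fun [set: T1] (fun x => P [set w | E (x, V w)]).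
Proof.
move=> mE; have mh := @measurable_indic _ _ R setT E mE.
rewrite (_ : (fun _ => _) = fun x => \int[P]_w (\1_E (x, V w))%:E).
  apply: (measurable_integral_snd (h := fun x => (\1_E x)%:E)).
    exact/measurable_EFinP.
  by move=> x; rewrite lee_fin.
apply/funext => x.
rewrite (_ : (fun _ => _) = fun w => (\1_[set w | E (x, V w)] w)%:E).
  rewrite integral_indic ?setIT//.
  have mxV : measurable_fun [set: T] (fun w => (x, V w)).
    exact: measurable_fun_pair.
  by rewrite -[X in measurable X]setTI; exact: mxV.
by apply/funext => w; rewrite !indicE; congr (_%:R%:E).
Qed.

Hypothesis UV : independent_functions U V.

(** The joint law is the product law, so Tonelli's theorem integrates out the
    second variable with the value of the first one frozen. *)
Lemma integral_independent (h : T1 * T2 -> \bar R) :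
  measurable_fun [set: T1 * T2] h -> (forall x, 0 <= h x) ->
  \int[P]_w h (U w, V w) = \int[P]_w \int[P]_w' h (U w, V w').
Proof.
move=> mh h0.
pose mUV : measurable_fun [set: T] (fun w => (U w, V w)) :=
  measurable_fun_pair mU mV.
pose U' : {mfun T >-> T1} := HB.pack U (isMeasurableFun.Build _ _ _ _ U mU).
pose V' : {mfun T >-> T2} := HB.pack V (isMeasurableFun.Build _ _ _ _ V mV).
pose UV' : {mfun T >-> (T1 * T2)%type} := HB.pack (fun w => (U w, V w))
  (isMeasurableFun.Build _ _ _ _ (fun w => (U w, V w)) mUV).
transitivity (\int[distribution P UV']_z h z).
  by rewrite ge0_integral_pushforward.
transitivity (\int[distribution P U' \x distribution P V']_z h z).
  have rect B C : measurable B -> measurable C ->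
      distribution P UV' (B `*` C) = distribution P U' B * distribution P V' C.
    move=> mB mC; rewrite -[RHS](UV mB mC); congr (P _).
  apply: eq_measure_integral => A mA _; apply/esym.
  exact: (product_measure_unique rect mA).
rewrite fubini_tonelli1//.
transitivity (\int[distribution P U']_x \int[P]_w' h (x, V w')).
  apply: eq_integral => x _; rewrite /fubini_F ge0_integral_pushforward//.
  exact: measurableT_comp.
rewrite ge0_integral_pushforward//.
  exact: measurable_integral_snd.
by move=> x _; exact: integral_ge0.
Qed.

Lemma probability_independent (E : set (T1 * T2)) : measurable E ->
  P [set w | E (U w, V w)] = \int[P]_w P [set w' | E (U w, V w')].
Proof.
move=> mE; have mh := @measurable_indic _ _ R setT E mE.
have := integral_independent (h := fun x => (\1_E x)%:E).
move=> /(_ _ _)/wrap[|x|]; first exact/measurable_EFinP.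
  by rewrite lee_fin.
have slice (f : T -> T1 * T2) : measurable_fun setT f ->
    \int[P]_w (\1_E (f w))%:E = P [set w | E (f w)].
  move=> mf; rewrite (_ : (fun _ => _) = fun w => (\1_[set w | E (f w)] w)%:E).
    rewrite integral_indic ?setIT//.
    by rewrite -[X in measurable X]setTI; exact: mf.
  by apply/funext => w; rewrite !indicE; congr (_%:R%:E).
rewrite slice; last exact: measurable_fun_pair.
by move=> ->; apply: eq_integral => w _; rewrite slice//;
  exact: measurable_fun_pair.
Qed.

Lemma integral_independentM (f : T1 -> \bar R) (g : T2 -> \bar R) :
  measurable_fun [set: T1] f -> (forall x, 0 <= f x) ->
  measurable_fun [set: T2] g -> (forall x, 0 <= g x) ->
  \int[P]_w (f (U w) * g (V w)) =
  \int[P]_w f (U w) * \int[P]_w g (V w).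
Proof.
move=> mf f0 mg g0.
rewrite (integral_independent (h := fun x => f x.1 * g x.2)); last 2 first.
- apply: emeasurable_funM; first exact: measurableT_comp.
  exact: measurableT_comp.
- by move=> x; rewrite mule_ge0.
have mfU : measurable_fun setT (f \o U) by exact: measurableT_comp.
have mgV : measurable_fun setT (g \o V) by exact: measurableT_comp.
transitivity (\int[P]_w (f (U w) * \int[P]_w' g (V w'))).
  by apply: eq_integral => w _ /=; rewrite ge0_integralZl.
by rewrite ge0_integralZr//; exact: integral_ge0.
Qed.

End independence.

Section sigma_algebras.
Context {R : realType} {d : measure_display} {T : measurableType d}.
Variable P : probability T R.

(** Measurability with respect to a generated sigma-algebra is measurability on
    the space that carries it, to which the usual lemmas apply. *)
Lemma sigma_gen_preimage {I : Type} (D : set I) (X : I -> T -> R)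
    {d1 : measure_display} {T1 : measurableType d1} (U : T -> T1) (A : set T1) :
  measurable_fun [set: g_sigma_algebraType
    (\bigcup_(i in D) preimage_set_system setT (X i) measurable)] U ->
  measurable A -> sigma_gen D X (U @^-1` A).
Proof. by move=> mU mA; rewrite -[_ @^-1` _]setTI; exact: mU. Qed.

Lemma measurable_sigma_gen {I : Type} (D : set I) (X : I -> T -> R) i : D i ->
  measurable_fun [set: g_sigma_algebraType
    (\bigcup_(i in D) preimage_set_system setT (X i) measurable)]
    (X i : g_sigma_algebraType _ -> R).
Proof.
move=> Di _ A mA; apply: sub_sigma_algebra; exists i => //.
by exists A => //; rewrite setTI.
Qed.

End sigma_algebras.

(** * Regularly varying tails *)
Section regular_variation.
Context {R : realType}.
Variables (tail L : R -> R) (alpha : R) (a : nat -> R).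
Hypothesis alpha_gt0 : 0 < alpha.
Hypothesis L_sv : slowly_varying L.
Hypothesis tailE : forall x : R, 0 < x -> tail x = x `^ (- alpha) * L x.
Hypothesis tail_noninc : forall x y, x <= y -> tail y <= tail x.
Hypothesis tail_ge0 : forall x, 0 <= tail x.

Lemma tail_gt0_near : \forall x \near +oo, 0 < tail x.
Proof.
have [L0 _] := L_sv.
near=> x; rewrite tailE; first by rewrite mulr_gt0 ?powR_gt0//; near: x.
by near: x; exact: nbhs_pinfty_gt.
Unshelve. all: by end_near. Qed.

Lemma tail_ratio_cvg c : 0 < c ->
  tail (c * x) / tail x @[x --> +oo] --> c `^ (- alpha).
Proof.
move=> c0; have [L0 /(_ c c0) Lc] := L_sv.
have h : c `^ (- alpha) * (L (c * x) / L x) @[x --> +oo] --> c `^ (- alpha).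
  by rewrite -[X in _ --> X]mulr1; apply: cvgM => //; exact: cvg_cst.
apply: cvg_trans h; apply: near_eq_cvg; near=> x.
have x0 : 0 < x by near: x; exact: nbhs_pinfty_gt.
have Lx : 0 < L x by near: x.
rewrite !tailE ?mulr_gt0// powRM ?ltW//; field.
by rewrite !gt_eqF//= powR_gt0.
Unshelve. all: by end_near. Qed.

(** Past some point, each multiplication of the argument by [2 `^ delta^-1]
    multiplies the tail by a factor close to [2 `^ (- alpha / delta)], which is
    below one half, so that a geometric series dominates the sum. *)
Lemma tail_geometric_sum (delta : R) : 0 < delta < alpha ->
  exists x0 B : R, [/\ 0 < x0, 0 < B & forall x N, x0 <= x ->
    \sum_(0 <= k < N) 2 ^+ k * tail ((2 `^ delta^-1) ^+ k * x) <= B * tail x].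
Proof.
move=> /andP[d0 da]; set c := 2 `^ delta^-1.
have c0 : 0 < c by rewrite powR_gt0.
have c1 : 1 <= c.
  by rewrite /c -[leLHS](powRr0 2) ler_powR ?ler1n// invr_ge0 ltW.
have ca : c `^ (- alpha) < 2^-1.
  rewrite /c -powRrM mulrN powRN ltf_pV2 ?posrE ?powR_gt0//.
  have u1 : 0 < delta^-1 * alpha - 1.
    by rewrite subr_gt0 mulrC ltr_pdivlMr// mul1r.
  rewrite -(subrK 1 (delta^-1 * alpha)) powRD ?pnatr_eq0 ?implybT// powRr1//.
  rewrite ltr_pMl//; have := @gt0_ltr_powR R _ u1 1 2.
  by rewrite powR1; apply; rewrite ?nnegrE ?ltr1n.
have [rho [rca rho2]] : exists rho, c `^ (- alpha) < rho /\ rho < 2^-1.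
  by exists ((c `^ (- alpha) + 2^-1) / 2); split; lra.
have rho0 : 0 < rho by rewrite (lt_trans _ rca)// powR_gt0.
have near_rho : \forall x \near +oo, tail (c * x) <= rho * tail x.
  have tp := tail_gt0_near; have tc := tail_ratio_cvg c0.
  near=> x; rewrite -ler_pdivrMr; last by near: x.
  by near: x; apply: (cvgr_le _ tc).
have [x0 [_ x0P]] := near_rho.
pose x1 := Num.max 1 (x0 + 1).
have x1P x : x1 <= x -> tail (c * x) <= rho * tail x.
  by rewrite ge_max => /andP[_ x0x]; apply: x0P; rewrite (lt_le_trans _ x0x)// ltrDl.
exists x1, (1 - 2 * rho)^-1; split.
- by rewrite lt_max ltr01.
- by rewrite invr_gt0; lra.
move=> x N x1x.
have tk k : tail (c ^+ k * x) <= rho ^+ k * tail x.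
  elim: k => [|k IH]; first by rewrite !expr0 !mul1r.
  have xk : x1 <= c ^+ k * x.
    rewrite (le_trans x1x)// ler_peMl ?exprn_ege1// (le_trans _ x1x)//.
    by rewrite le_max ler01.
  by rewrite !exprS -!mulrA (le_trans (x1P _ xk))// ler_pM2l.
apply: le_trans (_ : \sum_(0 <= k < N) (2 * rho) ^+ k * tail x <= _).
  by apply: ler_sum => k _; rewrite exprMn -mulrA ler_pM2l// exprn_gt0.
rewrite -mulr_suml ler_wpM2r//.
have r1 : 0 < 1 - 2 * rho by lra.
rewrite -[leRHS]mul1r ler_pdivlMr//.
elim: N => [|N IH]; first by rewrite big_nil mul0r.
suff -> : (\sum_(0 <= k < N.+1) (2 * rho) ^+ k) * (1 - 2 * rho) =
    1 - (2 * rho) ^+ N.+1.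
  by rewrite lerBlDr lerDl exprn_ge0// mulr_ge0// ltW.
elim: {IH} N => [|N IH]; first by rewrite big_nat1 expr0 expr1 mul1r.
rewrite big_nat_recr//= mulrDl IH [X in _ = 1 - X]exprSr.
by move: ((2 * rho) ^+ N.+1) => q; ring.
Unshelve. all: by end_near. Qed.

Hypothesis a_gt0 : forall n, 0 < a n.
Hypothesis a_norm : n%:R * tail (a n) @[n --> \oo] --> (1 : R).

(** If [a n] returned below a bound [B] with [tail B > 0] for arbitrarily large
    [n], then [n * tail (a n) >= n * tail B] would be unbounded, but it
    tends to 1. *)
Lemma normalizer_cvgy : a n @[n --> \oo] --> +oo.
Proof.
apply/cvgryPgt => A.
have [B [AB B0]] : exists B, A <= B /\ 0 < tail B.
  have tp := tail_gt0_near; near (pinfty_nbhs R) => B; exists B; split.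
    by near: B; apply: nbhs_pinfty_ge; exact: num_real.
  by near: B.
near=> n; rewrite ltNge; apply/negP => aA.
have : n%:R * tail (a n) < 2 by near: n; apply: (cvgr_lt _ a_norm); lra.
apply/negP; rewrite -leNgt.
rewrite (@le_trans _ _ (n%:R * tail B))//; last first.
  by rewrite ler_wpM2l// tail_noninc// (le_trans aA).
rewrite -ler_pdivrMr// ltW//; near: n; exact: nbhs_infty_gtr.
Unshelve. all: by end_near. Qed.

Lemma cvg_normalizedM (y : R) : 0 < y -> a n * y @[n --> \oo] --> +oo.
Proof.
move=> y0; have /cvgryPge ay := normalizer_cvgy; apply/cvgryPge => A.
by apply: filterS (ay (A / y)) => n; rewrite ler_pdivrMr.
Qed.

Lemma normalized_tail_cvg (y : R) : 0 < y ->
  n%:R * tail (a n * y) @[n --> \oo] --> y `^ (- alpha).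
Proof.
move=> y0.
have h : (n%:R * tail (a n)) * (tail (y * a n) / tail (a n)) @[n --> \oo] -->
    y `^ (- alpha).
  rewrite -[X in _ --> X]mul1r; apply: cvgM => //.
  exact: (cvg_comp _ _ normalizer_cvgy (tail_ratio_cvg y0)).
apply: cvg_trans h; apply: near_eq_cvg.
have tp : \forall n \near \oo, 0 < tail (a n).
  by have /(_ [set x | 0 < tail x]) := normalizer_cvgy; apply; exact: tail_gt0_near.
near=> n; have t0 : 0 < tail (a n) by near: n.
by rewrite [y * _]mulrC; field; rewrite gt_eqF.
Unshelve. all: by end_near. Qed.

Lemma normalized_balanced_tail_cvg (tail1 : R -> R) (q y : R) : 0 < y ->
  tail1 x / tail x @[x --> +oo] --> q ->
  n%:R * tail1 (a n * y) @[n --> \oo] --> q * y `^ (- alpha).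
Proof.
move=> y0 tq.
have h : (tail1 (a n * y) / tail (a n * y)) * (n%:R * tail (a n * y))
    @[n --> \oo] --> q * y `^ (- alpha).
  apply: cvgM; last exact: normalized_tail_cvg.
  exact: (cvg_comp _ _ (cvg_normalizedM y0) tq).
apply: cvg_trans h; apply: near_eq_cvg.
have tp : \forall n \near \oo, 0 < tail (a n * y).
  have /(_ [set x | 0 < tail x]) := cvg_normalizedM y0; apply.
  exact: tail_gt0_near.
near=> n; have t0 : 0 < tail (a n * y) by near: n.
by field; rewrite gt_eqF.
Unshelve. all: by end_near. Qed.

End regular_variation.

(** * Union bounds *)
Section union_bound.
Context {R : realType} {d : measure_display} {T : measurableType d}.
Variable P : probability T R.

Lemma measurable_exists_lt n (E : nat -> set T) :
  (forall i, (i < n)%N -> measurable (E i)) ->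
  measurable [set w | exists2 i, (i < n)%N & E i w].
Proof.
move=> mE; rewrite (_ : mkset _ = \bigcup_(i in [set i | (i < n)%N]) E i)//.
exact: bigcup_measurable.
Qed.

Lemma fine_probability_exists_lt n (E : nat -> set T) :
  (forall i, (i < n)%N -> measurable (E i)) ->
  fine (P [set w | exists2 i, (i < n)%N & E i w]) <=
  \sum_(0 <= i < n) fine (P (E i)).
Proof.
elim: n => [|n IH] mE.
  rewrite big_nil (_ : mkset _ = set0) ?measure0//.
  by apply/seteqP; split=> w // -[].
have mEn : forall i, (i < n)%N -> measurable (E i).
  by move=> i ni; apply: mE; rewrite ltnW.
rewrite big_nat_recr//= (_ : mkset _ =
    [set w | exists2 i, (i < n)%N & E i w] `|` E n).
  apply: le_trans (fine_probabilityU _ _ _) _ => //.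
  - exact: measurable_exists_lt.
  - exact: mE.
  - by rewrite lerD2r; exact: IH.
apply/seteqP; split=> [w /= [i]|w /= [[i ni Ei]|En]].
- rewrite ltnS leq_eqVlt => /predU1P[->|ni] Ei; first by right.
  by left; exists i.
- by exists i => //; rewrite ltnW.
- by exists n.
Qed.

Lemma fine_probability_exists_lt_const n (E : nat -> set T) (b : R) :
  (forall i, (i < n)%N -> measurable (E i)) ->
  (forall i, (i < n)%N -> fine (P (E i)) <= b) ->
  fine (P [set w | exists2 i, (i < n)%N & E i w]) <= n%:R * b.
Proof.
move=> mE Eb; apply: le_trans (fine_probability_exists_lt mE) _.
rewrite big_nat; apply: le_trans (ler_sum _ (G := fun=> b) _) _ => [i /andP[_]|].
  exact: Eb.
by rewrite -big_nat sumr_const_nat subn0 mulr_natl.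
Qed.

Lemma markov_ge0 (f : T -> \bar R) (c : R) : 0 < c ->
  measurable_fun [set: T] f -> (forall w, 0 <= f w)%E ->
  (c%:E * P [set w | (c%:E <= f w)%E] <= \int[P]_w f w)%E.
Proof.
move=> c0 mf f0; have := @le_integral_abse _ _ _ P setT measurableT f c mf c0.
rewrite setTI; under eq_fun do rewrite gee0_abs//.
by under eq_integral do rewrite gee0_abs//.
Qed.

End union_bound.

(** * Negligibility of the far coefficients *)
Section far_coefficients.
Context {R : realType} {d : measure_display} {T : measurableType d}.
Variable P : probability T R.
Variables (delta : R) (tail : R -> R).
Hypothesis delta_gt0 : 0 < delta.
(** The ratio of the levels below: multiplying [z] by [c] doubles
    [`|z| `^ delta]. *)
Let c : R := 2 `^ delta^-1.
Let c_gt0 : 0 < c. Proof. by rewrite powR_gt0. Qed.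
Let cdelta k : (c ^+ k) `^ delta = 2 ^+ k.
Proof.
rewrite -(powR_mulrn _ (ltW c_gt0)) /c -!powRrM mulrCA mulVf ?gt_eqF// mulr1.
by rewrite powR_mulrn.
Qed.

Definition excess (x z : R) : R := if x < `|z| then `|z| `^ delta else 0.

Lemma excess_ge0 x z : 0 <= excess x z.
Proof. by rewrite /excess; case: ifP => // _; exact: powR_ge0. Qed.

Lemma powR_le_excess x z : 0 <= x -> `|z| `^ delta <= x `^ delta + excess x z.
Proof.
move=> x0; rewrite /excess; case: ltP => [_|zx]; first by rewrite lerDr powR_ge0.
by rewrite addr0 ge0_ler_powR ?nnegrE// ltW.
Qed.

Lemma measurable_excess x : measurable_fun [set: R] (excess x).
Proof.
apply: measurable_fun_ifT => //.
- by apply: measurable_fun_ltr => //; exact: measurable_normr.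
- exact: (measurableT_comp (measurable_powR _)).
Qed.

(** The excess over [x] is compared with the levels [c ^+ k * x] that [`|z|]
    passes, at each of which its power doubles. *)
Lemma excess_le_sum (x z : R) N : 0 < x -> `|z| <= c ^+ N * x ->
  excess x z <= \sum_(0 <= k < N)
    (2 * x `^ delta) * (2 ^+ k * (c ^+ k * x < `|z|)%R%:R).
Proof.
move=> x0; elim: N => [|N IH] zN.
  by rewrite big_nil /excess ltNge -[x]mul1r -(expr0 c) zN.
rewrite big_nat_recr//=; have [zN'|zN'] := leP `|z| (c ^+ N * x).
  by rewrite mulr0 mulr0 addr0; exact: IH.
rewrite mulr1 (@le_trans _ _ (2 * x `^ delta * 2 ^+ N))//; last first.
  rewrite lerDr sumr_ge0// => k _.
  by rewrite !mulr_ge0// ?exprn_ge0// powR_ge0.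
apply: le_trans (_ : `|z| `^ delta <= _).
  by rewrite /excess; case: ifP => // _; exact: powR_ge0.
have -> : 2 * x `^ delta * 2 ^+ N = (c ^+ N.+1 * x) `^ delta.
  by rewrite powRM ?exprn_ge0 ?ltW// cdelta exprS; ring.
by rewrite ge0_ler_powR ?nnegrE ?mulr_ge0 ?exprn_ge0// ltW.
Qed.

Lemma integral_excess_le (Y : T -> R) (x B : R) : 0 < x ->
  measurable_fun [set: T] Y ->
  (forall y : R, fine (P [set w | y < `|Y w|]) = tail y) ->
  (forall N, \sum_(0 <= k < N) 2 ^+ k * tail (c ^+ k * x) <= B) ->
  (\int[P]_w (excess x (Y w))%:E <= (2 * x `^ delta * B)%:E)%E.
Proof.
move=> x0 mY tY sB.
pose u k w : R := (2 * x `^ delta) * (2 ^+ k * (c ^+ k * x < `|Y w|)%R%:R).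
have u0 k w : 0 <= u k w by rewrite !mulr_ge0// ?exprn_ge0// powR_ge0.
have mYk k : measurable [set w | c ^+ k * x < `|Y w|].
  by apply: measurable_set_lt => //; exact: measurableT_comp.
have uE k w : u k w = (2 * x `^ delta * 2 ^+ k) *
    \1_[set w | c ^+ k * x < `|Y w|] w.
  rewrite /u indicE mulrA; have [h|/negP h] := boolP (c ^+ k * x < `|Y w|).
    by rewrite mem_set.
  by rewrite memNset.
have mu k : measurable_fun [set: T] (u k).
  rewrite (funext (uE k)); exact: measurable_funM.
have iu k : (\int[P]_w (u k w)%:E =
    (2 * x `^ delta * (2 ^+ k * tail (c ^+ k * x)))%:E)%E.
  under eq_integral do rewrite uE EFinM.
  rewrite ge0_integralZl//; last 2 first.
  - apply/measurable_EFinP; exact: (measurable_indic (mYk k)).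
  - by rewrite lee_fin !mulr_ge0// ?exprn_ge0// powR_ge0.
  rewrite [X in _ = X%:E]mulrA [RHS]EFinM; congr (_ * _)%E.
  by rewrite integral_indic// setIT -tY; exact: probabilityE.
apply: le_trans (_ : \int[P]_w (\sum_(0 <= k <oo) (u k w)%:E) <= _)%E.
  apply: ge0_le_integral => //.
  - by move=> w _; rewrite lee_fin excess_ge0.
  - apply/measurable_EFinP; exact: measurableT_comp (measurable_excess x) mY.
  - by apply: ge0_emeasurable_sum => [k w _ _|k _]; [rewrite lee_fin|
      exact/measurable_EFinP].
  - move=> w _.
    have [N zN] : exists N, `|Y w| <= c ^+ N * x.
      have c1 : 1 < c.
        have := @gt0_ltr_powR R delta^-1 _ 1 2.
        by rewrite powR1 invr_gt0; apply; rewrite ?nnegrE ?ltr1n.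
      have c1' : `|c^-1| < 1 by rewrite gtr0_norm ?invr_gt0// invf_lt1.
      have y0 : 0 < `|Y w| + 1 by rewrite ltr_wpDl.
      have xy0 : 0 < x / (`|Y w| + 1) by rewrite divr_gt0.
      have [N _ /(_ N (leqnn N)) /=] := cvgr_lt _ (cvg_expr c1') _ xy0.
      rewrite exprVn ltr_pdivlMr// mulrC ltr_pdivrMr ?exprn_gt0// => h.
      by exists N; rewrite mulrC (le_trans _ (ltW h))// lerDl.
    apply: le_trans (_ : (\sum_(0 <= k < N) (u k w)%:E <= _)%E).
      by rewrite sumEFin lee_fin; exact: excess_le_sum.
    by apply: nneseries_lim_ge => k _ _; rewrite lee_fin.
rewrite integral_nneseries//; last 2 first.
- by move=> k; exact/measurable_EFinP.
- by move=> k w _; rewrite lee_fin.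
apply: lime_le; first by apply: is_cvg_nneseries => k _ _;
  apply: integral_ge0 => w _; rewrite lee_fin.
apply: nearW => N; rewrite (eq_bigr _ (fun k _ => iu k)) sumEFin lee_fin.
by rewrite -mulr_sumr ler_wpM2l// mulr_ge0// powR_ge0.
Qed.

Section far_sum.
Variables (C : nat -> T -> R) (Z : int -> T -> R).
Hypothesis mC : forall j, measurable_fun [set: T] (C j).
Hypothesis mZ : forall i, measurable_fun [set: T] (Z i).
Hypothesis CZ : forall j i, independent_functions P (C j) (Z i).
Hypothesis tailZ : forall i y, fine (P [set w | y < `|Z i w|]) = tail y.

Let mCd j : measurable_fun [set: T] (fun w => `|C j w| `^ delta).
Proof.
apply: measurableT_comp (measurable_powR _) _.
exact: measurableT_comp.
Qed.

Let mCZd j i : measurable_fun [set: T] (fun w => `|C j w * Z i w| `^ delta).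
Proof.
apply: measurableT_comp (measurable_powR _) _.
by apply: measurableT_comp => //; exact: measurable_funM.
Qed.

Let mseries (f : nat -> T -> R) : (forall j, measurable_fun [set: T] (f j)) ->
  (forall j w, 0 <= f j w) ->
  measurable_fun [set: T] (fun w => \sum_(0 <= j <oo) (f j w)%:E)%E.
Proof.
move=> mf f0; apply: ge0_emeasurable_sum => [k w _ _|k _].
  by rewrite lee_fin.
exact/measurable_EFinP.
Qed.

Lemma measurable_far_sum (b : R) n (sigma : nat -> nat -> int) :
  measurable [set w | exists2 i, (i < n)%N &
    (b%:E < \sum_(0 <= j <oo) (`|C j w * Z (sigma i j) w| `^ delta)%:E)%E].
Proof.
apply: measurable_exists_lt => i _.
rewrite -[X in measurable X]setTI; apply: emeasurable_fun_o_infty => //.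
by apply: mseries => // j w; exact: powR_ge0.
Qed.

(** Let [S] be the sum of the [`|C j| `^ delta]. Where [S < 1], the innovations
    of absolute value at most [x] contribute less than [x `^ delta], so the excesses over [x] must
    contribute [x `^ delta] on their own. Markov's inequality bounds the event
    [1 <= S], which is common to all [i], and for each [i] the event of a large
    contribution of the excesses. *)
Lemma far_sum_probability_le (x B s : R) n (sigma : nat -> nat -> int) :
  0 < x -> (forall N, \sum_(0 <= k < N) 2 ^+ k * tail (c ^+ k * x) <= B) ->
  (\sum_(0 <= j <oo) \int[P]_w (`|C j w| `^ delta)%:E = s%:E)%E ->
  fine (P [set w | exists2 i, (i < n)%N & ((2 * x `^ delta)%:E <
    \sum_(0 <= j <oo) (`|C j w * Z (sigma i j) w| `^ delta)%:E)%E]) <=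
  s + n%:R * (2 * B * s).
Proof.
move=> x0 sB sE; have xd0 : 0 < x `^ delta by rewrite powR_gt0.
pose S w := (\sum_(0 <= j <oo) (`|C j w| `^ delta)%:E)%E.
pose G i w := (\sum_(0 <= j <oo)
  (`|C j w| `^ delta * excess x (Z (sigma i j) w))%:E)%E.
have S0 w : (0 <= S w)%E.
  by apply: nneseries_ge0 => j _ _; rewrite lee_fin powR_ge0.
have g0 i j w : 0 <= `|C j w| `^ delta * excess x (Z (sigma i j) w).
  by rewrite mulr_ge0 ?powR_ge0 ?excess_ge0.
have G0 i w : (0 <= G i w)%E.
  by apply: nneseries_ge0 => j _ _; rewrite lee_fin.
have mS : measurable_fun setT S.
  by apply: mseries => // j w; exact: powR_ge0.
have mexc i : measurable_fun setT (fun w => excess x (Z i w)).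
  exact: measurableT_comp (measurable_excess x) (mZ i).
have mG i : measurable_fun setT (G i).
  by apply: mseries => // j; exact: measurable_funM.
have mge (f : T -> \bar R) b : measurable_fun setT f ->
    measurable [set w | (b%:E <= f w)%E].
  move=> mf; rewrite -[X in measurable X]setTI.
  exact: emeasurable_fun_c_infty.
have PS : fine (P [set w | (1%:E <= S w)%E]) <= s.
  rewrite -lee_fin -probabilityE; last exact: mge.
  have := markov_ge0 P ltr01 mS S0; rewrite mul1e => /le_trans; apply.
  by rewrite -sE integral_nneseries// => j; exact/measurable_EFinP.
have IG i : (\int[P]_w G i w <= (2 * x `^ delta * B * s)%:E)%E.
  rewrite integral_nneseries//; last 2 first.
  - by move=> j; apply/measurable_EFinP; exact: measurable_funM.
  - by move=> j w _; rewrite lee_fin.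
  apply: le_trans (_ : \sum_(0 <= j <oo) ((2 * x `^ delta * B)%:E *
      \int[P]_w (`|C j w| `^ delta)%:E) <= _)%E.
    apply: lee_nneseries => [j _ _|j _].
      by apply: integral_ge0 => w _; rewrite lee_fin.
    have mabs : measurable_fun [set: R] (fun u : R => (`|u| `^ delta)%:E).
      by apply/measurable_EFinP; apply: measurableT_comp (measurable_powR _) _.
    under eq_integral do rewrite EFinM.
    rewrite (integral_independentM (mC j) (mZ (sigma i j)) (CZ _ _)
      (f := fun u => (`|u| `^ delta)%:E) (g := fun z => (excess x z)%:E))//.
    - rewrite muleC lee_wpmul2r//.
        by apply: integral_ge0 => w _; rewrite lee_fin powR_ge0.
      exact: integral_excess_le.
    - by apply/measurable_EFinP; exact: measurable_excess.
    - by move=> u; rewrite lee_fin excess_ge0.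
  rewrite nneseriesZl ?sE//.
  by move=> j _; apply: integral_ge0 => w _; rewrite lee_fin powR_ge0.
have PG i : fine (P [set w | ((x `^ delta)%:E <= G i w)%E]) <= 2 * B * s.
  rewrite -(ler_pM2l xd0) -lee_fin EFinM -probabilityE; last exact: mge.
  apply: le_trans (markov_ge0 P xd0 (mG i) (G0 i)) _.
  by apply: le_trans (IG i) _; rewrite lee_fin; lra.
have mE i : measurable [set w | ((x `^ delta)%:E <= G i w)%E] by exact: mge.
have mEx : measurable
    [set w | exists2 i, (i < n)%N & ((x `^ delta)%:E <= G i w)%E].
  by apply: measurable_exists_lt => i _; exact: mE.
apply: le_trans (_ : fine (P ([set w | (1%:E <= S w)%E] `|`
    [set w | exists2 i, (i < n)%N & ((x `^ delta)%:E <= G i w)%E])) <= _).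
  apply: le_fine_probability.
  - exact: measurable_far_sum.
  - by apply: measurableU => //; exact: mge.
  - move=> w /= [i ni big]; have [S1|S1] := leP 1%:E (S w); first by left.
    right; exists i => //; rewrite leNgt; apply/negP => Gx.
    move: big; apply/negP; rewrite -leNgt.
    apply: le_trans (_ : \sum_(0 <= j <oo) ((x `^ delta)%:E *
        (`|C j w| `^ delta)%:E + (`|C j w| `^ delta *
        excess x (Z (sigma i j) w))%:E) <= _)%E.
      apply: lee_nneseries => [j _ _|j _]; first by rewrite lee_fin powR_ge0.
      rewrite -EFinM -EFinD lee_fin normrM powRM// [_ * `|C j w| `^ _]mulrC.
      by rewrite -mulrDr ler_wpM2l ?powR_ge0// powR_le_excess// ltW.
    rewrite nneseriesD; last 2 first.
    - by move=> j _ _; rewrite -EFinM lee_fin mulr_ge0// powR_ge0.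
    - by move=> j _ _; rewrite lee_fin.
    rewrite nneseriesZl; last by move=> j _; rewrite lee_fin powR_ge0.
    rewrite mulr_natl mulr2n EFinD; apply: leeD; last exact: ltW.
    by rewrite -[leRHS]mule1 lee_pmul2l ?lte_fin// ltW.
apply: le_trans (fine_probabilityU _ _ _) _.
- exact: mge.
- exact: mEx.
- apply: lerD => //; apply: (@fine_probability_exists_lt_const _ _ _ P n
    (fun i => [set w | ((x `^ delta)%:E <= G i w)%E])) => i _ //.
Qed.

End far_sum.

Section negligible.
Variables (C : nat -> T -> R) (Z : int -> T -> R) (a : nat -> R) (alpha : R).
Hypothesis mC : forall j, measurable_fun [set: T] (C j).
Hypothesis mZ : forall i, measurable_fun [set: T] (Z i).
Hypothesis CZ : forall j i, independent_functions P (C j) (Z i).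
Hypothesis tailZ : forall i y, fine (P [set w | y < `|Z i w|]) = tail y.
Hypothesis C_summable :
  (\sum_(0 <= j <oo) \int[P]_w (`|C j w| `^ delta)%:E < +oo)%E.
Hypothesis geometric : exists x0 B : R, [/\ 0 < x0, 0 < B & forall x N, x0 <= x ->
    \sum_(0 <= k < N) 2 ^+ k * tail (c ^+ k * x) <= B * tail x].
Hypothesis a_gt0 : forall n, 0 < a n.
Hypothesis a_y : a n @[n --> \oo] --> +oo.
Hypothesis tail_a : forall y : R, 0 < y ->
  n%:R * tail (a n * y) @[n --> \oo] --> y `^ (- alpha).

(** The index map [sigma] serves for the innovations [i - j] that enter the
    value at time [i], and for a single innovation [i] that meets all far
    coefficients. *)
Definition far_event (eps : R) n (sigma : nat -> nat -> int) m : set T :=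
  [set w | exists2 i, (i < n)%N & (((eps * a n) `^ delta)%:E <
    \sum_(m <= j <oo) (`|C j w * Z (sigma i j) w| `^ delta)%:E)%E].

Lemma far_eventE eps n sigma m : far_event eps n sigma m =
  [set w | exists2 i, (i < n)%N & (((eps * a n) `^ delta)%:E <
    \sum_(0 <= j <oo) (`|C (j + m)%N w * Z (sigma i (j + m)%N) w| `^ delta)%:E)%E].
Proof.
have E i w : (\sum_(m <= j <oo) (`|C j w * Z (sigma i j) w| `^ delta)%:E =
    \sum_(0 <= j <oo)
      (`|C (j + m)%N w * Z (sigma i (j + m)%N) w| `^ delta)%:E)%E.
  apply/esym; apply: (nneseries_addn (f := fun j =>
    (`|C j w * Z (sigma i j) w| `^ delta)%:E)) => j.
  by rewrite lee_fin powR_ge0.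
rewrite /far_event; apply/seteqP; split=> w /= [i ni]; rewrite ?E => iw;
  by exists i => //; rewrite ?E.
Qed.

Lemma measurable_far_event eps n sigma m : measurable (far_event eps n sigma m).
Proof.
rewrite far_eventE.
apply: (@measurable_far_sum (fun j => C (j + m)%N) Z _ mZ _ n
  (fun i j => sigma i (j + m)%N)) => j; exact: mC.
Qed.

(** The probability is at most the remainder after [m] of the convergent series
    of moments, times a constant that depends neither on [n] nor on [sigma]: the
    factor [n] is absorbed by [n * tail (y * a n)], which is bounded. *)
Lemma far_event_negligible (eps eta : R) : 0 < eps -> 0 < eta ->
  \forall m \near \oo, \forall n \near \oo, forall sigma,
    fine (P (far_event eps n sigma m)) <= eta.
Proof.
move=> eps0 eta0; have [x0 [B [x00 B0 geo]]] := geometric.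
have EC0 j : (0 <= \int[P]_w (`|C j w| `^ delta)%:E)%E.
  by apply: integral_ge0 => w _; rewrite lee_fin powR_ge0.
(* With x = y * a n, the threshold 2 * x `^ delta is (eps * a n) `^ delta. *)
pose y := eps / c; have y0 : 0 < y by rewrite divr_gt0.
pose D := 1 + 2 * B * (y `^ (- alpha) + 1).
have D0 : 0 < D by rewrite /D ltr_pwDl// !mulr_ge0 ?addr_ge0 ?powR_ge0// ltW.
have s0 := nneseries_tail_cvg C_summable (fun j _ => EC0 j).
near=> m.
have : (\sum_(m <= j <oo) \int[P]_w (`|C j w| `^ delta)%:E < (eta / D)%:E)%E.
  near: m; have /(_ [set u | (u < (eta / D)%:E)%E]) := s0; apply.
  by apply: open_ereal_lt'; rewrite lte_fin divr_gt0.
set s := (X in (X < _)%E) => sD.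
have sg0 : (0 <= s)%E by apply: nneseries_ge0.
have sE : s = (fine s)%:E.
  by rewrite fineK// ge0_fin_numE// (lt_trans sD)// ltry.
rewrite sE lte_fin ltr_pdivlMr// in sD.
near=> n => sigma.
have xn : x0 <= y * a n.
  rewrite mulrC -ler_pdivrMr//; near: n; exact: (cvgry_ge a_y).
have yan : 0 < y * a n by rewrite mulr_gt0.
have E2 : (eps * a n) `^ delta = 2 * (y * a n) `^ delta.
  have -> : eps * a n = c * (y * a n) by rewrite mulrA [c * y]mulrC /y divfK ?gt_eqF.
  rewrite powRM ?ltW//; congr (_ * _).
  by have := cdelta 1; rewrite !expr1.
have tn : n%:R * tail (y * a n) <= y `^ (- alpha) + 1.
  rewrite mulrC [y * _]mulrC mulrC; near: n.
  by apply: (cvgr_le _ (tail_a y0)); rewrite ltrDl.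
rewrite far_eventE E2.
have key := @far_sum_probability_le (fun j => C (j + m)%N) Z
  (fun j => mC _) mZ (fun j i => CZ _ _) tailZ
  (y * a n) (B * tail (y * a n)) (fine s) n (fun i j => sigma i (j + m)%N) yan.
apply: (le_trans (key _ _)).
- by move=> N; exact: geo.
- by rewrite (nneseries_addn (f := fun j => \int[P]_w (`|C j w| `^ delta)%:E)%E).
- apply: le_trans (ltW sD); rewrite /D mulrDr mulr1 lerD2l.
  have -> : n%:R * (2 * (B * tail (y * a n)) * fine s) =
    fine s * (2 * B * (n%:R * tail (y * a n))) by ring.
  by rewrite ler_wpM2l ?fine_ge0// ler_pM2l// mulr_gt0.
Unshelve. all: by end_near. Qed.

End negligible.

End far_coefficients.

(** * One large innovation at a time *)
Section far_terms.
Context {R : realType}.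
Variable delta : R.
Hypothesis delta_gt0 : 0 < delta.
Hypothesis delta_le1 : delta <= 1.

(** By concavity [u `^ delta] exceeds the share of [u] in [(x + y) `^ delta]. *)
Lemma powR_subadditive (x y : R) : 0 <= x -> 0 <= y ->
  (x + y) `^ delta <= x `^ delta + y `^ delta.
Proof.
move=> x0 y0; have [s0|s0] := eqVneq (x + y) 0.
  by rewrite s0 powR0 ?gt_eqF// addr_ge0 ?powR_ge0.
have {}s0 : 0 < x + y by rewrite lt_neqAle eq_sym s0 addr_ge0.
have part u : 0 <= u -> u <= x + y ->
    (x + y) `^ delta * (u / (x + y)) <= u `^ delta.
  rewrite le_eqVlt => /predU1P[<- _|u0 us]; first by rewrite mul0r mulr0 powR_ge0.
  have us' : 0 < u / (x + y) <= 1 by rewrite divr_gt0//= ler_pdivrMr// mul1r.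
  have := ger1_powR us' delta_le1; rewrite -(ler_pM2l (powR_gt0 delta s0)).
  move=> /le_trans; apply; have /andP[/ltW q0 _] := us'.
  by rewrite -(powRM delta (ltW s0) q0) mulrC divfK ?gt_eqF.
have -> : (x + y) `^ delta =
    (x + y) `^ delta * (x / (x + y)) + (x + y) `^ delta * (y / (x + y)).
  by rewrite -mulrDr -mulrDl divff ?gt_eqF// mulr1.
by apply: lerD; apply: part; lra.
Qed.

Lemma powR_sum_le (u : nat -> R) m n :
  (\sum_(m <= j < n) `|u j|) `^ delta <= \sum_(m <= j < n) `|u j| `^ delta.
Proof.
have [nm|mn] := leqP n m.
  by rewrite !big_geq// powR0// gt_eqF.
elim: n mn => [//|n IH]; rewrite ltnS leq_eqVlt => /predU1P[<-|mn].
  by rewrite !big_nat1.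
have mn' := ltnW mn; rewrite big_nat_recr// [leRHS]big_nat_recr//=.
apply: le_trans (powR_subadditive _ _) _ => //; first exact: sumr_ge0.
by rewrite lerD2r IH.
Qed.

Lemma le_sum_powR_series (u : nat -> R) m n (e : R) : 0 <= e ->
  (\sum_(m <= j <oo) (`|u j| `^ delta)%:E <= (e `^ delta)%:E)%E ->
  \sum_(m <= j < n) `|u j| <= e.
Proof.
move=> e0 ue; rewrite leNgt; apply/negP => eu.
have : e `^ delta < (\sum_(m <= j < n) `|u j|) `^ delta.
  by rewrite gt0_ltr_powR ?nnegrE//; exact: sumr_ge0.
rewrite ltNge => /negP; apply; apply: le_trans (powR_sum_le _ _ _) _.
rewrite -lee_fin -sumEFin; apply: le_trans ue.
by apply: nneseries_lim_ge => j _ _; rewrite lee_fin powR_ge0.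
Qed.

(** Since [delta <= 1], a bound on the sum of the [delta]-th powers bounds the
    sum of the absolute values; in particular the series converges. *)
Lemma dist_limn_series_le (u : nat -> R) m (e : R) : 0 <= e ->
  (\sum_(m <= j <oo) (`|u j| `^ delta)%:E <= (e `^ delta)%:E)%E ->
  `|limn (series u) - \sum_(0 <= j < m) u j| <= e.
Proof.
move=> e0 ue.
have split n : (m <= n)%N ->
    series u n = \sum_(0 <= j < m) u j + \sum_(m <= j < n) u j.
  by move=> mn; rewrite seriesEnat/= -big_cat_nat.
have nE n : [normed series u] n = \sum_(0 <= j < n) `|u j| by [].
have cu : cvgn (series u).
  apply: normed_cvg; apply: nondecreasing_is_cvgn.
    apply/nondecreasing_seqP => n.
    by rewrite !nE big_nat_recr//= lerDl.
  exists (\sum_(0 <= j < m) `|u j| + e) => _ [n _ <-].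
  rewrite nE; have [mn|/ltnW nm] := leqP m n.
    rewrite (big_cat_nat (leq0n m) mn)/= lerD2l.
    exact: le_sum_powR_series.
  rewrite (big_cat_nat (leq0n n) nm)/= -addrA lerDl addr_ge0//.
  exact: sumr_ge0.
have cd : `|series u n - \sum_(0 <= j < m) u j| @[n --> \oo] -->
    `|limn (series u) - \sum_(0 <= j < m) u j|.
  by apply: cvg_norm; apply: cvgB => //; exact: cvg_cst.
apply: (cvgr_to_le cd); near=> n.
have mn : (m <= n)%N by near: n; exact: nbhs_infty_ge.
rewrite split// addrAC subrr add0r.
by apply: le_trans (ler_norm_sum _ _ _) _; exact: le_sum_powR_series.
Unshelve. all: by end_near. Qed.

End far_terms.

Lemma le_bigmax_index {R : realType} (x0 : R) (F : nat -> R) N k :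
  (0 < k <= N)%N -> F k <= \big[Num.max/x0]_(1 <= i < N.+1) F i.
Proof. by move=> kN; apply: le_bigmax_seq => //; rewrite mem_index_iota. Qed.

Lemma bigmax_index_le {R : realType} (x0 b : R) (F : nat -> R) N : x0 <= b ->
  (forall i, (0 < i <= N)%N -> F i <= b) ->
  \big[Num.max/x0]_(1 <= i < N.+1) F i <= b.
Proof.
move=> xb Fb; rewrite big_nat; apply: (big_ind (fun u => u <= b)) => //.
by move=> u v ub vb; rewrite ge_max ub.
Qed.

Lemma subz_reflect (i j : nat) : (i <= j)%N ->
  i%:Z - j%:Z = 1 - (j - i).+1%:Z.
Proof. by lia. Qed.

Lemma subz_subn (k N : nat) : (k <= N)%N -> k%:Z = N%:Z - (N - k)%N%:Z.
Proof. by lia. Qed.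

Lemma addn_subz (k j : nat) : (k + j)%N%:Z - j%:Z = k%:Z.
Proof. by lia. Qed.

Section single_jump.
Context {R : realType}.

(** The supremum of the products [c j * z] and of 0, where [cp] and [cm] are the
    suprema of the positive parts of [c j] and of [- c j]. *)
Definition jump (cp cm z : R) : R :=
  Num.max (cp * Num.max z 0) (cm * Num.max (- z) 0).

Lemma jump_ge0 (cp cm z : R) : 0 <= cp -> 0 <= jump cp cm z.
Proof. by move=> cp0; rewrite /jump le_max mulr_ge0// le_max lexx orbT. Qed.

Lemma mul_le_jump (cp cm c z : R) : c <= cp -> - c <= cm -> c * z <= jump cp cm z.
Proof.
move=> ccp ccm; rewrite /jump le_max; have [z0|/ltW z0] := leP 0 z.
  by rewrite ler_wpM2r.
have nz : 0 <= - z by rewrite oppr_ge0.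
by apply/orP; right; rewrite (max_idPl nz) -mulrNN ler_wpM2r.
Qed.

Lemma jump_le (cp cm z b : R) : 0 <= b -> cp * z <= b -> cm * (- z) <= b ->
  jump cp cm z <= b.
Proof.
move=> b0 zb mzb; rewrite /jump ge_max.
have [z0|z0] := leP 0 z; last rewrite mulr0 b0/=.
  rewrite zb/=; have : - z <= 0 by rewrite oppr_le0.
  by move=> /max_idPr ->; rewrite mulr0.
by have /max_idPl -> : 0 <= - z by rewrite oppr_ge0 ltW.
Qed.

Lemma jump_small (cp cm z b h : R) : 0 <= cp <= b -> 0 <= cm <= b -> `|z| <= h ->
  jump cp cm z <= b * h.
Proof.
move=> /andP[cp0 cpb] /andP[cm0 cmb] zh.
have h0 : 0 <= h by rewrite (le_trans _ zh).
apply: jump_le; first by rewrite mulr_ge0// (le_trans cp0).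
  apply: le_trans (_ : cp * h <= _); last by rewrite ler_wpM2r.
  by rewrite ler_wpM2l// (le_trans (ler_norm _)).
apply: le_trans (_ : cm * h <= _); last by rewrite ler_wpM2r.
by rewrite ler_wpM2l// (le_trans (ler_norm _))// normrN.
Qed.

(** [x] is a moving average of [z] up to the error [e]. Any [m] consecutive
    innovations contain at most one above [h], and those next to the ends of
    [1, N] are below [h]: a large innovation before time 1 would act on [x]
    without being counted as a jump, and one shortly before [N] would be counted
    before having met all the coefficients of index below [m]. *)
Variables (c : nat -> R) (z x : int -> R) (cp cm B h e : R) (m n N : nat).
Hypothesis m_gt0 : (0 < m)%N.
Hypothesis N_le_n : (N <= n)%N.
Hypothesis n_gt0 : (0 < n)%N.
Hypothesis h_ge0 : 0 <= h.
Hypothesis cp_ge0 : 0 <= cp.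
Hypothesis cm_ge0 : 0 <= cm.
Hypothesis c_cp : forall j, c j <= cp.
Hypothesis c_cm : forall j, - c j <= cm.
Hypothesis cp_lub : forall u : R, 0 <= u -> (forall j, c j <= u) -> cp <= u.
Hypothesis cm_lub : forall u : R, 0 <= u -> (forall j, - c j <= u) -> cm <= u.
Hypothesis cp_B : cp <= B.
Hypothesis cm_B : cm <= B.
Hypothesis x_near : forall i : nat, (0 < i <= n)%N ->
  `|x i - \sum_(0 <= j < m) c j * z (i%:Z - j%:Z)| <= e.
Hypothesis far_small : forall (k j : nat), (0 < k <= n)%N -> (m <= j)%N ->
  `|c j * z k| <= e.
Hypothesis no_pair : forall i j j' : nat, (0 < i <= n)%N -> (j < j' < m)%N ->
  ~ (h < `|z (i%:Z - j%:Z)| /\ h < `|z (i%:Z - j'%:Z)|).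
Hypothesis small_start : forall j : nat, (j < m)%N -> `|z (1 - j%:Z)| <= h.
Hypothesis small_end : forall j : nat, (j < m)%N -> `|z (N%:Z - j%:Z)| <= h.

Let B_ge0 : 0 <= B. Proof. exact: le_trans cp_B. Qed.

Let c_B j : `|c j| <= B.
Proof. by rewrite ler_norml lerNl (le_trans (c_cm j))// (le_trans (c_cp j)). Qed.

Let e_ge0 : 0 <= e.
Proof. by apply: le_trans (x_near (i := 1) _) => //; rewrite n_gt0. Qed.

Let czB j k : `|z k| <= h -> `|c j * z k| <= B * h.
Proof. by move=> zh; rewrite normrM ler_pM. Qed.

Let others_small (i j0 : nat) : (0 < i <= n)%N -> (j0 < m)%N ->
  (forall j, (j < m)%N -> j != j0 -> `|z (i%:Z - j%:Z)| <= h) ->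
  `|x i - c j0 * z (i%:Z - j0%:Z)| <= m%:R * (B * h) + e.
Proof.
move=> i_n j0m zj; have := x_near i_n.
rewrite big_mkord (bigD1 (Ordinal j0m))//=.
set S := \sum_(_ < _ | _) _; set y := c j0 * _ => xe.
have SB : `|S| <= m%:R * (B * h).
  apply: le_trans (ler_norm_sum _ _ _) _.
  apply: le_trans (ler_sum _ (G := fun=> B * h) _) _ => [j jj0|].
    by apply: czB; apply: zj.
  rewrite sumr_const -[leLHS]mulr_natl ler_wpM2r ?mulr_ge0// ler_nat.
  by rewrite (leq_trans (max_card _))// card_ord.
have -> : x i - y = (x i - (y + S)) + S by ring.
by rewrite (le_trans (ler_normD _ _))// addrC lerD.
Qed.

Let unique_large (i j0 : nat) : (0 < i <= n)%N -> (j0 < m)%N ->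
  h < `|z (i%:Z - j0%:Z)| ->
  forall j, (j < m)%N -> j != j0 -> `|z (i%:Z - j%:Z)| <= h.
Proof.
move=> i_n j0m zj0 j jm jj0; rewrite leNgt; apply/negP => zj.
have [jj0'|jj0'|jE] := ltngtP j j0; last by rewrite jE eqxx in jj0.
- by apply: (@no_pair i j j0) => //; rewrite jj0' j0m.
- by apply: (@no_pair i j0 j) => //; rewrite jj0' jm.
Qed.

Let all_small (i : nat) : (0 < i <= n)%N ->
  (forall j, (j < m)%N -> `|z (i%:Z - j%:Z)| <= h) ->
  `|x i| <= m%:R * (B * h) + e.
Proof.
move=> i_n zs; have := x_near i_n; set S := \sum_(_ <= _ < _) _ => xe.
have SB : `|S| <= m%:R * (B * h).
  apply: le_trans (ler_norm_sum _ _ _) _.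
  rewrite big_nat; apply: le_trans (ler_sum _ (G := fun=> B * h) _) _ => [j jm|].
    by apply: czB; apply: zs.
  by rewrite -big_nat sumr_const_nat subn0 mulr_natl.
have -> : x i = (x i - S) + S by ring.
by rewrite (le_trans (ler_normD _ _))// addrC lerD.
Qed.

Let x1_small : `|x 1| <= m%:R * (B * h) + e.
Proof. by apply: (all_small (i := 1)). Qed.

(** [M] and [J] are the two maxima, known through their universal property.
    Upper bound: [x i] is close to a single term [c j0 * z (i - j0)], which is at
    most the jump at [i - j0]. Lower bound: the value [x (k + j)] is close to
    [c j * z k] for each [j < m], so that all products [c j * z k] are bounded by
    [M] up to the error, hence so is their supremum. *)
Let single_jump_bounds (M J : R) : x 1 <= M -> 0 <= J ->
  (forall i : nat, (0 < i <= N)%N -> x i <= M) ->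
  (forall k : nat, (0 < k <= N)%N -> jump cp cm (z k) <= J) ->
  (forall b : R, x 1 <= b -> (forall i : nat, (0 < i <= N)%N -> x i <= b) ->
    M <= b) ->
  (forall b : R, 0 <= b ->
    (forall k : nat, (0 < k <= N)%N -> jump cp cm (z k) <= b) -> J <= b) ->
  `|M - J| <= m.+1%:R * (B * h) + 2 * e.
Proof.
move=> x1_le J_ge0 x_le J_le M_le J_le'.
have e0 : 0 <= e by exact: e_ge0.
have Bh0 : 0 <= B * h by rewrite mulr_ge0.
have mBh0 : 0 <= m%:R * (B * h) by rewrite mulr_ge0.
have Sm : m.+1%:R * (B * h) = m%:R * (B * h) + B * h by rewrite -natr1; ring.
have up : M <= J + (m%:R * (B * h) + e).
  apply: M_le => [|i /andP[i0 iN]].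
    by rewrite (le_trans (ler_norm _))// (le_trans x1_small)// lerDr.
  have i_n : (0 < i <= n)%N by rewrite i0 (leq_trans iN).
  have [[j0 [j0m zj0]]|nolarge] := pselect (exists j0 : nat,
      (j0 < m)%N /\ h < `|z (i%:Z - j0%:Z)|); last first.
    rewrite (le_trans (ler_norm _))// (le_trans (all_small i_n _)) ?lerDr//.
    by move=> j jm; rewrite leNgt; apply/negP => zj; apply: nolarge; exists j.
  have j0i : (j0 < i)%N.
    rewrite ltnNge; apply/negP => ij0; move: zj0; apply/negP; rewrite -leNgt.
    rewrite subz_reflect//; apply: small_start.
    by rewrite (leq_trans _ j0m)// ltnS ltn_subrL i0 (leq_trans i0).
  have := others_small i_n j0m (unique_large i_n j0m zj0).
  rewrite ler_norml => /andP[_]; rewrite lerBlDr addrC => /le_trans; apply.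
  rewrite lerD2r; apply: le_trans (mul_le_jump (z _) (c_cp j0) (c_cm j0)) _.
  rewrite (subzn (ltnW j0i)); apply: J_le.
  by rewrite subn_gt0 j0i (leq_trans (leq_subr _ _)).
have lo0 : 0 <= M + (m%:R * (B * h) + e).
  by move: x1_small x1_le; rewrite ler_norml; lra.
have lo : J <= M + (m.+1%:R * (B * h) + 2 * e).
  apply: J_le' => [|k /andP[k0 kN]]; first by rewrite Sm; lra.
  have k_n : (0 < k <= n)%N by rewrite k0 (leq_trans kN).
  have [zk|zk] := leP `|z k| h.
    have cpB : 0 <= cp <= B by rewrite cp_ge0.
    have cmB : 0 <= cm <= B by rewrite cm_ge0.
    by apply: le_trans (jump_small cpB cmB zk) _; rewrite Sm; lra.
  have kmN : (k + m <= N)%N.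
    rewrite leqNgt; apply/negP => Nkm; move: zk; apply/negP; rewrite -leNgt.
    by rewrite (subz_subn kN); apply: small_end; rewrite ltn_subLR.
  have cz j : c j * z k <= M + (m%:R * (B * h) + 2 * e).
    have [mj|jm] := leqP m j.
      by have := far_small k_n mj; rewrite ler_norml; lra.
    have kj_N : (0 < k + j <= N)%N.
      by rewrite addn_gt0 k0 (leq_trans _ kmN)// leq_add2l ltnW.
    have kj_n : (0 < k + j <= n)%N.
      by case/andP: kj_N => -> /leq_trans; apply.
    have kjE := addn_subz k j.
    have := @others_small (k + j) j kj_n jm.
    rewrite kjE => /(_ _)/wrap[].
      by apply: unique_large => //; rewrite kjE.
    rewrite ler_norml => /andP[+ _].
    have := x_le _ kj_N.
    lra.
  have b0 : 0 <= M + (m.+1%:R * (B * h) + 2 * e) by rewrite Sm; lra.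
  apply: jump_le => //.
  - have [z0|z0] := ltP 0 (z k); last by rewrite (le_trans _ b0)// mulr_ge0_le0.
    rewrite -ler_pdivlMr//; apply: cp_lub; first by rewrite divr_ge0// ltW.
    by move=> j; rewrite ler_pdivlMr// (le_trans (cz j))// Sm; lra.
  - have [z0|z0] := ltP 0 (- z k); last by rewrite (le_trans _ b0)// mulr_ge0_le0.
    rewrite -ler_pdivlMr//; apply: cm_lub; first by rewrite divr_ge0// ltW.
    by move=> j; rewrite ler_pdivlMr// mulrNN (le_trans (cz j))// Sm; lra.
rewrite ler_norml; apply/andP; split; first lra.
by rewrite Sm; lra.
Qed.

Lemma single_jump :
  `|\big[Num.max/x 1]_(1 <= i < N.+1) x i%:Z -
    \big[Num.max/0]_(1 <= k < N.+1) jump cp cm (z k%:Z)| <=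
  m.+1%:R * (B * h) + 2 * e.
Proof.
apply: single_jump_bounds.
- exact: bigmax_ge_id.
- exact: bigmax_ge_id.
- exact: (le_bigmax_index _ (fun i : nat => x i%:Z)).
- exact: (le_bigmax_index _ (fun k : nat => jump cp cm (z k%:Z))).
- move=> b; exact: bigmax_index_le.
- move=> b; exact: bigmax_index_le.
Qed.

End single_jump.

(** * Approximation of the maxima by the jumps *)
Section coefficient_sup.
Context {R : realType} {T : Type}.
Variable C : nat -> T -> R.

Lemma C_minusE : C_minus C = C_plus (fun j w => - C j w).
Proof. by []. Qed.

Lemma C_plus_ge0 w : 0 <= C_plus C w.
Proof.
rewrite /C_plus; have [[x ux]|nub] := pselect
    (has_ubound [set Num.max (C j w) 0 | j in [set: nat]]).
  apply: le_trans (_ : Num.max (C 0%N w) 0 <= _).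
    by rewrite le_max lexx orbT.
  by apply: ub_le_sup; [exists x|exists 0%N].
by rewrite sup_out// => -[].
Qed.

Variables (w : T) (B : R).
Hypothesis CB : forall j, `|C j w| <= B.

Let ubC : has_ubound [set Num.max (C j w) 0 | j in [set: nat]].
Proof.
exists B => _ [j _ <-]; rewrite ge_max (le_trans (ler_norm _) (CB j)).
exact: le_trans (CB j).
Qed.

Lemma le_C_plus j : C j w <= C_plus C w.
Proof.
apply: le_trans (_ : Num.max (C j w) 0 <= _); first by rewrite le_max lexx.
by apply: ub_le_sup => //; exists j.
Qed.

Lemma C_plus_le u : 0 <= u -> (forall j, C j w <= u) -> C_plus C w <= u.
Proof.
move=> u0 Cu; apply: ge_sup; first by exists (Num.max (C 0%N w) 0), 0%N.
by move=> _ [j _ <-]; rewrite ge_max Cu.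
Qed.

Lemma C_plus_le_bound : C_plus C w <= B.
Proof.
apply: C_plus_le; first exact: le_trans (CB 0).
by move=> j; rewrite (le_trans (ler_norm _)).
Qed.

End coefficient_sup.

Section jump_approximation.
Context {R : realType} {d : measure_display} {T : measurableType d}.
Variable P : probability T R.
Variables (delta alpha : R) (tail : R -> R) (C : nat -> T -> R)
  (Z : int -> T -> R) (a : nat -> R).
Hypothesis delta_gt0 : 0 < delta.
Hypothesis delta_le1 : delta <= 1.
Hypothesis mC : forall j, measurable_fun [set: T] (C j).
Hypothesis mZ : forall i, measurable_fun [set: T] (Z i).
Hypothesis CZ : forall j i, independent_functions P (C j) (Z i).
Hypothesis tailZ : forall i (y : R), fine (P [set w | y < `|Z i w|]) = tail y.
Hypothesis ZZ : forall i i' (y : R), i != i' ->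
  fine (P [set w | y < `|Z i w| /\ y < `|Z i' w|]) = tail y ^+ 2.
Hypothesis C_summable :
  (\sum_(0 <= j <oo) \int[P]_w (`|C j w| `^ delta)%:E < +oo)%E.
Hypothesis geometric : exists x0 B : R, [/\ 0 < x0, 0 < B &
  forall x N, x0 <= x -> \sum_(0 <= k < N)
    2 ^+ k * tail ((2 `^ delta^-1) ^+ k * x) <= B * tail x].
Hypothesis a_gt0 : forall n, 0 < a n.
Hypothesis a_y : a n @[n --> \oo] --> +oo.
Hypothesis tail_a : forall y : R, 0 < y ->
  n%:R * tail (a n * y) @[n --> \oo] --> y `^ (- alpha).

Let mlarge i (y : R) : measurable [set w | y < `|Z i w|].
Proof. by apply: measurable_set_lt => //; exact: measurableT_comp. Qed.

Let tail_ge0 y : 0 <= tail y.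
Proof. by rewrite -(tailZ 0) fine_ge0. Qed.

Let tail_cvg0 (y : R) : 0 < y -> tail (y * a n) @[n --> \oo] --> (0 : R).
Proof.
move=> y0.
have h : (n%:R * tail (a n * y)) * n%:R^-1 @[n --> \oo] --> (0 : R).
  rewrite -(mulr0 (y `^ (- alpha))); apply: cvgM; first exact: tail_a.
  rewrite -(@cvg_shiftS R).
  exact: cvg_harmonic.
apply: cvg_trans h; apply: near_eq_cvg; near=> n.
rewrite mulrAC divff ?mul1r 1?mulrC// pnatr_eq0 -lt0n.
by near: n; exact: nbhs_infty_gt.
Unshelve. all: by end_near. Qed.

(** [n * tail (y * a n)] is bounded and [tail (y * a n)] vanishes. *)
Let tail_sqr_cvg0 (y : R) : 0 < y ->
  n%:R * tail (y * a n) ^+ 2 @[n --> \oo] --> (0 : R).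
Proof.
move=> y0; rewrite (_ : (fun _ => _) =
    fun n => (n%:R * tail (a n * y)) * tail (y * a n)); last first.
  by apply/funext => n; rewrite [a n * y]mulrC -mulrA.
rewrite -(mulr0 (y `^ (- alpha))).
by apply: cvgM; [exact: tail_a|exact: tail_cvg0].
Qed.

Definition big_coefficients B : set T :=
  [set w | ((B `^ delta)%:E < \sum_(0 <= j <oo) (`|C j w| `^ delta)%:E)%E].

Let mbigC B : measurable (big_coefficients B).
Proof.
rewrite /big_coefficients -[X in measurable X]setTI.
apply: emeasurable_fun_o_infty => //.
apply: ge0_emeasurable_sum => [k w _ _|k _]; first by rewrite lee_fin powR_ge0.
apply/measurable_EFinP; apply: measurableT_comp (measurable_powR _) _.
exact: measurableT_comp.
Qed.

Lemma big_coefficients_negligible (eta : R) : 0 < eta ->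
  exists2 B : R, 0 < B & fine (P (big_coefficients B)) <= eta.
Proof.
move=> eta0; have EC0 j : (0 <= \int[P]_w (`|C j w| `^ delta)%:E)%E.
  by apply: integral_ge0 => w _; rewrite lee_fin powR_ge0.
pose S w := (\sum_(0 <= j <oo) (`|C j w| `^ delta)%:E)%E.
have S0 w : (0 <= S w)%E.
  by apply: nneseries_ge0 => j _ _; rewrite lee_fin powR_ge0.
have mCd j : measurable_fun [set: T] (fun w => (`|C j w| `^ delta)%:E).
  apply/measurable_EFinP; apply: measurableT_comp (measurable_powR _) _.
  exact: measurableT_comp.
have mS : measurable_fun setT S.
  by apply: ge0_emeasurable_sum => [k w _ _|k _]; rewrite ?lee_fin ?powR_ge0.
have sE : (\int[P]_w S w =
    (fine (\sum_(0 <= j <oo) \int[P]_w (`|C j w| `^ delta)%:E))%:E)%E.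
  rewrite fineK; first by rewrite integral_nneseries.
  by rewrite ge0_fin_numE//; apply: nneseries_ge0.
set s := fine _ in sE.
have s0 : 0 <= s by rewrite -lee_fin -sE; exact: integral_ge0.
pose b := (s + 1) / eta; have b0 : 0 < b by rewrite divr_gt0// ltr_wpDl.
have B0 : 0 < b `^ delta^-1 by rewrite powR_gt0.
exists (b `^ delta^-1) => //.
have BE : (b `^ delta^-1) `^ delta = b.
  by rewrite -powRrM mulVf ?gt_eqF// powRr1// ltW.
apply: le_trans (_ : fine (P [set w | (b%:E <= S w)%E]) <= _).
  apply: le_fine_probability => //.
    by rewrite -[X in measurable X]setTI; exact: emeasurable_fun_c_infty.
  by move=> w; rewrite /big_coefficients /= BE => /ltW.
rewrite -(ler_pM2l b0) -lee_fin EFinM -probabilityE; last first.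
  by rewrite -[X in measurable X]setTI; exact: emeasurable_fun_c_infty.
apply: le_trans (markov_ge0 P b0 mS S0) _.
by rewrite sE lee_fin /b divfK ?gt_eqF// lerDl.
Qed.

Lemma le_of_not_big_coefficients (B : R) w j : 0 < B ->
  ~ big_coefficients B w -> `|C j w| <= B.
Proof.
move=> B0 /negP; rewrite -leNgt => SB; rewrite leNgt; apply/negP => BC.
have : B `^ delta < `|C j w| `^ delta by rewrite gt0_ltr_powR ?nnegrE// ltW.
rewrite ltNge => /negP; apply; rewrite -lee_fin; apply: le_trans SB.
apply: le_trans (_ : (\sum_(0 <= i < j.+1) (`|C i w| `^ delta)%:E <= _)%E).
  rewrite big_nat_recr//= leeDr//; apply: sume_ge0 => i _.
  by rewrite lee_fin powR_ge0.
by apply: nneseries_lim_ge => i _ _; rewrite lee_fin powR_ge0.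
Qed.

Let pair_event n m (h : R) := [set w | exists2 i, (i < n)%N & exists2 j, (j < m)%N &
  exists2 j', (j' < m)%N & j != j' /\
    (h < `|Z (i.+1%:Z - j%:Z) w| /\ h < `|Z (i.+1%:Z - j'%:Z) w|)].

Let measurable_pair_event n m h : measurable (pair_event n m h).
Proof.
apply: measurable_exists_lt => i _; apply: measurable_exists_lt => j _.
apply: measurable_exists_lt => j' _.
have [jj'|jj'] := boolP (j != j'); last first.
  by rewrite [X in measurable X](_ : _ = set0)//; apply/seteqP; split=> w // -[].
rewrite [X in measurable X](_ : _ = [set w | h < `|Z (i.+1%:Z - j%:Z) w|] `&`
  [set w | h < `|Z (i.+1%:Z - j'%:Z) w|]); first exact: measurableI.
by apply/seteqP; split=> w //= -[].
Qed.

Let pair_event_le n m h :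
  fine (P (pair_event n m h)) <= n%:R * (m%:R * (m%:R * tail h ^+ 2)).
Proof.
have mE i j j' : measurable [set w | j != j' /\
    (h < `|Z (i.+1%:Z - j%:Z) w| /\ h < `|Z (i.+1%:Z - j'%:Z) w|)].
  have [jj'|jj'] := boolP (j != j'); last first.
    by rewrite [X in measurable X](_ : _ = set0)//; apply/seteqP; split=> w // -[].
  rewrite [X in measurable X](_ : _ = [set w | h < `|Z (i.+1%:Z - j%:Z) w|] `&`
    [set w | h < `|Z (i.+1%:Z - j'%:Z) w|]); first exact: measurableI.
  by apply/seteqP; split=> w //= -[].
apply: fine_probability_exists_lt_const => [i _|i _].
  by do 2 (apply: measurable_exists_lt => ? _); exact: mE.
apply: fine_probability_exists_lt_const => [j _|j _].
  by apply: measurable_exists_lt => ? _; exact: mE.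
apply: fine_probability_exists_lt_const => j' _; first exact: mE.
have [jj'|jj'] := eqVneq j j'.
  rewrite [X in P X](_ : _ = set0) ?measure0/= ?sqr_ge0//.
  by apply/seteqP; split=> w // -[].
rewrite -(ZZ (i := i.+1%:Z - j%:Z) (i' := i.+1%:Z - j'%:Z)); last first.
  by apply: contra_neq jj' => /addrI/oppr_inj[].
rewrite [X in P X](_ : _ = [set w | h < `|Z (i.+1%:Z - j%:Z) w| /\
  h < `|Z (i.+1%:Z - j'%:Z) w|])//.
by apply/seteqP; split=> w //= -[].
Qed.

Let end_event n m K (h : R) := [set w | exists2 l, (l < K.+1)%N &
  exists2 j, (j < m)%N & h < `|Z ((n * l %/ K)%N%:Z - j%:Z) w|].

Let start_event m (h : R) := [set w | exists2 j, (j < m)%N & h < `|Z (1 - j%:Z) w|].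

Let measurable_end_event n m K h : measurable (end_event n m K h).
Proof.
by do 2 (apply: measurable_exists_lt => ? _); exact: mlarge.
Qed.

Let measurable_start_event m h : measurable (start_event m h).
Proof. by apply: measurable_exists_lt => ? _; exact: mlarge. Qed.

Let end_event_le n m K h :
  fine (P (end_event n m K h)) <= K.+1%:R * (m%:R * tail h).
Proof.
apply: fine_probability_exists_lt_const => l _.
  by apply: measurable_exists_lt => ? _; exact: mlarge.
apply: fine_probability_exists_lt_const => j _; first exact: mlarge.
by rewrite -(tailZ ((n * l %/ K)%N%:Z - j%:Z)).
Qed.

Let start_event_le m h : fine (P (start_event m h)) <= m%:R * tail h.
Proof.
apply: fine_probability_exists_lt_const => j _; first exact: mlarge.
by rewrite -(tailZ (1 - j%:Z)).
Qed.

Definition jump_maximum (w : T) (N : nat) : R :=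
  \big[Num.max/0]_(1 <= k < N.+1) jump (C_plus C w) (C_minus C w) (Z k%:Z w).

(** Off this event the innovations and coefficients satisfy the hypotheses of
    [single_jump] for all grid times [n * l %/ K] at once. *)
Let bad_event (B eps : R) n m K (h : R) :=
  big_coefficients B `|`
  (far_event delta C Z a eps n (fun i j => i.+1%:Z - j%:Z) m `|`
  (far_event delta C Z a eps n (fun i j => i.+1%:Z) m `|`
  (pair_event n m h `|` (start_event m h `|` end_event n m K h)))).

Let measurable_bad_event B eps n m K h : measurable (bad_event B eps n m K h).
Proof.
do !apply: measurableU => //; exact: measurable_far_event.
Qed.

Let bad_event_le B eps n m K h : fine (P (bad_event B eps n m K h)) <=
  fine (P (big_coefficients B)) +
  (fine (P (far_event delta C Z a eps n (fun i j => i.+1%:Z - j%:Z) m)) +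
  (fine (P (far_event delta C Z a eps n (fun i j => i.+1%:Z) m)) +
  (n%:R * (m%:R * (m%:R * tail h ^+ 2)) +
  (m%:R * tail h + K.+1%:R * (m%:R * tail h))))).
Proof.
have mf sigma : measurable (far_event delta C Z a eps n sigma m).
  exact: measurable_far_event.
apply: le_trans (fine_probabilityU _ _ _) _ => //.
  by do !apply: measurableU => //; exact: mf.
rewrite lerD2l; apply: le_trans (fine_probabilityU _ _ _) _ => //.
  by do !apply: measurableU => //; exact: mf.
rewrite lerD2l; apply: le_trans (fine_probabilityU _ _ _) _ => //.
  by do !apply: measurableU => //; exact: mf.
rewrite lerD2l; apply: le_trans (fine_probabilityU _ _ _) _ => //.
  by do !apply: measurableU => //; exact: mf.
apply: lerD => //; apply: le_trans (fine_probabilityU _ _ _) _ => //.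
exact: lerD.
Qed.

Lemma jump_approximation_off_bad_event B eps n m K h w l : (0 < K)%N ->
  (0 < n)%N -> (0 < m)%N -> 0 < B -> 0 < eps -> 0 < h -> (l <= K)%N ->
  ~ bad_event B eps n m K h w ->
  `|\big[Num.max/linear_process C Z 1 w]_(1 <= i < (n * l %/ K).+1)
      linear_process C Z i%:Z w - jump_maximum w (n * l %/ K)| <=
  m.+1%:R * (B * h) + 2 * (eps * a n).
Proof.
move=> K0 n0 m0 B0 eps0 h0 lK /not_orP[nC /not_orP[nF1 /not_orP[nF2
  /not_orP[nP /not_orP[nS nE]]]]].
have ea0 : 0 <= eps * a n by rewrite mulr_ge0 ?ltW.
have CB j : `|C j w| <= B by exact: le_of_not_big_coefficients.
have CNB j : `|- C j w| <= B by rewrite normrN.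
apply: (@single_jump _ (fun j => C j w) (fun i => Z i w)
  (fun i => linear_process C Z i w) _ _ _ _ _ m n) => //.
- by rewrite -{2}(mulnK n K0) leq_div2r// leq_mul2l lK orbT.
- exact: ltW.
- exact: C_plus_ge0.
- exact: (C_plus_ge0 (fun j w => - C j w)).
- exact: (le_C_plus CB).
- exact: (le_C_plus (C := fun j w => - C j w) CNB).
- exact: C_plus_le.
- exact: (C_plus_le (C := fun j w => - C j w)).
- exact: (C_plus_le_bound CB).
- exact: (C_plus_le_bound (C := fun j w => - C j w) CNB).
- move=> [//|i] /andP[_ ni].
  apply: (dist_limn_series_le delta_gt0 delta_le1) => //.
  rewrite leNgt; apply/negP => big; apply: nF1.
  by exists i.
- move=> [//|k] j /andP[_ nk] mj.
  have [] // := lerP `|C j w * Z k.+1%:Z w| (eps * a n).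
  move=> big; exfalso; apply: nF2; exists k => //.
  apply: lt_le_trans (_ : ((`|C j w * Z k.+1%:Z w| `^ delta)%:E <= _)%E).
    by rewrite lte_fin gt0_ltr_powR ?nnegrE.
  have mj1 : (m <= j.+1)%N by rewrite ltnW.
  apply: le_trans (nneseries_lim_ge j.+1 _); last first.
    by move=> i _ _; rewrite lee_fin powR_ge0.
  rewrite big_nat_recr//= leeDr//; apply: sume_ge0 => i _.
  by rewrite lee_fin powR_ge0.
- move=> [//|i] j j' /andP[_ ni] /andP[jj' j'm] [zj zj']; apply: nP.
  exists i => //; exists j; first exact: ltn_trans j'm.
  by exists j' => //; split=> //; rewrite ltn_eqF.
- move=> j jm; rewrite leNgt; apply/negP => zj; apply: nS; by exists j.
- move=> j jm; rewrite leNgt; apply/negP => zj; apply: nE.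
  by exists l; rewrite ?ltnS//; exists j.
Qed.

(** Two innovations above the order of [a n] within [m] steps have a probability
    of order [n * m ^ 2 * tail (a n) ^ 2], and a large innovation near time 1 or
    a grid time one of order [K * m * tail (a n)]. Once [B] and [m] are chosen so
    that large coefficients and far coefficients are unlikely to matter, both
    vanish as [n] grows. *)
Lemma jump_approximation K (eps eta : R) : (0 < K)%N -> 0 < eps -> 0 < eta ->
  \forall n \near \oo, exists E : set T, [/\ measurable E,
    fine (P E) <= eta & forall w, ~ E w -> forall l, (l <= K)%N ->
    `|scaled_max (a n) (fun i => linear_process C Z i w) (n * l %/ K) -
      (a n)^-1 * jump_maximum w (n * l %/ K)| <= eps].
Proof.
move=> K0 eps0 eta0.
have eta60 : 0 < eta / 6 by rewrite divr_gt0.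
have eps40 : 0 < eps / 4 by rewrite divr_gt0.
have [B B0 PB] := big_coefficients_negligible eta60.
have far := far_event_negligible delta_gt0 mC mZ CZ tailZ C_summable geometric
  a_gt0 a_y tail_a eps40 eta60.
have [m [m0 farm]] : exists m, (0 < m)%N /\ \forall n \near \oo,
    forall sigma, fine (P (far_event delta C Z a (eps / 4) n sigma m)) <= eta / 6.
  near \oo => m; exists m; split; near: m => //; exact: nbhs_infty_gt.
(* So that m.+1 * (B * (y * a n)) is half of eps * a n. *)
pose y := eps / (2 * m.+1%:R * B).
have y0 : 0 < y by rewrite divr_gt0// !mulr_gt0.
have mR0 : 0 < m%:R :> R by rewrite ltr0n.
have m20 : 0 < m%:R * m%:R :> R by rewrite mulr_gt0.
have Km0 : 0 < K.+1%:R * m%:R :> R by rewrite mulr_gt0 ?ltr0n.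
near=> n.
have n0 : (0 < n)%N by near: n; exact: nbhs_infty_gt.
have h0 : 0 < y * a n by rewrite mulr_gt0.
exists (bad_event B (eps / 4) n m K (y * a n)); split => //.
  apply: le_trans (bad_event_le _ _ _ _ _ _) _.
  have f1 : fine (P (far_event delta C Z a (eps / 4) n
      (fun i j => i.+1%:Z - j%:Z) m)) <= eta / 6.
    by move: (fun i j => _); near: n.
  have f2 : fine (P (far_event delta C Z a (eps / 4) n
      (fun i j => i.+1%:Z) m)) <= eta / 6.
    by move: (fun i j => _); near: n.
  have f3 : n%:R * (m%:R * (m%:R * tail (y * a n) ^+ 2)) <= eta / 6.
    have -> : n%:R * (m%:R * (m%:R * tail (y * a n) ^+ 2)) =
      m%:R * m%:R * (n%:R * tail (y * a n) ^+ 2) by ring.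
    rewrite mulrC -ler_pdivlMr//; near: n.
    by apply: (cvgr_le _ (tail_sqr_cvg0 y0)); rewrite divr_gt0.
  have f4 : m%:R * tail (y * a n) <= eta / 6.
    rewrite mulrC -ler_pdivlMr ?ltr0n//; near: n.
    by apply: (cvgr_le _ (tail_cvg0 y0)); rewrite divr_gt0.
  have f5 : K.+1%:R * (m%:R * tail (y * a n)) <= eta / 6.
    rewrite mulrA mulrC -ler_pdivlMr//; near: n.
    by apply: (cvgr_le _ (tail_cvg0 y0)); rewrite divr_gt0.
  lra.
move=> w nw l lK.
have := jump_approximation_off_bad_event K0 n0 m0 B0 eps40 h0 lK nw.
rewrite /scaled_max -mulrBr normrM gtr0_norm ?invr_gt0// ler_pdivrMl//.
move=> /le_trans; apply.
have -> : m.+1%:R * (B * (y * a n)) = eps / 2 * a n.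
  by rewrite /y; field; rewrite gt_eqF//= pnatr_eq0.
lra.
Unshelve. all: by end_near. Qed.

End jump_approximation.

(** * Maxima of independent innovations over blocks *)
Section poisson_limit.
Context {R : realType}.

(** [1 - q] lies between [expR (- (q / (1 - q)))] and [expR (- q)]. *)
Lemma cvg_pow_expR (q : nat -> R) (N : nat -> nat) (c : R) :
  (forall n, 0 <= q n <= 1) -> q n @[n --> \oo] --> (0 : R) ->
  (N n)%:R * q n @[n --> \oo] --> c ->
  (1 - q n) ^+ N n @[n --> \oo] --> expR (- c).
Proof.
move=> q01 q0 Nq.
have up : expR (- ((N n)%:R * q n)) @[n --> \oo] --> expR (- c).
  by apply: continuous_cvg; [exact: continuous_expR|exact: cvgN].
have lo : expR (- ((N n)%:R * q n / (1 - q n))) @[n --> \oo] --> expR (- c).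
  apply: continuous_cvg; first exact: continuous_expR.
  apply: cvgN; rewrite -[c]divr1 -[X in _ / X](subr0 1).
  apply: cvgM => //; apply: cvgV; first by rewrite subr0.
  by apply: cvgB => //; exact: cvg_cst.
apply: (squeeze_cvgr _ lo up); near=> n.
have /andP[qn0 qn1] := q01 n.
have q1 : q n < 1 by near: n; apply: (cvgr_lt _ q0).
have q1' : 0 < 1 - q n by rewrite subr_gt0.
have E (x : R) : expR (- ((N n)%:R * x)) = expR (- x) ^+ N n.
  by rewrite -mulrN expRM_natl.
rewrite -mulrA !E !lerXn2r ?nnegrE ?expR_ge0 ?subr_ge0//.
  by apply: le_trans (expR_ge1Dx _); rewrite lexx.
rewrite expRN -[leRHS]invrK lef_pV2 ?posrE ?invr_gt0 ?expR_gt0//.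
apply: le_trans (expR_ge1Dx _).
suff -> : 1 + q n / (1 - q n) = (1 - q n)^-1 by [].
by field; rewrite gt_eqF.
Unshelve. all: by end_near. Qed.

(** The number of [k] with [l / K < k / n <= (l + 1) / K]. *)
Definition block_size K n l : nat := (n * l.+1 %/ K - n * l %/ K)%N.

Lemma block_size_cvg K l : (0 < K)%N ->
  (block_size K n l)%:R / n%:R @[n --> \oo] --> (K%:R^-1 : R).
Proof.
move=> K0; apply/cvgrPdist_le => e e0; near=> n.
have n0 : (0 < n)%N by near: n; exact: nbhs_infty_gt.
have K0' : 0 < K%:R :> R by rewrite ltr0n.
have n0' : 0 < n%:R :> R by rewrite ltr0n.
have fl (m : nat) : (m %/ K)%:R <= m%:R / K%:R :> R /\
    m%:R / K%:R < (m %/ K)%:R + 1 :> R.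
  rewrite ler_pdivlMr// ltr_pdivrMr// -natrM ler_nat leq_divM natr1 -natrM.
  by rewrite ltr_nat ltn_ceil.
have mono : (n * l %/ K <= n * l.+1 %/ K)%N by rewrite leq_div2r// leq_mul2l leqnSn orbT.
have [a1 a2] := fl (n * l.+1)%N; have [b1 b2] := fl (n * l)%N.
have nlE : (n * l.+1)%:R / K%:R - (n * l)%:R / K%:R = n%:R / K%:R :> R.
  by rewrite -mulrBl -natrB ?leq_mul2l ?leqnSn ?orbT// -mulnBr subSnn muln1.
have bE : (block_size K n l)%:R = (n * l.+1 %/ K)%:R - (n * l %/ K)%:R :> R.
  by rewrite /block_size natrB.
have d1 : `|n%:R / K%:R - (block_size K n l)%:R| <= 1 :> R.
  by rewrite ler_norml bE; lra.
have -> : K%:R^-1 - (block_size K n l)%:R / n%:R =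
    (n%:R / K%:R - (block_size K n l)%:R) / n%:R :> R.
  by field; rewrite !gt_eqF.
rewrite normrM [X in _ * X]gtr0_norm ?invr_gt0//.
apply: le_trans (_ : 1 / n%:R <= _); first by rewrite ler_wpM2r// invr_ge0 ltW.
rewrite ler_pdivrMr// mulrC -ler_pdivrMr//; near: n; exact: nbhs_infty_ger.
Unshelve. all: by end_near. Qed.

(** The ceiling of [k * K / n], that is, the index [l] of the first grid point
    [l / K] that is not before [k / n]. *)
Definition block_index K n k : nat := ((k * K + n.-1) %/ n)%N.

Lemma block_index_le K n k l : (0 < n)%N -> (0 < K)%N ->
  (block_index K n k <= l)%N = (k <= n * l %/ K)%N.
Proof.
move=> n0 K0; rewrite /block_index leq_divRL// -ltnS ltn_divLR//.
have -> : (l.+1 * n = (n * l + n.-1).+1)%N.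
  by rewrite mulSn -{1}(prednK n0) addSn mulnC addnC.
by rewrite ltnS leq_add2r.
Qed.

Lemma block_indexE K n k l : (0 < n)%N -> (0 < K)%N ->
  (n * l %/ K < k <= n * l.+1 %/ K)%N -> block_index K n k = l.+1.
Proof.
move=> n0 K0 /andP[lk kl]; apply/eqP; rewrite eqn_leq block_index_le// kl/=.
by rewrite ltnNge block_index_le// -ltnNge.
Qed.

Lemma prod_block_index K n (f : nat -> R) : (0 < n)%N -> (0 < K)%N ->
  \prod_(1 <= k < n.+1) f (block_index K n k) =
  \prod_(0 <= l < K) f l.+1 ^+ block_size K n l.
Proof.
move=> n0 K0; suff main L : \prod_(1 <= k < (n * L %/ K).+1)
    f (block_index K n k) = \prod_(0 <= l < L) f l.+1 ^+ block_size K n l.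
  by rewrite -main mulnK.
elim: L => [|L IH]; first by rewrite muln0 div0n !big_geq.
have LL : (n * L %/ K <= n * L.+1 %/ K)%N.
  by rewrite leq_div2r// leq_mul2l leqnSn orbT.
rewrite [RHS]big_nat_recr//= -IH (big_cat_nat (n := (n * L %/ K).+1))//=.
congr (_ * _).
rewrite big_nat (eq_bigr (fun=> f L.+1)); last first.
  by move=> k; rewrite ltnS => kL; rewrite (block_indexE n0 K0 kL).
by rewrite -big_nat prodr_const_nat subSS.
Qed.

End poisson_limit.

Section block_maxima.
Context {R : realType} {d : measure_display} {T : measurableType d}.
Variable P : probability T R.
Variables (Z : int -> T -> R) (a : nat -> R) (alpha p r : R).
Hypothesis mZ : forall i, measurable_fun [set: T] (Z i).
Hypothesis Z_indep : mutually_independent P Z.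
Hypothesis Z_id : identically_distributed P Z.
Hypothesis alpha_gt0 : 0 < alpha.
Hypothesis a_gt0 : forall n, 0 < a n.
Hypothesis right_tail : forall y : R, 0 < y ->
  n%:R * fine (P [set w | a n * y < Z 1 w]) @[n --> \oo] -->
  p * y `^ (- alpha).
Hypothesis left_tail : forall y : R, 0 < y ->
  n%:R * fine (P [set w | Z 1 w < - (a n * y)]) @[n --> \oo] -->
  r * y `^ (- alpha).

Lemma measurable_jump (u1 u2 : R) : measurable_fun [set: R] (jump u1 u2).
Proof.
apply: measurable_maxr; apply: measurable_funM => //.
- exact: measurable_maxr.
- by apply: measurable_maxr => //; exact: measurable_oppr.
Qed.

Let mjump u1 u2 b i : measurable [set w | b < jump u1 u2 (Z i w)].
Proof.
apply: measurable_set_lt => //.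
exact: measurableT_comp (measurable_jump u1 u2) (mZ i).
Qed.

Let lt_mul_max (c u z : R) : 0 < c -> 0 < u ->
  (c < u * Num.max z 0) = (c / u < z).
Proof.
move=> c0 u0; rewrite mulrC -ltr_pdivrMr// lt_max.
by rewrite [_ < 0]ltNge ltW ?orbF// divr_gt0.
Qed.

Let half_tail (Y : T -> R) (q u b : R) : (forall y : R, 0 < y ->
    n%:R * fine (P [set w | a n * y < Y w]) @[n --> \oo] -->
    q * y `^ (- alpha)) -> 0 <= u -> 0 < b ->
  n%:R * fine (P [set w | b * a n < u * Num.max (Y w) 0]) @[n --> \oo] -->
  b `^ (- alpha) * (q * u `^ alpha).
Proof.
move=> tY; rewrite le_eqVlt => /predU1P[<- b0|u0 b0].
  rewrite powR0 ?gt_eqF// !mulr0 (_ : (fun _ => _) = fun=> 0); first exact: cvg_cst.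
  apply/funext => n; rewrite [X in P X](_ : _ = set0) ?measure0 ?mulr0//.
  by apply/seteqP; split=> w //=; rewrite mul0r ltNge mulr_ge0// ltW.
have bu0 : 0 < b / u by rewrite divr_gt0.
have -> : b `^ (- alpha) * (q * u `^ alpha) = q * (b / u) `^ (- alpha).
  rewrite powRM ?invr_ge0 ?(ltW b0) ?(ltW u0)//.
  by rewrite -(powR_inv1 (ltW u0)) -powRrM mulrNN mul1r; ring.
rewrite (_ : (fun _ => _) = fun n =>
    n%:R * fine (P [set w | a n * (b / u) < Y w])); first exact: tY.
apply/funext => n; congr (_ * fine (P _)); apply/seteqP; split=> w /=;
  by rewrite lt_mul_max ?mulr_gt0// mulrA [a n * b]mulrC.
Qed.

(** A large jump comes either from a large positive or from a large negative
    innovation, and these exclude each other. *)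
Lemma jump_tail_cvg (u1 u2 b : R) : 0 <= u1 -> 0 <= u2 -> 0 < b ->
  n%:R * fine (P [set w | b * a n < jump u1 u2 (Z 1 w)]) @[n --> \oo] -->
  b `^ (- alpha) * (p * u1 `^ alpha + r * u2 `^ alpha).
Proof.
move=> u10 u20 b0; rewrite mulrDr.
have mhalf (Y : T -> R) u c : measurable_fun [set: T] Y ->
    measurable [set w | c < u * Num.max (Y w) 0].
  move=> mY; apply: measurable_set_lt => //; apply: measurable_funM => //.
  exact: measurable_maxr.
have mNZ : measurable_fun [set: T] (fun w => - Z 1 w).
  exact: measurableT_comp.
rewrite (_ : (fun _ => _) = fun n =>
  n%:R * fine (P [set w | b * a n < u1 * Num.max (Z 1 w) 0]) +
  n%:R * fine (P [set w | b * a n < u2 * Num.max (- Z 1 w) 0])).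
  apply: cvgD; first exact: half_tail.
  apply: half_tail => // y y0; have := left_tail y0.
  rewrite [X in X @ _ --> _ -> _](_ : _ = fun n =>
    n%:R * fine (P [set w | a n * y < - Z 1 w]))//.
  apply/funext => n; congr (_ * fine (P _)); apply/seteqP; split=> w /=;
    by rewrite ltrNr.
apply/funext => n; rewrite -mulrDr; congr (_ * _).
have ban : 0 < b * a n by rewrite mulr_gt0.
rewrite -fineD ?fin_num_measure//; [|exact: mhalf|exact: mhalf].
rewrite -measureU; [|exact: mhalf|exact: mhalf|].
  congr (fine (P _)); apply/seteqP; split=> w /=;
    by rewrite /jump lt_max => /orP.
apply/seteqP; split=> w //= [].
have [z0|z0] := leP 0 (Z 1 w).
  have : - Z 1 w <= 0 by rewrite oppr_le0.
  by move=> /max_idPr -> _; rewrite mulr0 ltNge ltW.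
by rewrite mulr0 ltNge ltW.
Qed.

Variables (K : nat) (y : nat -> R).
Hypothesis K_gt0 : (0 < K)%N.
Hypothesis y_gt0 : forall l, 0 < y l.

Let q u1 u2 z n l := fine (P [set w | z * y l * a n < jump u1 u2 (Z 1 w)]).

Lemma block_probability u1 u2 (z : R) n : (0 < n)%N ->
  fine (P [set w | forall k : nat, (0 < k <= n)%N ->
    jump u1 u2 (Z k w) <= z * y (block_index K n k) * a n]) =
  \prod_(0 <= l < K) (1 - q u1 u2 z n l.+1) ^+ block_size K n l.
Proof.
move=> n0.
pose B (i : int) := [set x | jump u1 u2 x <= z * y (block_index K n `|i|%N) * a n].
have mB i : measurable (B i).
  exact: (measurable_set_le (measurable_jump u1 u2)).
pose s := [seq k%:Z | k <- index_iota 1 n.+1].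
have us : uniq s by rewrite map_inj_uniq ?iota_uniq// => i j [].
have := Z_indep us mB.
rewrite (_ : \bigcap_(i in _) _ = [set w | forall k : nat, (0 < k <= n)%N ->
    jump u1 u2 (Z k w) <= z * y (block_index K n k) * a n]); last first.
  apply/seteqP; split=> w /= h.
    move=> k kn; apply: (h k%:Z) => /=.
    by apply: map_f; rewrite mem_index_iota.
  by move=> i /= /mapP[k]; rewrite mem_index_iota => kn ->; exact: h.
move=> ->; rewrite big_map.
rewrite (eq_bigr (fun k => (1 - q u1 u2 z n (block_index K n k))%:E)).
  rewrite prodEFin /=.
  exact: (prod_block_index (fun l => 1 - q u1 u2 z n l)).
move=> k _; rewrite (Z_id k%:Z 1 (mB k%:Z)).
rewrite (_ : _ @^-1` _ = ~` [set w | z * y (block_index K n k) * a n <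
    jump u1 u2 (Z 1 w)]).
  by rewrite probability_setC// EFinB -probabilityE.
by apply/seteqP; split=> w; rewrite /B /= leNgt => /negP.
Qed.

(** The probability that [u1 * W1] and [u2 * W2] stay below [z * y l] at the grid
    points [l / K], for independent extremal processes [W1] and [W2] with the
    constants [p] and [r]: a product over the cells of the grid of Frechet
    distribution functions. *)
Definition frechet_block (u1 u2 z : R) : R :=
  \prod_(0 <= l < K) expR (- (K%:R^-1 * ((z * y l.+1) `^ (- alpha) *
    (p * u1 `^ alpha + r * u2 `^ alpha)))).

Lemma block_probability_cvg (u1 u2 z : R) : 0 <= u1 -> 0 <= u2 -> 0 < z ->
  fine (P [set w | forall k : nat, (0 < k <= n)%N ->
    jump u1 u2 (Z k w) <= z * y (block_index K n k) * a n]) @[n --> \oo] -->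
  frechet_block u1 u2 z.
Proof.
move=> u10 u20 z0.
have h : \prod_(0 <= l < K) (1 - q u1 u2 z n l.+1) ^+ block_size K n l
    @[n --> \oo] --> frechet_block u1 u2 z.
  apply: cvgn_prod => l.
  have zy0 : 0 < z * y l.+1 by rewrite mulr_gt0.
  have nq := jump_tail_cvg u10 u20 zy0.
  have nV : n%:R^-1 @[n --> \oo] --> (0 : R).
    by rewrite -(@cvg_shiftS R); exact: cvg_harmonic.
  apply: cvg_pow_expR => [n||].
  - by rewrite fine_ge0//= fine_probability_le1.
  - have h : n%:R^-1 * (n%:R * q u1 u2 z n l.+1) @[n --> \oo] --> (0 : R).
      rewrite -(mul0r ((z * y l.+1) `^ (- alpha) *
        (p * u1 `^ alpha + r * u2 `^ alpha))).
      exact: cvgM nV nq.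
    apply: cvg_trans h; apply: near_eq_cvg.
    near=> n; rewrite /= mulrA mulVf ?mul1r// pnatr_eq0 -lt0n.
    by near: n; exact: nbhs_infty_gt.
  - have h : (block_size K n l)%:R / n%:R * (n%:R * q u1 u2 z n l.+1)
        @[n --> \oo] --> K%:R^-1 * ((z * y l.+1) `^ (- alpha) *
        (p * u1 `^ alpha + r * u2 `^ alpha)).
      exact: cvgM (block_size_cvg l K_gt0) nq.
    apply: cvg_trans h.
    apply: near_eq_cvg; near=> n; rewrite /= mulrA divfK// pnatr_eq0 -lt0n.
    by near: n; exact: nbhs_infty_gt.
apply: cvg_trans h; apply: near_eq_cvg; near=> n; rewrite block_probability//.
by near: n; exact: nbhs_infty_gt.
Unshelve. all: by end_near. Qed.

End block_maxima.

(** * Averaging over the random coefficients *)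
(** The supremum is taken in the extended reals, where it is measurable; where
    it is infinite, both [sup] and [fine] give 0. *)
Lemma measurable_C_plus {R : realType} {d : measure_display}
    {T : measurableType d} (C : nat -> T -> R) :
  (forall j, measurable_fun [set: T] (C j)) ->
  measurable_fun [set: T] (C_plus C).
Proof.
move=> mC.
have mCp (j : nat) : measurable_fun [set: T] (fun w => (Num.max (C j w) 0)%:E).
  by apply/measurable_EFinP; exact: measurable_maxr.
rewrite (_ : C_plus C = fine \o
    (fun w => esups (fun j : nat => (Num.max (C j w) 0)%:E) 0%N)).
  by apply: measurableT_comp; [exact: fine_measurable|exact: measurable_fun_esups].
apply/funext => w; rewrite /C_plus /esups /sdrop /=.
rewrite [X in ereal_sup X](_ : _ =
    EFin @` [set Num.max (C j w) 0 | j in [set: nat]]); last first.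
  apply/seteqP; split=> [_ [j _ <-]|_ [_ [j _ <-] <-]]; last by exists j.
  by exists (Num.max (C j w) 0) => //; exists j.
have ne : [set Num.max (C j w) 0 | j in [set: nat]] !=set0.
  by exists (Num.max (C 0%N w) 0), 0%N.
have [ub|nub] := pselect (has_ubound [set Num.max (C j w) 0 | j in [set: nat]]).
  by rewrite ereal_sup_EFin.
by rewrite hasNub_ereal_sup// sup_out// => -[].
Qed.

(** Through the identity, a whole family of variables is one random element with
    values in the space with the generated sigma-algebra, and independence of
    sigma-algebras becomes independence of two functions. *)
Lemma measurable_id_generated {d : measure_display} {T : measurableType d}
    (G : set (set T)) : G `<=` measurable ->
  measurable_fun [set: T] (id : T -> g_sigma_algebraType G).
Proof.
move=> Gm _ A mA; rewrite setTI /=.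
by apply: (smallest_sub _ Gm) mA; exact: sigma_algebra_measurable.
Qed.

Section mixed_frechet_block.
Context {R : realType}.
Variables (alpha p r : R) (K : nat) (y : nat -> R).
Hypotheses (p_ge0 : 0 <= p) (r_ge0 : 0 <= r).

Lemma frechet_block_norm_le1 u1 u2 z : `|frechet_block alpha p r K y u1 u2 z| <= 1.
Proof.
rewrite /frechet_block ger0_norm; last by apply: prodr_ge0 => l _; exact: expR_ge0.
apply: numdomain.Num.Theory.prodr_ile1 => l _; rewrite expR_ge0/= -expR0 ler_expR oppr_le0.
by rewrite !mulr_ge0 ?addr_ge0 ?mulr_ge0 ?powR_ge0 ?invr_ge0.
Qed.

Lemma measurable_frechet_block z : measurable_fun [set: R * R]
  (fun u => frechet_block alpha p r K y u.1 u.2 z).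
Proof.
apply: measurable_prod => l _.
have m1 : measurable_fun [set: R * R] (fun u => u.1 `^ alpha).
  exact: measurableT_comp (measurable_powR _) measurable_fst.
have m2 : measurable_fun [set: R * R] (fun u => u.2 `^ alpha).
  exact: measurableT_comp (measurable_powR _) measurable_snd.
apply: measurableT_comp => //; apply: measurableT_comp => //.
apply: measurable_funM => //; apply: measurable_funM => //.
by apply: measurable_funD; apply: measurable_funM.
Qed.

End mixed_frechet_block.

Section mixed_blocks.
Context {R : realType} {d : measure_display} {T : measurableType d}.
Variable P : probability T R.
Variables (C : nat -> T -> R) (Z : int -> T -> R) (a : nat -> R).
Variables (alpha p r : R) (K : nat) (y : nat -> R).
Hypothesis mC : forall j, measurable_fun [set: T] (C j).
Hypothesis mZ : forall i, measurable_fun [set: T] (Z i).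
Hypothesis C_Z_indep : independent_sigma P (sigma_gen setT C) (sigma_gen setT Z).
Hypothesis a_gt0 : forall n, 0 < a n.
Hypothesis K_gt0 : (0 < K)%N.
Hypothesis y_gt0 : forall l, 0 < y l.
Hypothesis y_homo : {homo y : l l' / (l <= l')%N >-> l <= l'}.
Hypothesis block_cvg : forall u1 u2 z : R, 0 <= u1 -> 0 <= u2 -> 0 < z ->
  fine (P [set w | forall k : nat, (0 < k <= n)%N ->
    jump u1 u2 (Z k w) <= z * y (block_index K n k) * a n]) @[n --> \oo] -->
  frechet_block alpha p r K y u1 u2 z.

(** As [y] is nondecreasing, an innovation need only be compared with the level
    at the first grid point that is not before it. *)
Lemma jump_maximum_leP n (z : R) w : (0 < n)%N -> 0 <= z ->
  (forall l, (l <= K)%N -> (a n)^-1 * jump_maximum C Z w (n * l %/ K) <= z * y l)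
  <-> (forall k : nat, (0 < k <= n)%N ->
    jump (C_plus C w) (C_minus C w) (Z k w) <= z * y (block_index K n k) * a n).
Proof.
move=> n0 z0.
have max_le l (b : R) : 0 <= b -> (jump_maximum C Z w (n * l %/ K) <= b) <->
    (forall k : nat, (1 <= k < (n * l %/ K).+1)%N ->
     jump (C_plus C w) (C_minus C w) (Z k w) <= b).
  move=> b0; split.
    by move=> + k kl; apply: le_trans; apply: le_bigmax_index.
  by move=> h; apply: bigmax_index_le.
have zy l : 0 <= z * y l * a n.
  by rewrite !mulr_ge0 ?(ltW (y_gt0 _)) ?(ltW (a_gt0 _)).
split=> h.
  move=> k /andP[k0 kn].
  have lK : (block_index K n k <= K)%N by rewrite block_index_le// mulnK.
  have := h _ lK; rewrite ler_pdivrMl// mulrC => /(max_le _ _ (zy _)); apply.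
  by rewrite k0 /= ltnS -block_index_le.
move=> l lK; rewrite ler_pdivrMl// mulrC.
apply/(max_le _ _ (zy _)) => k /andP[k0]; rewrite ltnS => kl.
apply: le_trans (h k _) _.
  by rewrite k0 (leq_trans kl)// -[leqRHS](mulnK n K_gt0) leq_div2r// leq_mul2l lK orbT.
rewrite ler_wpM2r ?(ltW (a_gt0 _))// ler_wpM2l//.
by apply: y_homo; rewrite block_index_le.
Qed.

(** With the coefficients frozen the limit is [block_cvg]; the conditional
    probabilities are bounded by 1, so their averages converge too. *)
Lemma jump_maximum_cdf_cvg (z : R) : 0 < z ->
  fine (P [set w | forall l, (l <= K)%N ->
    (a n)^-1 * jump_maximum C Z w (n * l %/ K) <= z * y l]) @[n --> \oo] -->
  (\int[P]_w frechet_block alpha p r K y (C_plus C w) (C_minus C w) z)%R.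
Proof.
move=> z0.
pose gZ := \bigcup_(i in [set: int]) preimage_set_system setT (Z i) measurable.
pose TZ := g_sigma_algebraType gZ.
pose U (w : T) : R * R := (C_plus C w, C_minus C w).
have mid : measurable_fun [set: T] (id : T -> TZ).
  apply: measurable_id_generated => _ [i _ [B mB <-]].
  exact: mZ.
have mZ' i : measurable_fun [set: TZ] (Z i : TZ -> R).
  exact: measurable_sigma_gen.
pose TC := g_sigma_algebraType
  (\bigcup_(j in [set: nat]) preimage_set_system setT (C j) measurable).
have mC' j : measurable_fun [set: TC] (C j : TC -> R).
  exact: measurable_sigma_gen.
have mCpm : measurable_fun [set: TC] (U : TC -> R * R).
  apply: measurable_fun_pair; first exact: (measurable_C_plus mC').
  rewrite C_minusE.
  apply: (measurable_C_plus (T := TC)) => j.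
  exact: measurableT_comp (mC' j).
have mU : measurable_fun [set: T] U.
  apply: measurable_fun_pair; first exact/measurable_C_plus.
  by rewrite C_minusE; apply: measurable_C_plus => j; exact: measurableT_comp.
have UZ : independent_functions P U (id : T -> TZ).
  by move=> A B mA mB; apply: C_Z_indep => //; exact: sigma_gen_preimage.
pose E n : set ((R * R) * TZ) := [set x | forall k : nat, (0 < k <= n)%N ->
  jump x.1.1 x.1.2 (Z k x.2) <= z * y (block_index K n k) * a n].
have mE n : measurable (E n).
  apply: measurable_forall => k _; apply: measurable_set_le => //.
  have m1 : measurable_fun setT (fun x : (R * R) * TZ => x.1.1).
    exact: measurableT_comp.
  have m2 : measurable_fun setT (fun x : (R * R) * TZ => x.1.2).
    exact: measurableT_comp.
  have m3 : measurable_fun setT (fun x : (R * R) * TZ => Z k x.2).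
    exact: measurableT_comp (mZ' k) _.
  apply: measurable_maxr; apply: measurable_funM => //.
    exact: measurable_maxr.
  by apply: measurable_maxr => //; exact: measurableT_comp.
pose f n u := fine (P [set w | E n (u, w)]).
have mf n : measurable_fun [set: R * R] (f n).
  by apply: measurableT_comp => //; exact: measurable_probability_snd.
have mEu n u : measurable [set w : T | E n (u, w)].
  rewrite -[X in measurable X]setTI.
  have : measurable_fun [set: T] (fun w => (u, w) : (R * R) * TZ).
    exact: measurable_fun_pair.
  by apply.
have fU n w : 0 <= f n (U w) <= 1.
  by rewrite fine_probability_ge0/= fine_probability_le1.
have lim : (\int[P]_w f n (U w))%R @[n --> \oo] -->
    (\int[P]_w frechet_block alpha p r K y (C_plus C w) (C_minus C w) z)%R.
  apply: (bounded_convergence (B := 1)) => [n|||].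
  - exact: measurableT_comp (mf n) mU.
  - exact: measurableT_comp (measurable_frechet_block _ _ _ _ _ _) mU.
  - by move=> n w; have /andP[f0 f1] := fU n w; rewrite ger0_norm.
  - apply: aeW => w; apply: block_cvg => //.
      exact: C_plus_ge0.
    by rewrite C_minusE; exact: C_plus_ge0.
apply: cvg_trans lim; apply: near_eq_cvg; near=> n.
have n0 : (0 < n)%N by near: n; exact: nbhs_infty_gt.
rewrite (_ : [set w | forall l, _] = [set w | E n (U w, w)]); last first.
  by apply/seteqP; split=> w /(jump_maximum_leP _ n0 (ltW z0)).
rewrite (probability_independent mU mid UZ (mE n)) /Rintegral; congr fine.
by apply: eq_integral => w _; rewrite -probabilityE.
Unshelve. all: by end_near. Qed.

End mixed_blocks.

(** * Extremal processes at grid points *)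
Section exponent_measure.
Context {R : realType}.
Variables (c alpha : R).
Hypothesis alpha_gt0 : 0 < alpha.
Hypothesis c_ge0 : 0 <= c.

Lemma cvgy_powRN : x `^ (- alpha) @[x --> +oo] --> (0 : R).
Proof.
apply/cvgrPdist_le => e e0; near=> x.
have M0 : 0 < e `^ (- alpha^-1) by rewrite powR_gt0.
have Mx : e `^ (- alpha^-1) <= x by near: x; exact: nbhs_pinfty_ge.
rewrite sub0r normrN ger0_norm ?powR_ge0// powRN.
have <- : (e `^ (- alpha^-1)) `^ (- alpha) = e.
  by rewrite -powRrM mulrNN mulVf ?gt_eqF// powRr1// ltW.
have x_gt0 : 0 < x := lt_le_trans M0 Mx.
rewrite [leRHS]powRN lef_pV2 ?posrE ?powR_gt0//.
by rewrite ge0_ler_powR ?nnegrE ?(ltW alpha_gt0)// ?(ltW M0)// (le_trans (ltW M0)).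
Unshelve. all: by end_near. Qed.

Lemma continuous_powR_gt0 (b : R) (x : R) : 0 < x -> {for x, continuous (fun u : R => u `^ b)}.
Proof.
move=> x0; apply: differentiable_continuous; apply/derivable1_diffP.
by apply: derivable_powR; rewrite in_itv/= x0.
Qed.

Lemma exponent_measure_ray (x : R) : 0 < x ->
  exponent_measure c alpha `]x, +oo[%classic = (x `^ (- alpha) * c)%:E.
Proof.
move=> x0; pose f (u : R) : R := c * alpha * u `^ (- alpha - 1).
have pos u : x <= u -> 0 < u by exact: lt_le_trans.
have cf : {within `[x, +oo[, continuous f}.
  apply: continuous_in_subspaceT => u /[!inE]/= /[!in_itv]/= /andP[xu _].
  apply: cvgM; first exact: cvg_cst.
  exact: continuous_powR_gt0 (pos _ xu).
pose F (u : R) : R := - c * u `^ (- alpha).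
rewrite /exponent_measure; transitivity
  (\int[lebesgue_measure]_(u in `]x, +oo[%classic) (f u)%:E)%E.
  apply: eq_integral => u /[!inE]/= /[!in_itv]/= /andP[xu _].
  by rewrite indicE mem_set ?mulr1//= in_itv/= (lt_trans x0).
rewrite (@integral_itv_obnd_cbnd _ x +oo%O (fun u => (f u)%:E)); last first.
  apply/measurable_EFinP; apply: measurable_funM => //.
  exact: measurable_funTS (measurable_powR _).
have dF u : x < u -> is_derive u 1 F (f u).
  move=> xu; have u0 := pos _ (ltW xu).
  rewrite /f (_ : c * alpha * _ = - c *: (- alpha * u `^ (- alpha - 1))).
    exact: is_deriveZ (is_derive1_powR _ u0).
  by rewrite /GRing.scale/=; ring.
rewrite (@ge0_continuous_FTC2y _ f F x 0)//.
- by rewrite sub0e /F -EFinN mulNr opprK mulrC.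
- move=> u xu; rewrite /f !mulr_ge0 ?powR_ge0//; exact: ltW.
- rewrite -(mulr0 (- c)); apply: cvgM; [exact: cvg_cst|exact: cvgy_powRN].
- by move=> u xu; have [] := dF _ xu.
- apply: cvg_at_right_filter; apply: cvgM; first exact: cvg_cst.
  exact: continuous_powR_gt0.
- move=> u /[!in_itv]/= /andP[xu _]; rewrite derive1E.
  by have [_ ->] := dF _ xu.
Qed.

Lemma exponent_measure0 : exponent_measure c alpha set0 = 0%E.
Proof. by rewrite /exponent_measure integral_set0. Qed.

End exponent_measure.

Section staircase.
Context {R : realType}.
Variables (c alpha : R) (K : nat) (b : nat -> R).
Hypothesis alpha_gt0 : 0 < alpha.
Hypothesis c_ge0 : 0 <= c.
Hypothesis K_gt0 : (0 < K)%N.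
Hypothesis b_gt0 : forall l, 0 < b l.
Hypothesis b_homo : {homo b : l l' / (l <= l')%N >-> l <= l'}.

(** The cell number 0 is the single time 0: the value of the process at time 0
    depends on the points at time 0. *)
Definition grid_cell l : set R :=
  if l is l'.+1 then `]grid K l', grid K l]%classic else [set 0].

Lemma grid_homo l l' : (l <= l')%N -> grid K l <= grid K l' :> R.
Proof. by move=> ll'; rewrite ler_wpM2r ?invr_ge0// ler_nat. Qed.

Lemma grid_cell_le l s : grid_cell l s -> 0 <= s <= grid K l.
Proof.
case: l => [->|l] /=; first by rewrite grid0 lexx.
rewrite in_itv/= => /andP[ls ->]; rewrite andbT.
by rewrite (le_trans _ (ltW ls))// /grid divr_ge0.
Qed.

Lemma grid_cell_cover l s : 0 <= s <= grid K l ->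
  exists2 l', (l' <= l)%N & grid_cell l' s.
Proof.
elim: l => [|l IH] /andP[s0 sl].
  exists 0%N => //=; apply/eqP; rewrite eq_le s0 andbT.
  by rewrite (le_trans sl)// grid0.
have [sl'|ls] := leP s (grid K l).
  have [|l' l'l Il'] := IH; first by rewrite s0.
  by exists l' => //; rewrite (leq_trans l'l).
by exists l.+1 => //=; rewrite in_itv/= ls.
Qed.

Lemma grid_cell_inj l l' s : grid_cell l s -> grid_cell l' s -> l = l'.
Proof.
wlog : l l' / (l < l')%N => [wl Il Il'|].
  by have [ll|ll|//] := ltngtP l l'; [exact: wl|apply/esym; exact: wl].
case: l' => // l' ll' /grid_cell_le/andP[_ sl] /=.
rewrite in_itv/= ltNge => /andP[/negP h _]; exfalso; apply: h.
by rewrite (le_trans sl)// grid_homo.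
Qed.

Lemma measurable_grid_cell l : measurable (grid_cell l).
Proof. by case: l => [|l] /=. Qed.

Lemma lebesgue_grid_cell l : lebesgue_measure (grid_cell l) =
  (if l is _.+1 then K%:R^-1%:E else 0%E) :> \bar R.
Proof.
case: l => [|l] /=; first by rewrite lebesgue_measure_set1.
rewrite lebesgue_measure_itv/= lte_fin ltr_pM2r ?invr_gt0 ?ltr0n// ltr_nat ltnSn.
by rewrite -EFinB -mulrBl -natrB// subSnn mul1r.
Qed.

Definition staircase : set (R * R) := [set tj |
  exists2 l, (l <= K)%N & grid_cell l tj.1 /\ b l < tj.2].

Lemma measurable_staircase : measurable staircase.
Proof.
rewrite (_ : staircase =
    \bigcup_(l in [set l | (l <= K)%N]) (grid_cell l `*` `]b l, +oo[%classic)).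
  apply: bigcup_measurable => l _; apply: measurableX => //.
  exact: measurable_grid_cell.
by apply/seteqP; split=> -[t j] [l lK [Il]] /=;
  exists l => //; split => //=; move: (b0) => //; rewrite ?in_itv/= ?andbT.
Qed.

Lemma staircase_subset :
  staircase `<=` [set tj : R * R | 0 <= tj.1 <= 1 /\ 0 < tj.2].
Proof.
move=> [t j] [l lK [/grid_cell_le/andP[t0 tl] /= bj]]; split.
  by rewrite t0 (le_trans tl)//; have /andP[_] := @grid_itv R _ _ lK.
by apply: lt_trans bj.
Qed.

(** The section of the region at a time in cell [l] is the ray above [b l], and
    the cell number 0 is negligible. *)
Lemma staircase_measure :
  (lebesgue_measure \x exponent_measure c alpha)%E staircase =
  (\sum_(0 <= l < K) K%:R^-1 * (b l.+1 `^ (- alpha) * c))%:E.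
Proof.
pose g l := b l `^ (- alpha) * c.
have g0 l : 0 <= g l by rewrite mulr_ge0 ?powR_ge0.
rewrite /product_measure1; transitivity (\int[lebesgue_measure]_x
    \sum_(l <- index_iota 0 K.+1) (g l * \1_(grid_cell l) x)%:E)%E.
  apply: eq_integral => x _ /=; rewrite sumEFin.
  have [[l lK Il]|nI] := pselect (exists2 l, (l <= K)%N & grid_cell l x).
    rewrite (_ : xsection _ _ = `]b l, +oo[%classic); last first.
      apply/seteqP; split=> j.
        move/xsectionP => [l' l'K [/= Il' bj]].
        by rewrite in_itv/= andbT (grid_cell_inj Il Il').
      by rewrite /= in_itv/= andbT => bj; apply/xsectionP; exists l.
    rewrite exponent_measure_ray// (bigD1_seq l) ?iota_uniq ?mem_index_iota//=.
    rewrite indicE mem_set// mulr1 big1 ?addr0// => l' l'l.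
    rewrite indicE memNset ?mulr0// => Il'.
    by rewrite (grid_cell_inj Il' Il) eqxx in l'l.
  rewrite (_ : xsection _ _ = set0); last first.
    apply/seteqP; split=> j // /xsectionP [l lK [/= Il _]].
    by apply: nI; exists l.
  rewrite exponent_measure0 big_nat big1// => l lK.
  rewrite indicE memNset ?mulr0// => Il; apply: nI.
  by exists l.
have mI l : measurable (grid_cell l) by exact: measurable_grid_cell.
rewrite ge0_integral_sum//; last 2 first.
- move=> l; apply/measurable_EFinP; apply: measurable_funM => //.
  by apply: measurable_indic; exact: measurable_grid_cell.
- by move=> l x _; rewrite lee_fin mulr_ge0.
rewrite (eq_bigr (fun l => (g l)%:E * lebesgue_measure (grid_cell l))%E).
  rewrite big_nat_recl//= lebesgue_measure_set1 mule0 add0e -sumEFin.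
  apply: eq_bigr => l _.
  by rewrite (lebesgue_grid_cell l.+1) -EFinM mulrC.
move=> l _; under eq_integral do rewrite EFinM.
rewrite ge0_integralZl ?lee_fin//; last first.
  apply/measurable_EFinP; apply: measurable_indic.
  exact: measurable_grid_cell.
by rewrite integral_indic ?setIT//; exact: measurable_grid_cell.
Qed.

End staircase.

Section points.
Context {R : realType} {d : measure_display} {Omega : measurableType d}.

Lemma point_count_eq0P {T : Type} (pts : nat -> Omega -> option T) (B : set T) w :
  point_count (R := R) pts B w = 0%E <-> forall i z, pts i w = Some z -> ~ B z.
Proof.
pose u i : \bar R := if pts i w is Some z then (\1_B z)%:E else 0%E.
have u0 i : (0 <= u i)%E by rewrite /u; case: (pts i w) => // z; rewrite lee_fin.
have -> : point_count pts B w = (\sum_(0 <= i <oo) u i)%E by [].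
split=> [s0 i z iz Bz|nB].
  have : (\sum_(0 <= i < i.+1) u i <= 0)%E.
    by rewrite -[leRHS]s0; exact: nneseries_lim_ge.
  rewrite big_nat_recr//= {2}/u iz indicE mem_set//.
  apply/negP; rewrite -ltNge.
  by apply: lt_le_trans (leeDr _ _); rewrite ?lte_fin// sume_ge0.
apply: eseries0 => i _ _; rewrite /u; case: (pts i w) (nB i) => // z /(_ z erefl) nBz.
by rewrite indicE memNset.
Qed.

Lemma running_sup_leP (pts : nat -> Omega -> option (R * R)) w t (b : R) : 0 <= b ->
  (running_sup pts w t <= b%:E)%E <->
  forall i s j, pts i w = Some (s, j) -> s <= t -> j <= b.
Proof.
move=> b0; rewrite /running_sup; split=> [|h].
  rewrite ge_max => /andP[_ h] i s j isj st; rewrite -lee_fin.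
  by apply: le_trans h; apply: ereal_sup_ubound; exists i, s, j.
rewrite ge_max lee_fin b0/=; apply: ge_ereal_sup => _ [i [s [j [isj st ->]]]].
by rewrite lee_fin (h i s j).
Qed.

Lemma running_sup_ge0 (pts : nat -> Omega -> option (R * R)) w t :
  (0 <= running_sup pts w t)%E.
Proof. by rewrite /running_sup le_max lexx. Qed.

(** A point that lifts the running supremum above [b l] at the grid point [l] lies
    in a cell [l' <= l], whose level [b l' <= b l] it exceeds. *)
Lemma running_sup_staircase (pts : nat -> Omega -> option (R * R)) w K b :
  (0 < K)%N -> (forall l, 0 < b l) -> {homo b : l l' / (l <= l')%N >-> l <= l'} ->
  (forall i z, pts i w = Some z -> 0 <= z.1 <= 1 /\ 0 < z.2) ->
  (forall l, (l <= K)%N -> (running_sup pts w (grid K l) <= (b l)%:E)%E) <->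
  point_count (R := R) pts (staircase K b) w = 0%E.
Proof.
move=> K0 b0 bh E; rewrite point_count_eq0P; split=> [h i [s j] isj|h l lK].
  move=> [l lK [/= /grid_cell_le/andP[_ sl] bj]].
  have /running_sup_leP - /(_ (ltW (b0 l)) _ _ _ isj sl) := h _ lK.
  by rewrite leNgt bj.
apply/running_sup_leP; first exact: ltW.
move=> i s j isj sl; rewrite leNgt; apply/negP => bj.
have [/andP[s0 _] _] := E _ _ isj.
have [|l' l'l Il'] := @grid_cell_cover _ K l s; first by rewrite s0.
apply: (h _ _ isj); exists l'; first exact: leq_trans lK.
by split=> //=; rewrite (le_lt_trans _ bj)// bh.
Qed.

End points.

Section extremal_cdf.
Context {R : realType} {d : measure_display} {Omega : measurableType d}.
Variable P : probability Omega R.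
Variables (c alpha : R) (W : Omega -> D_up R).
Hypothesis alpha_gt0 : 0 < alpha.
Hypothesis c_ge0 : 0 <= c.
Hypothesis W_extremal : stable_extremal_process P c alpha W.

Lemma measurable_extremal t : 0 <= t <= 1 ->
  measurable_fun [set: Omega] (fun w => W w t).
Proof.
move: W_extremal; rewrite /stable_extremal_process; case: ifPn => _.
  move=> W0 t01; rewrite (_ : (fun _ => _) = cst 0)//.
  by apply/funext => w; rewrite W0.
by move=> [mW _]; exact: mW.
Qed.

Lemma extremal0_ge0 : P [set w | W w 0 < 0] = 0%E.
Proof.
move: W_extremal; rewrite /stable_extremal_process; case: ifPn => _.
  move=> W0; rewrite [X in P X](_ : _ = set0) ?measure0//.
  by apply/seteqP; split=> w //=; rewrite W0 ?lexx ?ler01// ltxx.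
move=> [_ [d' [T [Q [pts [_ fd]]]]]].
have := fd [:: 0] (fun=> `]-oo, 0[%classic).
rewrite (_ : [set w | _] = [set w | W w 0 < 0]); last first.
  apply/seteqP; split=> w /= h; first by have := h 0 (mem_head _ _); rewrite in_itv.
  by move=> t; rewrite inE => /eqP ->; rewrite in_itv.
move=> ->//; last by move=> t; rewrite inE => /eqP ->; rewrite lexx ler01.
rewrite [X in Q X](_ : _ = set0) ?measure0//.
apply/seteqP; split=> w //= /(_ 0 (mem_head _ _)) [e] /=.
rewrite in_itv/= => e0 eE; have := running_sup_ge0 pts w 0.
by rewrite -eE lee_fin leNgt e0.
Qed.

(** The process stays below the levels exactly when the Poisson process has no
    point above the staircase, an event whose probability is [expR (- mu)] for the
    mass [mu] of that region. *)
Lemma extremal_cdf K (b : nat -> R) : (0 < K)%N -> (forall l, 0 < b l) ->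
  {homo b : l l' / (l <= l')%N >-> l <= l'} ->
  P [set w | forall l, (l <= K)%N -> W w (grid K l) <= b l] =
  (\prod_(0 <= l < K) expR (- (K%:R^-1 * (b l.+1 `^ (- alpha) * c))))%:E.
Proof.
move=> K0 b0 bh; move: W_extremal; rewrite /stable_extremal_process.
case: ifPn => [/eqP c0 W0|_ [_ [d' [T [Q [pts [ppp fd]]]]]]].
  rewrite [X in P X](_ : _ = setT).
    rewrite probability_setT big1// => l _.
    by rewrite c0 !mulr0 oppr0 expR0.
  apply/seteqP; split=> w //= _ l lK.
  by rewrite W0 ?grid_itv// ltW.
pose s : seq R := [seq grid K l | l <- iota 0 K.+1].
pose beta (t : R) : R := b (Num.truncn (K%:R * t)).
have betaE l : beta (grid K l) = b l.
  by rewrite /beta /grid mulrCA divff ?mulr1 ?natrK// pnatr_eq0 -lt0n.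
have sP (Q' : R -> Prop) : (forall t, t \in s -> Q' t) <->
    (forall l, (l <= K)%N -> Q' (grid K l)).
  split=> h; first by move=> l lK; apply: h; apply: map_f; rewrite mem_iota.
  by move=> t /mapP[l]; rewrite mem_iota => /andP[_ lK] ->; exact: h.
have := fd s (fun t => `]-oo, beta t]%classic).
move=> /(_ _ _)/wrap[||].
- by apply/sP => l lK; exact: grid_itv.
- by move=> t; exact: measurable_itv.
rewrite (_ : [set w | _] =
    [set w | forall l, (l <= K)%N -> W w (grid K l) <= b l]); last first.
  apply/seteqP; split=> w /=.
    by move=> /sP h l /h; rewrite in_itv/= betaE.
  by move=> h; apply/sP => l /h; rewrite in_itv/= betaE.
move=> ->.
have [ptsE mcount count _ _] := ppp.
have mS := @measurable_staircase R K b.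
have SE : staircase K b `<=` _ := @staircase_subset R K b b0.
have SM := @staircase_measure R c alpha K b alpha_gt0 c_ge0 K0 b0.
rewrite [X in Q X](_ : _ =
    [set w | point_count pts (staircase K b) w = (0%:R : R)%:E]).
  rewrite count// SM ?ltry// fact0 expr0 divr1 mul1r/= -sumrN expR_sum.
  by [].
apply/seteqP; split=> w /=.
  move=> /sP h; apply/running_sup_staircase => //; first by move=> i z /ptsE.
  move=> l /h [e] /=; rewrite in_itv/= betaE => eb <-.
  by rewrite lee_fin.
move=> /running_sup_staircase h; apply/sP => l lK.
have hl := h K0 b0 bh (fun i z => @ptsE i w z) l lK.
have fin : running_sup pts w (grid K l) \is a fin_num.
  rewrite ge0_fin_numE ?running_sup_ge0//.
  by apply: le_lt_trans hl _; rewrite ltry.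
exists (fine (running_sup pts w (grid K l))); last by rewrite fineK.
by rewrite /= in_itv/= betaE -lee_fin fineK.
Qed.

End extremal_cdf.

(** * The limit process at grid points *)
Lemma ge0_integral_eq_law {R : realType} {d d' ds : measure_display}
    {T : measurableType d} {T' : measurableType d'} {S : measurableType ds}
    (P : probability T R) (P' : probability T' R) (U : T -> S) (U' : T' -> S)
    (g : S -> \bar R) :
  measurable_fun [set: T] U -> measurable_fun [set: T'] U' ->
  (forall A, measurable A -> P' (U' @^-1` A) = P (U @^-1` A)) ->
  measurable_fun [set: S] g -> (forall x, 0 <= g x)%E ->
  (\int[P']_w g (U' w) = \int[P]_w g (U w))%E.
Proof.
move=> mU mU' law mg g0.
pose X : {mfun T >-> S} := HB.pack U (isMeasurableFun.Build _ _ _ _ U mU).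
pose X' : {mfun T' >-> S} := HB.pack U' (isMeasurableFun.Build _ _ _ _ U' mU').
transitivity (\int[distribution P' X']_x g x)%E.
  by rewrite ge0_integral_pushforward.
transitivity (\int[distribution P X]_x g x)%E.
  by apply: eq_measure_integral => A mA _; exact: law.
by rewrite ge0_integral_pushforward.
Qed.

Section scaled_extremal.
Context {R : realType} {d : measure_display} {T : measurableType d}.
Variable P : probability T R.
Variables (c alpha : R) (W : T -> D_up R) (K : nat) (y : nat -> R).
Hypothesis alpha_gt0 : 0 < alpha.
Hypothesis c_ge0 : 0 <= c.
Hypothesis W_extremal : stable_extremal_process P c alpha W.
Hypothesis K_gt0 : (0 < K)%N.
Hypothesis y_gt0 : forall l, 0 < y l.
Hypothesis y_homo : {homo y : l l' / (l <= l')%N >-> l <= l'}.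

Lemma scaled_extremal_cdf (u z : R) : 0 <= u -> 0 < z ->
  P [set w | forall l, (l <= K)%N ->
    u * Num.max (W w (grid K l)) 0 <= z * y l] =
  (\prod_(0 <= l < K) expR (- (K%:R^-1 *
    ((z * y l.+1) `^ (- alpha) * (c * u `^ alpha)))))%:E.
Proof.
move=> u0 z0; have zy l : 0 < z * y l by rewrite mulr_gt0.
move: u0; rewrite le_eqVlt => /predU1P[<-|u0].
  rewrite [X in P X](_ : _ = setT).
    rewrite probability_setT big1// => l _.
    by rewrite powR0 ?gt_eqF// !mulr0 oppr0 expR0.
  by apply/seteqP; split=> w //= _ l _; rewrite mul0r ltW.
pose b l := z * y l / u.
have b0 l : 0 < b l by rewrite divr_gt0.
rewrite [X in P X](_ : _ =
    [set w | forall l, (l <= K)%N -> W w (grid K l) <= b l]).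
  rewrite (extremal_cdf alpha_gt0 c_ge0 W_extremal K_gt0 b0); last first.
    by move=> l l' ll'; rewrite ler_wpM2r ?invr_ge0 ?(ltW u0)// ler_wpM2l ?(ltW z0)// y_homo.
  congr _%:E; apply: eq_bigr => l _; congr (expR (- (_ * _))).
  rewrite /b powRM ?invr_ge0 ?(ltW (zy _)) ?(ltW u0)//.
  by rewrite -(powR_inv1 (ltW u0)) -powRrM mulrNN mul1r; ring.
apply/seteqP; split=> w /= h l lK; have := h l lK.
  rewrite mulrC -ler_pdivlMr// => {}h.
  by apply: le_trans h; rewrite le_max lexx.
move=> hl; rewrite mulrC -ler_pdivlMr// ge_max hl/=.
exact/ltW/b0.
Qed.

End scaled_extremal.

Section mixed_extremal.
Context {R : realType} {d : measure_display} {T : measurableType d}.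
Variable P : probability T R.
Variables (alpha p r : R) (C1 C2 : T -> R) (W1 W2 : T -> D_up R).
Hypothesis alpha_gt0 : 0 < alpha.
Hypotheses (p_ge0 : 0 <= p) (r_ge0 : 0 <= r).
Hypothesis W1_extremal : stable_extremal_process P p alpha W1.
Hypothesis W2_extremal : stable_extremal_process P r alpha W2.
Hypothesis W_indep : independent_sigma P
  (sigma_gen `[0, 1]%classic (fun (t : R) w => W1 w t))
  (sigma_gen `[0, 1]%classic (fun (t : R) w => W2 w t)).
Hypothesis mC1 : measurable_fun [set: T] C1.
Hypothesis mC2 : measurable_fun [set: T] C2.
Hypothesis C12_W_indep : independent_sigma P
  (sigma_gen [set: bool] (fun b => if b then C1 else C2))
  (<<s sigma_gen `[0, 1]%classic (fun (t : R) w => W1 w t) `|`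
       sigma_gen `[0, 1]%classic (fun (t : R) w => W2 w t) >>).

(** The limit process with all factors replaced by their positive parts. These
    are nonnegative almost surely, and the replacement makes the process
    nonnegative and nondecreasing everywhere. *)
Definition positive_max (w : T) (t : R) : R :=
  Num.max (Num.max (C1 w) 0 * Num.max (W1 w t) 0)
          (Num.max (C2 w) 0 * Num.max (W2 w t) 0).

Lemma measurable_positive_max t : 0 <= t <= 1 ->
  measurable_fun [set: T] (fun w => positive_max w t).
Proof.
move=> t01; apply: measurable_maxr; apply: measurable_funM;
  apply: measurable_maxr => //; [exact: measurable_extremal W1_extremal _ _|].
exact: measurable_extremal W2_extremal _ _.
Qed.

Lemma positive_max_ge0 w t : 0 <= positive_max w t.
Proof. by rewrite le_max mulr_ge0// le_max lexx orbT. Qed.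

Lemma positive_max_homo w s t : 0 <= s -> s <= t -> t <= 1 ->
  positive_max w s <= positive_max w t.
Proof.
move=> s0 st t1; rewrite /positive_max.
have W1st := @D_up_nondecreasing _ (W1 w) _ _ s0 st t1.
have W2st := @D_up_nondecreasing _ (W2 w) _ _ s0 st t1.
have mono (c x x' : R) : x <= x' ->
    Num.max c 0 * Num.max x 0 <= Num.max c 0 * Num.max x' 0.
  move=> xx'; apply: ler_wpM2l; first by rewrite le_max lexx orbT.
  by rewrite ge_max !le_max xx' lexx orbT.
by rewrite ge_max !le_max !mono// orbT.
Qed.

Variables (K : nat) (y : nat -> R).
Hypothesis K_gt0 : (0 < K)%N.
Hypothesis y_gt0 : forall l, 0 < y l.
Hypothesis y_homo : {homo y : l l' / (l <= l')%N >-> l <= l'}.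

(** The exponents of the two independent factors add up. *)
Lemma extremal_pair_cdf (u1 u2 z : R) : 0 <= u1 -> 0 <= u2 -> 0 < z ->
  P [set w | forall l, (l <= K)%N ->
    Num.max (u1 * Num.max (W1 w (grid K l)) 0)
            (u2 * Num.max (W2 w (grid K l)) 0) <= z * y l] =
  (frechet_block alpha p r K y u1 u2 z)%:E.
Proof.
move=> u10 u20 z0.
pose F (u : R) (W : T -> D_up R) := [set w | forall l, (l <= K)%N ->
    u * Num.max (W w (grid K l)) 0 <= z * y l].
have sF u (W : T -> D_up R) : sigma_gen `[0, 1]%classic (fun (t : R) w => W w t) (F u W).
  pose TW := g_sigma_algebraType (\bigcup_(t in (`[0, 1]%classic : set R))
    preimage_set_system setT (fun w => W w t) measurable).
  have mW l : (l <= K)%N ->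
      measurable_fun [set: TW] (fun w : TW => W w (grid K l)).
    move=> lK; apply: (measurable_sigma_gen (X := fun (t : R) w => W w t)).
    by rewrite /= in_itv/= grid_itv.
  suff : measurable (F u W : set TW) by [].
  rewrite /F; apply: measurable_forall => l lK.
  apply: measurable_set_le => //.
  by apply: measurable_funM => //; apply: measurable_maxr => //; exact: mW.
rewrite (_ : [set w | _] = F u1 W1 `&` F u2 W2); last first.
  apply/seteqP; split=> w /=.
    by move=> h; split=> l /h; rewrite ge_max => /andP[].
  by move=> [h1 h2] l lK; rewrite ge_max h1// h2.
rewrite (W_indep (sF _ _) (sF _ _)).
rewrite (scaled_extremal_cdf alpha_gt0 p_ge0 W1_extremal K_gt0 y_gt0 y_homo u10 z0).
rewrite (scaled_extremal_cdf alpha_gt0 r_ge0 W2_extremal K_gt0 y_gt0 y_homo u20 z0).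
rewrite -EFinM -big_split/=; congr _%:E; apply: eq_bigr => l _.
by rewrite -expRD; congr expR; ring.
Qed.

(** The pair of coefficients is frozen, as for the maxima of the jumps. *)
Lemma positive_max_cdf (z : R) : 0 < z ->
  P [set w | forall l, (l <= K)%N -> positive_max w (grid K l) <= z * y l] =
  (\int[P]_w (frechet_block alpha p r K y
    (Num.max (C1 w) 0) (Num.max (C2 w) 0) z)%:E)%E.
Proof.
move=> z0.
pose G : set (set T) := sigma_gen `[0, 1]%classic (fun (t : R) w => W1 w t) `|`
  sigma_gen `[0, 1]%classic (fun (t : R) w => W2 w t).
pose TW := g_sigma_algebraType G.
pose TC := g_sigma_algebraType (\bigcup_(b in [set: bool])
  preimage_set_system setT (if b then C1 else C2) measurable).
pose U (w : T) : R * R := (C1 w, C2 w).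
have mUC : measurable_fun [set: TC] (U : TC -> R * R).
  by apply: measurable_fun_pair;
    [exact: (@measurable_sigma_gen _ _ _ _ setT (fun b => if b then C1 else C2) true)
    |exact: (@measurable_sigma_gen _ _ _ _ setT (fun b => if b then C1 else C2) false)].
have mU : measurable_fun [set: T] U by exact: measurable_fun_pair.
have sub (W : T -> D_up R) : (forall t : R, 0 <= t <= 1 ->
    measurable_fun [set: T] (fun w => W w t)) ->
    sigma_gen `[0, 1]%classic (fun (t : R) w => W w t) `<=` measurable.
  move=> mW A; apply: smallest_sub; first exact: sigma_algebra_measurable.
  by move=> _ [t /= t01 [B mB <-]]; exact: mW.
have mid : measurable_fun [set: T] (id : T -> TW).
  apply: measurable_id_generated => A [].
    by apply: sub => t; exact: measurable_extremal W1_extremal _.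
  by apply: sub => t; exact: measurable_extremal W2_extremal _.
have mW (W : T -> D_up R) l : (l <= K)%N ->
    sigma_gen `[0, 1]%classic (fun (t : R) w => W w t) `<=` G ->
    measurable_fun [set: TW] (fun w : TW => W w (grid K l)).
  move=> lK WG _ A mA; rewrite setTI; apply: sub_sigma_algebra; apply: WG.
  apply: sub_sigma_algebra; exists (grid K l); last by exists A => //; rewrite setTI.
  by rewrite /= in_itv/= grid_itv.
have UW : independent_functions P U (id : T -> TW).
  move=> A B mA mB; apply: C12_W_indep => //.
  exact: (sigma_gen_preimage mUC).
pose E : set ((R * R) * TW) := [set x | forall l, (l <= K)%N ->
  Num.max (Num.max x.1.1 0 * Num.max (W1 x.2 (grid K l)) 0)
          (Num.max x.1.2 0 * Num.max (W2 x.2 (grid K l)) 0) <= z * y l].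
have mE : measurable E.
  apply: measurable_forall => l lK; apply: measurable_set_le => //.
  have m1 : measurable_fun setT (fun x : (R * R) * TW => x.1.1).
    exact: measurableT_comp.
  have m2 : measurable_fun setT (fun x : (R * R) * TW => x.1.2).
    exact: measurableT_comp.
  have m3 : measurable_fun setT (fun x : (R * R) * TW => W1 x.2 (grid K l)).
    by apply: (measurableT_comp (mW W1 l lK _)) => //; exact: subsetUl.
  have m4 : measurable_fun setT (fun x : (R * R) * TW => W2 x.2 (grid K l)).
    by apply: (measurableT_comp (mW W2 l lK _)) => //; exact: subsetUr.
  by apply: measurable_maxr; apply: measurable_funM => //; exact: measurable_maxr.
have := probability_independent mU mid UW mE; rewrite /E/= => ->.
apply: eq_integral => w _; apply: extremal_pair_cdf => //.
  by rewrite le_max lexx orbT.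
by rewrite le_max lexx orbT.
Qed.

Lemma positive_max_cdf_law {d' : measure_display} {T' : measurableType d'}
    (P' : probability T' R) (D1 D2 : T' -> R) (z : R) : 0 < z ->
  measurable_fun [set: T'] D1 -> measurable_fun [set: T'] D2 ->
  (forall w, 0 <= D1 w) -> (forall w, 0 <= D2 w) ->
  (forall A : set (R * R), measurable A ->
    P [set w | A (C1 w, C2 w)] = P' [set w | A (D1 w, D2 w)]) ->
  fine (P [set w | forall l, (l <= K)%N ->
    positive_max w (grid K l) <= z * y l]) =
  (\int[P']_w frechet_block alpha p r K y (D1 w) (D2 w) z)%R.
Proof.
move=> z0 mD1 mD2 D10 D20 law; rewrite positive_max_cdf// /Rintegral.
congr fine.
pose g (u : R * R) : \bar R :=
  (frechet_block alpha p r K y (Num.max u.1 0) (Num.max u.2 0) z)%:E.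
have := ge0_integral_eq_law (P := P') (P' := P) (U := fun w => (D1 w, D2 w))
  (U' := fun w => (C1 w, C2 w)) (g := g).
move=> /(_ _ _ _ _ _)/wrap[|||||->].
- exact: measurable_fun_pair.
- exact: measurable_fun_pair.
- by move=> A mA; exact: law.
- apply/measurable_EFinP.
  have m : measurable_fun [set: R * R]
      (fun u => (Num.max u.1 0, Num.max u.2 0) : R * R).
    by apply: measurable_fun_pair; apply: measurable_maxr.
  exact: measurableT_comp (measurable_frechet_block _ _ _ _ _ _) m.
- move=> u; rewrite lee_fin; apply: prodr_ge0 => l _; exact: expR_ge0.
by apply: eq_integral => w _; rewrite /g/= !max_l.
Qed.

Lemma extremal_ge0_ae (c : R) (W : T -> D_up R) :
  stable_extremal_process P c alpha W ->
  {ae P, forall w (t : R), 0 <= t <= 1 -> 0 <= W w t}.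
Proof.
move=> We; exists [set w | W w 0 < 0]; split.
- apply: measurable_set_lt => //.
  by apply: measurable_extremal We _ _; rewrite lexx ler01.
- exact: extremal0_ge0 We.
- move=> w /=; apply: contra_notP => /negP; rewrite -leNgt => W0 t /andP[t0 t1].
  exact: le_trans W0 (@D_up_nondecreasing _ (W w) _ _ (lexx 0) t0 t1).
Qed.

Lemma positive_max_ae (M : T -> D_up R) :
  {ae P, forall w, 0 <= C1 w /\ 0 <= C2 w} ->
  {ae P, forall w (t : R), 0 <= t <= 1 ->
    M w t = Num.max (C1 w * W1 w t) (C2 w * W2 w t)} ->
  {ae P, forall w (t : R), 0 <= t <= 1 -> M w t = positive_max w t}.
Proof.
move=> C0 MM; have w1 := extremal_ge0_ae W1_extremal.
have w2 := extremal_ge0_ae W2_extremal.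
near=> w.
have [c1 c2] : 0 <= C1 w /\ 0 <= C2 w by near: w.
have W1w : forall t : R, 0 <= t <= 1 -> 0 <= W1 w t by near: w.
have W2w : forall t : R, 0 <= t <= 1 -> 0 <= W2 w t by near: w.
have Mw : forall t : R, 0 <= t <= 1 ->
  M w t = Num.max (C1 w * W1 w t) (C2 w * W2 w t) by near: w.
move=> t t01; rewrite Mw// /positive_max (max_l c1) (max_l c2).
by rewrite (max_l (W1w _ t01)) (max_l (W2w _ t01)).
Unshelve. all: by end_near. Qed.

End mixed_extremal.

(** * From the jumps to the linear process *)
Section monotone_levels.
Context {R : realType}.
Variables (K : nat) (x : 'I_K.+1 -> R).

(** The largest nondecreasing minorant of the levels [x], extended by its last
    value beyond [K]. A nondecreasing path respects the levels [x] if and only if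
    it respects this minorant. *)
Definition tail_min (l : nat) : R :=
  \big[Num.min/x ord_max]_(i < K.+1 | (l <= i)%N) x i.

Lemma tail_min_gt0 : (forall i, 0 < x i) -> forall l, 0 < tail_min l.
Proof. by move=> x0 l; apply: lt_bigmin. Qed.

Lemma tail_min_homo : {homo tail_min : l l' / (l <= l')%N >-> l <= l'}.
Proof.
move=> l l' ll'; apply: le_bigmin; first exact: bigmin_le_id.
by move=> i l'i; apply: bigmin_le_cond; exact: leq_trans l'i.
Qed.

Lemma tail_min_leP (f : nat -> R) :
  (forall l l', (l <= l')%N -> (l' <= K)%N -> f l <= f l') ->
  (forall i : 'I_K.+1, f i <= x i) <-> (forall l, (l <= K)%N -> f l <= tail_min l).
Proof.
move=> fh; split=> [h l lK|h i].
  apply: le_bigmin => [|i li].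
    by apply: le_trans (h ord_max); exact: fh.
  by apply: le_trans (h i); apply: fh => //; rewrite -ltnS.
apply: le_trans (h i _) _; first by rewrite -ltnS.
exact: bigmin_le_cond.
Qed.

End monotone_levels.

Section sandwich.
Context {R : realType} {d : measure_display} {T : measurableType d}.
Variable P : probability T R.
Variables (K : nat) (A J : nat -> nat -> T -> R).
Hypothesis mA : forall n l, measurable_fun [set: T] (A n l).
Hypothesis mJ : forall n l, measurable_fun [set: T] (J n l).
Hypothesis close : forall eps eta : R, 0 < eps -> 0 < eta ->
  \forall n \near \oo, exists E : set T, [/\ measurable E, fine (P E) <= eta &
    forall w, ~ E w -> forall l, (l <= K)%N -> `|A n l w - J n l w| <= eps].

Let mcdf (B : nat -> T -> R) (x : nat -> R) :
  (forall l, measurable_fun [set: T] (B l)) ->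
  measurable [set w | forall l, (l <= K)%N -> B l w <= x l].
Proof.
by move=> mB; apply: measurable_forall => l _; exact: measurable_set_le.
Qed.

(** An error of [h * y 0] is at most [h * y l] at every grid point, so that the
    event for [A] lies, up to the exceptional set, between the events for [J] at
    the levels [(1 - h) * y] and [(1 + h) * y]; the limits of the latter are close
    by continuity. *)
Lemma sandwich_cdf_cvg (y : nat -> R) (H : R -> R) :
  (forall l, 0 < y l) -> (forall l, (l <= K)%N -> y 0%N <= y l) ->
  (forall z : R, 0 < z ->
    fine (P [set w | forall l, (l <= K)%N -> J n l w <= z * y l])
      @[n --> \oo] --> H z) ->
  (forall e : R, 0 < e -> exists2 h : R, 0 < h < 1 &
    `|H 1 - H (1 + h)| <= e /\ `|H 1 - H (1 - h)| <= e) ->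
  fine (P [set w | forall l, (l <= K)%N -> A n l w <= y l])
    @[n --> \oo] --> H 1.
Proof.
move=> y0 y0l JH Hc; apply/cvgrPdist_le => e e0.
have e3 : 0 < e / 3 by lra.
have [h /andP[h0 h1] [Hp Hm]] := Hc _ e3.
have hp : 0 < 1 + h by lra.
have hm : 0 < 1 - h by lra.
have eps0 : 0 < h * y 0%N by rewrite mulr_gt0.
have cl := close eps0 e3.
have Jp := JH _ hp; have Jm := JH _ hm.
near=> n.
have [E [mE PE AJ]] : exists E : set T, [/\ measurable E, fine (P E) <= e / 3 &
    forall w, ~ E w -> forall l, (l <= K)%N -> `|A n l w - J n l w| <= h * y 0%N].
  by near: n.
have Dp : `|H (1 + h) - fine (P [set w | forall l, (l <= K)%N ->
    J n l w <= (1 + h) * y l])| <= e / 3.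
  by near: n; move/cvgrPdist_le : Jp; exact.
have Dm : `|H (1 - h) - fine (P [set w | forall l, (l <= K)%N ->
    J n l w <= (1 - h) * y l])| <= e / 3.
  by near: n; move/cvgrPdist_le : Jm; exact.
have mJz z : measurable [set w | forall l, (l <= K)%N -> J n l w <= z * y l].
  by apply: mcdf => l; exact: mJ.
have mAy : measurable [set w | forall l, (l <= K)%N -> A n l w <= y l].
  by apply: mcdf => l; exact: mA.
have hy l : (l <= K)%N -> h * y 0%N <= h * y l.
  by move=> lK; rewrite ler_wpM2l ?(ltW h0)// y0l.
have up : fine (P [set w | forall l, (l <= K)%N -> A n l w <= y l]) <=
    fine (P [set w | forall l, (l <= K)%N -> J n l w <= (1 + h) * y l]) +
    fine (P E).
  apply: le_trans (fine_probabilityU P (mJz _) mE).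
  apply: le_fine_probability => //; first exact: measurableU.
  move=> w Aw; have [Ew|nEw] := pselect (E w); [by right|left=> l lK].
  have := AJ w nEw l lK; have := Aw l lK; have := hy l lK.
  by rewrite ler_norml mulrDl mul1r; lra.
have dn : fine (P [set w | forall l, (l <= K)%N -> J n l w <= (1 - h) * y l]) <=
    fine (P [set w | forall l, (l <= K)%N -> A n l w <= y l]) + fine (P E).
  apply: le_trans (fine_probabilityU P mAy mE).
  apply: le_fine_probability => //; first exact: measurableU.
  move=> w Jw; have [Ew|nEw] := pselect (E w); [by right|left=> l lK].
  have := AJ w nEw l lK; have := Jw l lK; have := hy l lK.
  by rewrite ler_norml mulrBl mul1r; lra.
move: Hp Hm Dp Dm up dn PE; rewrite !ler_norml.
move: (fine _) (fine _) (fine _) (fine _) => f1 f2 f3 f4; lra.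
Unshelve. all: by end_near. Qed.

(** Off the exceptional set [A] is close to the nonnegative [J], so it cannot be
    below a negative level. *)
Lemma sandwich_negative_level (x : 'I_K.+1 -> R) (i0 : 'I_K.+1) :
  (forall n l w, 0 <= J n l w) -> x i0 < 0 ->
  fine (P [set w | forall i : 'I_K.+1, A n i w <= x i]) @[n --> \oo] --> (0 : R).
Proof.
move=> J0 xi0; apply/cvgrPdist_le => e e0.
have eps0 : 0 < - x i0 / 2 by lra.
have cl := close eps0 e0.
near=> n.
have [E [mE PE AJ]] : exists E : set T, [/\ measurable E, fine (P E) <= e &
    forall w, ~ E w -> forall l, (l <= K)%N -> `|A n l w - J n l w| <= - x i0 / 2].
  by near: n.
rewrite sub0r normrN ger0_norm ?fine_probability_ge0//.
apply: le_trans PE; apply: le_fine_probability => //.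
  by apply: measurable_forallT => i; apply: measurable_set_le => //; exact: mA.
move=> w Aw; apply: contrapT => nEw.
have := AJ w nEw i0; rewrite -ltnS => /(_ (ltn_ord _)).
have := Aw i0; have := J0 n i0 w; rewrite ler_norml; lra.
Unshelve. all: by end_near. Qed.

End sandwich.

Section mixed_continuity.
Context {R : realType} {d : measure_display} {T : measurableType d}.
Variable P : probability T R.
Variables (alpha p r : R) (K : nat) (y : nat -> R) (U1 U2 : T -> R).
Hypotheses (p_ge0 : 0 <= p) (r_ge0 : 0 <= r).
Hypothesis y_gt0 : forall l, 0 < y l.
Hypothesis mU1 : measurable_fun [set: T] U1.
Hypothesis mU2 : measurable_fun [set: T] U2.

Let H (z : R) := (\int[P]_w frechet_block alpha p r K y (U1 w) (U2 w) z)%R.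

Lemma mixed_frechet_continuous (e : R) : 0 < e -> exists2 h : R, 0 < h < 1 &
  `|H 1 - H (1 + h)| <= e /\ `|H 1 - H (1 - h)| <= e.
Proof.
move=> e0.
have seq_cvg (u : nat -> R) : u n @[n --> \oo] --> (1 : R) ->
    H (u n) @[n --> \oo] --> H 1.
  move=> u1; have mU : measurable_fun [set: T] (fun w => (U1 w, U2 w)).
    exact: measurable_fun_pair.
  apply: (bounded_convergence (B := 1)) => [n||n w|].
  - exact: measurableT_comp (measurable_frechet_block _ _ _ _ _ _) mU.
  - exact: measurableT_comp (measurable_frechet_block _ _ _ _ _ _) mU.
  - exact: frechet_block_norm_le1.
  - apply: aeW => w; apply: cvgn_prod => l.
    apply: continuous_cvg; first exact: continuous_expR.
    apply: cvgN; apply: cvgM; first exact: cvg_cst.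
    apply: cvgM; last exact: cvg_cst.
    have uy : u n * y l.+1 @[n --> \oo] --> 1 * y l.+1.
      by apply: cvgM => //; exact: cvg_cst.
    have y0 : 0 < 1 * y l.+1 by rewrite mul1r.
    exact: (cvg_comp _ _ uy (@continuous_powR_gt0 _ (- alpha) _ y0)).
have h0 : (n.+2%:R^-1 : R) @[n --> \oo] --> (0 : R).
  by have := @cvg_harmonic R; rewrite -(@cvg_shiftS R).
have Hp : H (1 + n.+2%:R^-1) @[n --> \oo] --> H 1.
  by apply: seq_cvg; rewrite -[X in _ --> X]addr0; apply: cvgD => //; exact: cvg_cst.
have Hm : H (1 - n.+2%:R^-1) @[n --> \oo] --> H 1.
  by apply: seq_cvg; rewrite -[X in _ --> X]subr0; apply: cvgB => //; exact: cvg_cst.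
move/cvgrPdist_le : Hp => /(_ _ e0) Bp; move/cvgrPdist_le : Hm => /(_ _ e0) Bm.
have [n [bp bm]] := filter_ex (filterI Bp Bm).
have h01 : 0 < (n.+2%:R^-1 : R) < 1.
  have n0 : 0 < n.+2%:R :> R by rewrite ltr0n.
  apply/andP; split; first by rewrite invr_gt0.
  by rewrite invf_lt1// ltr1n.
exists n.+2%:R^-1; first exact: h01.
by split; [exact: bp|exact: bm].
Qed.

End mixed_continuity.

(** * Measurability of the maxima *)
Section measurability_of_maxima.
Context {R : realType} {d : measure_display} {T : measurableType d}.

(** Convergence is the Cauchy condition, a countable combination of measurable
    conditions, and where it fails [limn] takes a fixed default value. *)
Lemma measurable_limn (f : nat -> T -> R) :
  (forall n, measurable_fun [set: T] (f n)) ->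
  measurable_fun [set: T] (fun w => limn (f ^~ w)).
Proof.
move=> mf; pose D := [set w | cvgn (f ^~ w)].
have DE : D = [set w | forall k : nat, exists N : nat,
    forall n : nat, (N <= n)%N -> `|f N w - f n w| <= k.+1%:R^-1].
  apply/seteqP; split=> w /= => [cw k|cw].
    have k0 : 0 < k.+1%:R^-1 / 2 :> R by rewrite divr_gt0// invr_gt0 ltr0n.
    have [N _ hN] : \forall n \near \oo,
        `|limn (f ^~ w) - f n w| <= k.+1%:R^-1 / 2.
      by move/cvgrPdist_le : cw => /(_ _ k0).
    exists N => n Nn; have := hN N (leqnn N); have := hN n Nn.
    move: (k.+1%:R^-1) (limn _) (f N w) (f n w) => e l u v /=.
    by rewrite !ler_norml; lra.
  apply/cauchy_cvgP; apply: cauchy_exP => e e0.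
  have ek : (Num.truncn e^-1).+1%:R^-1 < e.
    by rewrite invf_plt ?posrE ?ltr0n// truncnS_gt.
  have [N hN] := cw (Num.truncn e^-1); exists (f N w), N => // n Nn /=.
  exact: le_lt_trans (hN n Nn) ek.
have mD : measurable D.
  rewrite DE; apply: measurable_forallT => k.
  rewrite [X in measurable X](_ : _ = \bigcup_N [set w | forall n : nat, (N <= n)%N ->
      `|f N w - f n w| <= k.+1%:R^-1]); last first.
    by apply/seteqP; split=> w /= [N]; [exists N|move=> _; exists N].
  apply: bigcupT_measurable => N; apply: measurable_forall => n _.
  apply: measurable_set_le => //; apply: measurableT_comp => //.
  exact: measurable_funB.
rewrite -(setUv D); apply/measurable_funU => //; first exact: measurableC.
split.
  by apply: measurable_fun_cvg => [n|w Dw]; [exact: measurable_funTS (mf n)|exact: Dw].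
apply: (eq_measurable_fun (cst (point : R))) => [w|//].
by rewrite inE => /dvgP /= ->.
Qed.

Lemma measurable_bigmax_index (x0 : T -> R) (F : nat -> T -> R) (s : seq nat) :
  measurable_fun [set: T] x0 -> (forall i, measurable_fun [set: T] (F i)) ->
  measurable_fun [set: T] (fun w => \big[Num.max/x0 w]_(i <- s) F i w).
Proof.
move=> mx mF; elim: s => [|i s IH].
  by rewrite (_ : (fun _ => _) = x0)//; apply/funext => w; rewrite big_nil.
rewrite (_ : (fun _ => _) = fun w =>
    Num.max (F i w) (\big[Num.max/x0 w]_(i <- s) F i w)).
  exact: measurable_maxr.
by apply/funext => w; rewrite big_cons.
Qed.

Lemma measurable_linear_process (C : nat -> T -> R) (Z : int -> T -> R) i :
  (forall j, measurable_fun [set: T] (C j)) ->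
  (forall i, measurable_fun [set: T] (Z i)) ->
  measurable_fun [set: T] (linear_process C Z i).
Proof.
move=> mC mZ; apply: (measurable_limn (f := fun n w =>
    series (linear_terms C Z i w) n)) => n.
by apply: measurable_sum => j; exact: measurable_funM.
Qed.

Lemma measurable_scaled_max (b : R) (X : int -> T -> R) k :
  (forall i, measurable_fun [set: T] (X i)) ->
  measurable_fun [set: T] (fun w => scaled_max b (fun i => X i w) k).
Proof.
by move=> mX; apply: measurable_funM => //; exact: measurable_bigmax_index.
Qed.

Lemma measurable_jump_maximum (C : nat -> T -> R) (Z : int -> T -> R) k :
  (forall j, measurable_fun [set: T] (C j)) ->
  (forall i, measurable_fun [set: T] (Z i)) ->
  measurable_fun [set: T] (fun w => jump_maximum C Z w k).
Proof.
move=> mC mZ; apply: measurable_bigmax_index => // i.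
apply: measurable_maxr; apply: measurable_funM.
- exact: measurable_C_plus.
- exact: measurable_maxr.
- by rewrite C_minusE; apply: measurable_C_plus => j; exact: measurableT_comp.
- by apply: measurable_maxr => //; exact: measurableT_comp.
Qed.

End measurability_of_maxima.

Lemma truncn_grid {R : realType} n K l : (0 < K)%N ->
  Num.truncn (n%:R * grid K l : R) = (n * l %/ K)%N.
Proof.
move=> K0; apply: truncn_def.
have K0' : 0 < K%:R :> R by rewrite ltr0n.
by rewrite /grid mulrA -natrM ler_pdivlMr// ltr_pdivrMr// -!natrM ler_nat
  ltr_nat leq_divM ltn_ceil.
Qed.

(** * Convergence of the partial maxima *)
Theorem theorem3p4 (R : realType)
  (d : measure_display) (Omega : measurableType d) (P : probability Omega R)
  (alpha p r : R) (L : R -> R) (a : nat -> R)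
  (Z : int -> Omega -> R) (C : nat -> Omega -> R)
  (d' : measure_display) (Omega' : measurableType d')
  (P' : probability Omega' R)
  (C1 C2 : Omega' -> R) (W1 W2 M : Omega' -> D_up R)
  (alpha_gt0 : 0 < alpha)
  (* (Z_i) is i.i.d. with regularly varying, balanced tails *)
  (mZ : forall i, measurable_fun [set: Omega] (Z i))
  (Z_indep : mutually_independent P Z)
  (Z_id : identically_distributed P Z)
  (L_sv : slowly_varying L)
  (Z_tail : forall x : R, 0 < x ->
    P [set w | x < `|Z 1 w|] = (x `^ (- alpha) * L x)%:E)
  (p_ge0 : 0 <= p) (p_le1 : p <= 1) (p_r : p + r = 1)
  (Z_right : fine (P [set w | x < Z 1 w]) / fine (P [set w | x < `|Z 1 w|])
    @[x --> +oo] --> p)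
  (Z_left : fine (P [set w | Z 1 w < - x]) / fine (P [set w | x < `|Z 1 w|])
    @[x --> +oo] --> r)
  (a_gt0 : forall n, 0 < a n)
  (a_norm : n%:R * fine (P [set w | a n < `|Z 1 w|]) @[n --> \oo] --> (1 : R))
  (* the random coefficients *)
  (mC : forall j, measurable_fun [set: Omega] (C j))
  (C_Z_indep : independent_sigma P (sigma_gen setT C) (sigma_gen setT Z))
  (X_cvg : forall i, {ae P, forall w, cvgn (series (linear_terms C Z i w))})
  (C_lt1 : alpha < 1 ->
    (exists2 delta : R, 0 < delta < alpha &
      (\sum_(0 <= j <oo) 'E_P[fun w => (`|C j w| `^ delta)%R] < +oo)%E) /\
    (exists2 gamma : R, alpha < gamma < 1 &
      (\sum_(0 <= j <oo) 'E_P[fun w => (`|C j w| `^ gamma)%R] < +oo)%E))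
  (C_eq1 : alpha = 1 ->
    exists2 delta : R, 0 < delta < alpha &
      (\sum_(0 <= j <oo) 'E_P[fun w => (`|C j w| `^ delta)%R] < +oo)%E)
  (C_gt1 : 1 < alpha ->
    (\sum_(0 <= j <oo) 'E_P[fun w => `|C j w|%R] < +oo)%E)
  (* the limit process *)
  (W1_extremal : stable_extremal_process P' p alpha W1)
  (W2_extremal : stable_extremal_process P' r alpha W2)
  (W_indep : independent_sigma P'
    (sigma_gen `[0, 1]%classic (fun t w => W1 w t))
    (sigma_gen `[0, 1]%classic (fun t w => W2 w t)))
  (mC1 : measurable_fun [set: Omega'] C1)
  (mC2 : measurable_fun [set: Omega'] C2)
  (C12_law : forall A : set (R * R), measurable A ->
    P' [set w | A (C1 w, C2 w)] = P [set w | A (C_plus C w, C_minus C w)])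
  (C12_W_indep : independent_sigma P'
    (sigma_gen [set: bool] (fun b => if b then C1 else C2))
    (<<s sigma_gen `[0, 1]%classic (fun t w => W1 w t) `|`
         sigma_gen `[0, 1]%classic (fun t w => W2 w t) >>))
  (M_random : random_element M)
  (M_def : {ae P', forall w (t : R), 0 <= t <= 1 ->
    M w t = Num.max (C1 w * W1 w t) (C2 w * W2 w t)}) :
  cvg_in_distribution P P'
    (fun n w => maxima_path n (fun i => linear_process C Z i w) (a_gt0 n)) M.
Proof.
pose tail (y : R) := fine (P [set w | y < `|Z 1 w|]).
have r_ge0 : 0 <= r by lra.
have mabs i (y : R) : measurable [set w | y < `|Z i w|].
  by apply: measurable_set_lt => //; exact: measurableT_comp.
have tail_noninc (x y : R) : x <= y -> tail y <= tail x.
  by move=> xy; apply: le_fine_probability => // w /=; exact: le_lt_trans.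
have tail_ge0 (x : R) : 0 <= tail x by exact: fine_probability_ge0.
have tailE (x : R) : 0 < x -> tail x = x `^ (- alpha) * L x.
  by move=> x0; rewrite /tail Z_tail.
have mray (y : R) : measurable [set x : R | y < `|x|].
  by apply: measurable_set_lt => //; exact: measurableT_comp.
have tailZ i (y : R) : fine (P [set w | y < `|Z i w|]) = tail y.
  by congr (fine _); exact: (Z_id i 1 _ (mray y)).
have ZZ i i' (y : R) : i != i' ->
    fine (P [set w | y < `|Z i w| /\ y < `|Z i' w|]) = tail y ^+ 2.
  move=> ii'.
  have uii : uniq [:: i; i'] by rewrite /= inE ii'.
  have := Z_indep _ _ uii (fun=> mray y).
  rewrite big_cons big_seq1 (_ : \bigcap_(_ in _) _ =
      [set w | y < `|Z i w| /\ y < `|Z i' w|]); last first.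
    apply/seteqP; split=> w /=.
      by move=> h; split; apply: h; rewrite /= !inE eqxx ?orbT.
    by move=> [h h'] j /=; rewrite !inE => /orP[]/eqP ->.
  move=> ->; rewrite fineM ?fin_num_measure//; last 2 first.
  - exact: mabs.
  - exact: mabs.
  by rewrite expr2; congr (_ * _); exact: tailZ.
have CZ j i : independent_functions P (C j) (Z i).
  move=> A B mA mB; apply: C_Z_indep.
    by apply: sigma_gen_preimage mA; exact: measurable_sigma_gen.
  by apply: sigma_gen_preimage mB; exact: measurable_sigma_gen.
have ES (f : nat -> Omega -> R) : (\sum_(0 <= j <oo) 'E_P[f j] =
    \sum_(0 <= j <oo) \int[P]_w (f j w)%:E)%E.
  by apply: eq_eseriesr => j _; rewrite unlock.
(* For alpha > 1 the exponent 1 is below alpha. *)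
have [delta [delta0 delta1 delta_alpha Csum]] : exists delta : R,
    [/\ 0 < delta, delta <= 1, delta < alpha &
     (\sum_(0 <= j <oo) \int[P]_w (`|C j w| `^ delta)%:E < +oo)%E].
  have [alt1|agt1|aeq1] := ltgtP alpha 1.
  - have [[delta /andP[d0 da] S] _] := C_lt1 alt1.
    exists delta; split => //; first exact/ltW/(lt_trans da).
    by rewrite -(ES (fun j w => `|C j w| `^ delta)).
  - exists 1; split => //; apply: le_lt_trans (C_gt1 agt1).
    rewrite (ES (fun j w => `|C j w|)) le_eqVlt; apply/orP; left; apply/eqP.
    by apply: eq_eseriesr => j _; apply: eq_integral => w _; rewrite powRr1.
  - have [delta /andP[d0 da] S] := C_eq1 aeq1.
    exists delta; split => //; first by rewrite -aeq1 ltW.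
    by rewrite -(ES (fun j w => `|C j w| `^ delta)).
have delta_lt : 0 < delta < alpha by rewrite delta0.
have geometric := tail_geometric_sum L_sv tailE tail_ge0 delta_lt.
have a_y := normalizer_cvgy L_sv tailE tail_noninc a_norm.
have tail_a := normalized_tail_cvg L_sv tailE tail_noninc a_norm.
have right_tail (y : R) : 0 < y ->
    n%:R * fine (P [set w | a n * y < Z 1 w]) @[n --> \oo] --> p * y `^ (- alpha).
  move=> y0; exact: (normalized_balanced_tail_cvg L_sv tailE tail_noninc
    a_norm y0 Z_right).
have left_tail (y : R) : 0 < y ->
    n%:R * fine (P [set w | Z 1 w < - (a n * y)]) @[n --> \oo] -->
    r * y `^ (- alpha).
  move=> y0; exact: (normalized_balanced_tail_cvg L_sv tailE tail_noninc
    a_norm y0 Z_left).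
have mX i : measurable_fun [set: Omega] (linear_process C Z i).
  exact: measurable_linear_process.
have mCp : measurable_fun [set: Omega] (C_plus C) by exact: measurable_C_plus.
have mCm : measurable_fun [set: Omega] (C_minus C).
  by rewrite C_minusE; apply: measurable_C_plus => j; exact: measurableT_comp.
have Cm_ge0 w : 0 <= C_minus C w by rewrite C_minusE; exact: C_plus_ge0.
(* C1 and C2 share the law of the nonnegative suprema. *)
have C0 : {ae P', forall w, 0 <= C1 w /\ 0 <= C2 w}.
  pose N : set (R * R) := [set u | u.1 < 0] `|` [set u | u.2 < 0].
  have mN : measurable N by apply: measurableU; exact: measurable_set_lt.
  exists [set w | N (C1 w, C2 w)]; split.
  - rewrite (_ : [set w | _] = [set w | C1 w < 0] `|` [set w | C2 w < 0])//.
    by apply: measurableU; exact: measurable_set_lt.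
  - rewrite C12_law// [X in P X](_ : _ = set0) ?measure0//.
    apply/seteqP; split=> w //= []/=; rewrite ltNge.
      by rewrite C_plus_ge0.
    by rewrite Cm_ge0.
  - move=> w /=; apply: contra_notP => nN; split; rewrite leNgt; apply/negP => h.
      by apply: nN; left.
    by apply: nN; right.
apply: (cvg_in_distribution_fidi (Y' := positive_max C1 C2 W1 W2)) => //.
- move=> n t _; rewrite /= (_ : (fun _ => _) = fun w =>
      scaled_max (a n) (fun i => linear_process C Z i w) (Num.truncn (n%:R * t))).
    exact: measurable_scaled_max.
  by apply/funext => w; rewrite /= maxima_funE.
- by move=> t t01; exact: (measurable_positive_max W1_extremal W2_extremal mC1 mC2).
- exact: (positive_max_ae W1_extremal W2_extremal C0 M_def).
move=> K x K0 x0.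
pose A n l w := scaled_max (a n) (fun i => linear_process C Z i w) (n * l %/ K).
pose J n l w := (a n)^-1 * jump_maximum C Z w (n * l %/ K).
have mA n l : measurable_fun [set: Omega] (A n l) by exact: measurable_scaled_max.
have mJ n l : measurable_fun [set: Omega] (J n l).
  by apply: measurable_funM => //; exact: measurable_jump_maximum.
have close (eps eta : R) : 0 < eps -> 0 < eta -> \forall n \near \oo,
    exists E : set Omega, [/\ measurable E, fine (P E) <= eta &
    forall w, ~ E w -> forall l, (l <= K)%N -> `|A n l w - J n l w| <= eps].
  by move=> eps0 eta0; exact: (jump_approximation delta0 delta1 mC mZ CZ tailZ
    ZZ Csum geometric a_gt0 a_y tail_a K0 eps0 eta0).
have XA n w (l : 'I_K.+1) : maxima_path n
    (fun i => linear_process C Z i w) (a_gt0 n) (grid K l) = A n l w.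
  by rewrite /= maxima_funE truncn_grid.
rewrite (_ : (fun n => _) = fun n =>
    fine (P [set w | forall l : 'I_K.+1, A n l w <= x l])); last first.
  apply/funext => n; congr (fine (P _)); apply/seteqP; split=> w h l;
    by have := h l; rewrite XA.
have J0 n l w : 0 <= J n l w.
  rewrite mulr_ge0 ?invr_ge0 ?(ltW (a_gt0 n))//.
  by rewrite /jump_maximum; elim/big_ind : _ => // [u v u0 v0|i _];
    [rewrite le_max u0|exact/jump_ge0/C_plus_ge0].
(* Below a negative level both sides vanish. *)
have [[i0 xi0]|xpos] := pselect (exists i, x i < 0).
  rewrite [X in P' X](_ : _ = set0); last first.
    apply/seteqP; split=> w //= /(_ i0); rewrite leNgt (lt_le_trans xi0)//.
    exact: positive_max_ge0.
  by rewrite measure0/=; exact: (sandwich_negative_level mA close J0 xi0).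
have {}xpos i : 0 < x i.
  rewrite lt_neqAle eq_sym x0/= leNgt; apply/negP => xi; apply: xpos.
  by exists i.
pose y := tail_min x.
have y0 l : 0 < y l by exact: tail_min_gt0.
have yh : {homo y : l l' / (l <= l')%N >-> l <= l'} by exact: tail_min_homo.
have Ah n w l l' : (l <= l')%N -> (l' <= K)%N -> A n l w <= A n l' w.
  move=> ll' _; apply: scaled_max_homo; first exact: a_gt0.
  by rewrite leq_div2r// leq_mul2l ll' orbT.
have Mh w l l' : (l <= l')%N -> (l' <= K)%N ->
    positive_max C1 C2 W1 W2 w (grid K l) <= positive_max C1 C2 W1 W2 w (grid K l').
  move=> ll' l'K; have /andP[l0 _] := @grid_itv R _ _ (leq_trans ll' l'K).
  have /andP[_ l1] := @grid_itv R _ _ l'K.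
  by apply: positive_max_homo => //; exact: grid_homo.
rewrite (_ : (fun n => _) = fun n =>
    fine (P [set w | forall l, (l <= K)%N -> A n l w <= y l])); last first.
  apply/funext => n; congr (fine (P _)); apply/seteqP; split=> w;
    by move=> /(tail_min_leP x (Ah n w)).
rewrite [X in P' X](_ : _ = [set w | forall l, (l <= K)%N ->
    positive_max C1 C2 W1 W2 w (grid K l) <= 1 * y l]); last first.
  apply/seteqP; split=> w.
    by move=> /(tail_min_leP x (Mh w)) h l lK; rewrite mul1r; exact: h.
  by move=> h; apply/(tail_min_leP x (Mh w)) => l lK; rewrite -[leRHS]mul1r; exact: h.
rewrite (positive_max_cdf_law alpha_gt0 p_ge0 r_ge0 W1_extremal W2_extremal
  W_indep mC1 mC2 C12_W_indep K0 y0 yh ltr01 mCp mCm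
  (fun w => C_plus_ge0 C w) Cm_ge0 C12_law).
have block (u1 u2 z : R) : 0 <= u1 -> 0 <= u2 -> 0 < z ->
    fine (P [set w | forall k : nat, (0 < k <= n)%N ->
      jump u1 u2 (Z k w) <= z * y (block_index K n k) * a n]) @[n --> \oo] -->
    frechet_block alpha p r K y u1 u2 z.
  by move=> u10 u20 z0; exact: (block_probability_cvg mZ Z_indep Z_id alpha_gt0
    a_gt0 right_tail left_tail K0 y0 u10 u20 z0).
apply: (sandwich_cdf_cvg (J := J) (H := fun z => (\int[P]_w
  frechet_block alpha p r K y (C_plus C w) (C_minus C w) z)%R) mA mJ close y0).
- by move=> l _; exact: yh.
- by move=> z z0; exact: (jump_maximum_cdf_cvg mC mZ C_Z_indep a_gt0 K0 y0 yh
    block z0).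
- by move=> e e0; exact: mixed_frechet_continuous p_ge0 r_ge0 y0 mCp mCm _ e0.
Qed.
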